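(* Let $\theta\colon(R,\mathfrak{m})\to(S,\mathfrak{n})$ be a finite local extension of $F$-finite noetherian local $\mathbb{F}_p$-algebras, with $S$ satisfying $\mathbf{S}_1$, defining a cover $f\colon\operatorname{Spec}S\to\operatorname{Spec}R$. Suppose that $R$ is an integral domain with field of fractions $K$, set $L=S\otimes_RK$ and $[L:K]=\dim_KL$. Suppose that there is an $S$-linear map $\sigma_R\colon S\to\omega_{S/R}=\operatorname{Hom}_R(S,R)$ that is a generic isomorphism and such that $T=\sigma_R(1)$ is surjective and $T(\mathfrak{n})\subset\mathfrak{m}$. Let $\mathcal{C}$ be a Cartier $R$-algebra acting on $R$ such that $R$ is a $T$-transposable Cartier $\mathcal{C}$-module. Then $$\beta(S,f^*\mathcal{C})\cap R=\beta(R,\mathcal{C})$$ and $$[\kappa(\mathfrak{n}):\kappa(\mathfrak{m})]\cdot r(S,f^*\mathcal{C})=\big[\kappa(\beta(S,f^*\mathcal{C})):\kappa(\beta(R,\mathcal{C}))\big]\cdot r(R,\mathcal{C}),$$ where $\kappa(-)$ denotes residue fields. In particular, $(R,\mathcal{C})$ is $F$-pure (resp. $F$-regular) if and only if so is $(S,f^*\mathcal{C})$. In the $F$-regular case, $$[\kappa(\mathfrak{n}):\kappa(\mathfrak{m})]\cdot s(S,f^*\mathcal{C})=[L:K]\cdot s(R,\mathcal{C}).$$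
   Context: $p$ is a prime, $F^e$ the iterated Frobenius, $q=p^e$. $\mathbf{S}_1$: $\operatorname{depth}S_x\ge\min\{1,\dim S_x\}$ for all primes $x$. ''Generic isomorphism'' means an isomorphism after $K\otimes_R-$; it is part of the setup that $L=K\otimes_RS$ is the total ring of fractions of $S$ (so $\sigma_R$ is injective). Cartier algebras. A Cartier $R$-algebra is an $\mathbb{N}$-graded ring $\mathcal{C}=\bigoplus_{e\ge0}\mathcal{C}_e$ with $\mathcal{C}_0=R$ and $r\cdot\kappa=\kappa\cdot r^{q}$ for $r\in R$, $\kappa\in\mathcal{C}_e$. That $\mathcal{C}$ acts on $R$ means a homomorphism of Cartier algebras $\mathcal{C}\to\mathcal{C}_R=\bigoplus_e\operatorname{Hom}_R(F^e_*R,R)$ is given (product $\varphi_e\cdot\varphi_d=\varphi_e\circ F^e_*\varphi_d$). $f^*\mathcal{C}=\bigoplus_e\mathcal{C}_e\otimes_RS$ is the Cartier $S$-algebra with $s\cdot(\kappa_e\otimes s')=\kappa_e\otimes s^{q}s'$. Transposability. $\varphi\in\operatorname{Hom}_R(F^e_*R,R)$ is $T$-transposable if there is a (necessarily unique) $\varphi^\top\in\operatorname{Hom}_S(F^e_*S,S)$ with $\varphi\circ F^e_*T=T\circ\varphi^\top$. $R$ is a $T$-transposable Cartier $\mathcal{C}$-module if every homogeneous element of $\mathcal{C}$ acts on $R$ through a $T$-transposable map (this is automatic if $\sigma_R$ is an isomorphism). Then $f^*\mathcal{C}$ acts on $S$ by $\varphi\otimes s\mapsto\varphi^\top\cdot s$,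 with $(\varphi^\top\cdot s)(F^e_*x)=\varphi^\top(F^e_*sx)$. Invariants of a local ring $(R,\mathfrak{m},k)$ with a Cartier algebra $\mathcal{C}$ acting on $R$ (applied also to $(S,f^*\mathcal{C})$). - Splitting prime: $\beta(R,\mathcal{C})=\{r\in R\mid\kappa\cdot r\in\mathfrak{m}\text{ for all }e\ge1,\ \kappa\in\mathcal{C}_e\}$. The pair is $F$-pure if $\beta(R,\mathcal{C})$ is a proper ideal (then it is a prime ideal and the largest proper Cartier submodule of $R$), and $F$-regular if $\beta(R,\mathcal{C})=0$ (equivalently $R$ is simple as a $\mathcal{C}$-module). - Splitting numbers: $a_e(R,\mathcal{C})=\lambda_R(\mathcal{C}_e/\mathcal{C}_e^{\mathrm{ns}})$, the length as left $R$-module, where $\mathcal{C}_e^{\mathrm{ns}}=\{\kappa\in\mathcal{C}_e\mid\kappa\cdot R\subset\mathfrak{m}\}$. - $F$-signature: $s(R,\mathcal{C})=\lim_{e\to\infty}a_{en}(R,\mathcal{C})/p^{en\delta}$, where $n=\gcd\{e\ge1\mid a_e(R,\mathcal{C})\ne0\}$ and $\delta=\dim R+\log_p[k^{1/p}:k]$ (the limit exists; $s=0$ if all $a_e$ with $e\ge1$ vanish). - Splitting ratio: if $(R,\mathcal{C})$ is $F$-pure and $\beta=\beta(R,\mathcal{C})$, each map $\varphi$ in the image of $\mathcal{C}_e\to\operatorname{Hom}_R(F^e_*R,R)$ induces $\overline\varphi\colon F^e_*(R/\beta)\to R/\beta$; these form a Cartier $R/\beta$-algebra $\overline{\mathcal{C}}$,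 and $r(R,\mathcal{C})=s(R/\beta,\overline{\mathcal{C}})$. If $(R,\mathcal{C})$ is not $F$-pure, $r(R,\mathcal{C})=0$ and the displayed formula for $r$ is read as $0=0$. *)

(* Defs.v *)
From HB Require Import structures.
From mathcomp Require Import all_boot all_order all_algebra.
From mathcomp Require Import generic_quotient ring_quotient fraction.
From mathcomp Require Import ring.
From mathcomp Require Import boolp classical_sets functions.
From mathcomp Require Import reals constructive_ereal ereal topology sequences exp.

Set Implicit Arguments.
Unset Strict Implicit.
Unset Printing Implicit Defensive.

Import Order.TTheory GRing.Theory Num.Theory.
Local Open Scope ring_scope.
Local Open Scope quotient_scope.

Section SubZmod.
Variables (V : zmodType) (P : zmodClosed V).
Record zsub := ZSub { zval : V; zvalP : zval \in P }.
HB.instance Definition _ := [isSub for zval].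
HB.instance Definition _ := [Choice of zsub by <:].
HB.instance Definition _ := [SubChoice_isSubZmodule of zsub by <:].
End SubZmod.

Section SubLmod.
Variables (A : nzRingType) (V : lmodType A).

Definition submod_pred (N : submodClosed V) : {pred V} := N.
Lemma submod_zmod (N : submodClosed V) : zmod_closed (submod_pred N).
Proof.
split; first exact: rpred0.
by move=> u v uN vN; rewrite -scaleN1r; apply: rpredD => //; apply: rpredZ.
Qed.
HB.instance Definition _ (N : submodClosed V) :=
  GRing.isZmodClosed.Build V (submod_pred N) (submod_zmod N).

Definition lquot (N : submodClosed V) := {ideal_quot (submod_pred N)}.
HB.instance Definition _ N := GRing.Zmodule.on (lquot N).

Section Quot.
Variable N : submodClosed V.
Definition lquot_scale (a : A) (x : lquot N) : lquot N := \pi_(lquot N) (a *: repr x).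

Lemma lquot_eq (x y : V) : x - y \in N -> \pi_(lquot N) x = \pi_(lquot N) y.
Proof. by move=> h; apply/eqP; rewrite -Quotient.idealrBE. Qed.

Lemma lquot_repr (x : V) : repr (\pi_(lquot N) x) - x \in N.
Proof.
have /eqP : \pi_(lquot N) (repr (\pi_(lquot N) x)) = \pi_(lquot N) x by rewrite reprK.
by rewrite -Quotient.idealrBE.
Qed.

Lemma lquot_scaleE a x : lquot_scale a (\pi_(lquot N) x) = \pi_(lquot N) (a *: x).
Proof.
apply: lquot_eq; rewrite -scalerBr; apply: rpredZ; exact: lquot_repr.
Qed.

Lemma lquotD x y : \pi_(lquot N) (x + y) = \pi_(lquot N) x + \pi_(lquot N) y.
Proof. exact: (@Quotient.pi_add V (submod_pred N)). Qed.

Lemma lquot_ind (P : lquot N -> Prop) :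
  (forall x, P (\pi_(lquot N) x)) -> forall x, P x.
Proof. by move=> h x; rewrite -[x]reprK. Qed.

Fact lquot_scaleA a b v : lquot_scale a (lquot_scale b v) = lquot_scale (a * b) v.
Proof. by elim/lquot_ind: v => v; rewrite !lquot_scaleE scalerA. Qed.
Fact lquot_scale1 : left_id 1 lquot_scale.
Proof. by elim/lquot_ind => v; rewrite !lquot_scaleE scale1r. Qed.
Fact lquot_scaleDr : right_distributive lquot_scale +%R.
Proof.
move=> a; elim/lquot_ind => u; elim/lquot_ind => v.
by rewrite -lquotD !lquot_scaleE scalerDr lquotD.
Qed.
Fact lquot_scaleDl v : {morph lquot_scale^~ v: a b / a + b}.
Proof.
by move=> a b; elim/lquot_ind: v => v; rewrite !lquot_scaleE scalerDl lquotD.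
Qed.
HB.instance Definition _ := GRing.Zmodule_isLmodule.Build A (lquot N)
  lquot_scaleA lquot_scale1 lquot_scaleDr lquot_scaleDl.
End Quot.
End SubLmod.

Section Tensor.
Variables (A : comNzRingType) (M N : lmodType A).

(* A list stands for the formal sum of its entries; [tens_rel] is the congruence
   generated by commutativity and the usual relations, and [(- m, n)] is an
   opposite of [(m, n)] modulo these. *)
Inductive tens_rel : seq (M * N) -> seq (M * N) -> Prop :=
| tens_refl s : tens_rel s s
| tens_sym s t : tens_rel s t -> tens_rel t s
| tens_trans s t u : tens_rel s t -> tens_rel t u -> tens_rel s u
| tens_cat s s' t t' : tens_rel s s' -> tens_rel t t' -> tens_rel (s ++ t) (s' ++ t')
| tens_comm s t : tens_rel (s ++ t) (t ++ s)
| tens_addl m m' n : tens_rel [:: (m + m', n)] [:: (m, n); (m', n)]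
| tens_addr m n n' : tens_rel [:: (m, n + n')] [:: (m, n); (m, n')]
| tens_bal a m n : tens_rel [:: (a *: m, n)] [:: (m, a *: n)]
| tens_zero n : tens_rel [:: (0, n)] [::].

Definition tens_relb : rel (seq (M * N)) := fun s t => `[< tens_rel s t >].
Fact tens_relb_equiv : equiv_class_of tens_relb.
Proof.
split=> [s|s t|t s u].
- by apply/asboolP; apply: tens_refl.
- by apply/asboolP/asboolP; apply: tens_sym.
- by move=> /asboolP h /asboolP k; apply/asboolP; apply: tens_trans h k.
Qed.
Canonical tens_equiv := EquivRelPack tens_relb_equiv.
Canonical tens_encModRel := defaultEncModRel tens_relb.

Definition tens := {eq_quot tens_relb}.
HB.instance Definition _ : EqQuotient _ tens_relb tens := EqQuotient.on tens.
HB.instance Definition _ := Choice.on tens.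

Definition tensf (s : seq (M * N)) : tens := \pi_tens s.
Definition tensor (m : M) (n : N) : tens := tensf [:: (m, n)].

Lemma tensfP s t : tens_rel s t <-> tensf s = tensf t.
Proof.
split=> [h|/eqP]; first by apply/eqP; rewrite piE; apply/asboolP.
by rewrite piE => /asboolP.
Qed.

Lemma tensf_repr s : tens_rel (repr (tensf s)) s.
Proof. by apply/tensfP; rewrite /tensf reprK. Qed.

Lemma tensfW (P : tens -> Prop) : (forall s, P (tensf s)) -> forall x, P x.
Proof. by move=> h x; rewrite -[x]reprK; apply: h. Qed.

Definition tens_add (x y : tens) : tens := tensf (repr x ++ repr y).
Definition tens_opp (x : tens) : tens := tensf [seq (- u.1, u.2) | u <- repr x].

Lemma tens_addE s t : tens_add (tensf s) (tensf t) = tensf (s ++ t).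
Proof. by apply/tensfP; apply: tens_cat; apply: tensf_repr. Qed.

Fact tens_addA : associative tens_add.
Proof.
by elim/tensfW=> s; elim/tensfW=> t; elim/tensfW=> u; rewrite !tens_addE catA.
Qed.
Fact tens_addC : commutative tens_add.
Proof.
elim/tensfW=> s; elim/tensfW=> t; rewrite !tens_addE.
by apply/tensfP; apply: tens_comm.
Qed.
Fact tens_add0 : left_id (tensf [::]) tens_add.
Proof. by elim/tensfW=> s; rewrite tens_addE. Qed.
Fact tens_addN : left_inverse (tensf [::]) tens_opp tens_add.
Proof.
move=> x; rewrite -{2}[x]reprK; rewrite -[\pi_tens _]/(tensf _) tens_addE.
apply/tensfP; elim: (repr x) => [|[m n] s IH] /=; first exact: tens_refl.
set s' := map _ s in IH *.
have h : tens_rel [:: (- m, n); (m, n)] [::].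
  apply: (tens_trans (tens_sym (tens_addl _ _ _))).
  by rewrite addNr; apply: tens_zero.
have k : tens_rel (s' ++ (m, n) :: s) ((m, n) :: s' ++ s).
  rewrite -cat1s catA -[_ :: _ ++ _]/(([:: (m, n)] ++ s') ++ s).
  by apply: tens_cat; [apply: tens_comm | apply: tens_refl].
apply: tens_trans (_ : tens_rel _ ([:: (-m, n); (m, n)] ++ (s' ++ s))) _.
  by rewrite -cat1s; apply: (@tens_cat [:: _] [:: _]); [apply: tens_refl | exact: k].
exact: tens_cat h IH.
Qed.
HB.instance Definition _ := GRing.isZmodule.Build tens
  tens_addA tens_addC tens_add0 tens_addN.

Lemma tensDl n : {morph tensor^~ n : m m' / m + m'}.
Proof.
move=> m m'; rewrite -[RHS]/(tens_add _ _) tens_addE.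
by apply/tensfP; apply: tens_addl.
Qed.
Lemma tensDr m : {morph tensor m : n n' / n + n'}.
Proof.
move=> n n'; rewrite -[RHS]/(tens_add _ _) tens_addE.
by apply/tensfP; apply: tens_addr.
Qed.
Lemma tens_balanced a m n : tensor (a *: m) n = tensor m (a *: n).
Proof. by apply/tensfP; apply: tens_bal. Qed.
Lemma tens0l n : tensor 0 n = 0.
Proof. by apply/tensfP; apply: tens_zero. Qed.

Lemma tens_ind (P : tens -> Prop) :
  (forall m n, P (tensor m n)) -> (forall x y, P x -> P y -> P (x + y)) ->
  forall x, P x.
Proof.
move=> hp hD; elim/tensfW; elim=> [|[m n] s IH].
  by rewrite -[tensf _]/(0 : tens) -(tens0l 0).
have -> : tensf ((m, n) :: s) = tensor m n + tensf s.
  by rewrite -[RHS]/(tens_add _ _) tens_addE.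
exact: hD.
Qed.

Section Lift.
Variables (W : zmodType) (g : M -> N -> W).
Definition balanced :=
  [/\ forall n, {morph g^~ n : m m' / m + m'},
      forall m, {morph g m : n n' / n + n'} &
      forall a m n, g (a *: m) n = g m (a *: n)].

Definition tens_lift (x : tens) : W := \sum_(u <- repr x) g u.1 u.2.

Hypothesis gP : balanced.
Lemma tens_lift_rel s t : tens_rel s t ->
  \sum_(u <- s) g u.1 u.2 = \sum_(u <- t) g u.1 u.2.
Proof.
case: gP => gl gr gb; elim=> {s t} //.
- by move=> s t u _ -> _ ->.
- by move=> s s' t t' _ h _ k; rewrite !big_cat /= h k.
- by move=> s t; rewrite !big_cat /= addrC.
- by move=> m m' n; rewrite !big_cons !big_nil /= gl !addr0.
- by move=> m n n'; rewrite !big_cons !big_nil /= gr !addr0.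
- by move=> a m n; rewrite !big_cons !big_nil /= gb.
- move=> n; rewrite !big_cons !big_nil /= addr0.
  by apply: (@addrI _ (g 0 n)); rewrite -gl !addr0.
Qed.
Lemma tens_liftE m n : tens_lift (tensor m n) = g m n.
Proof.
by rewrite /tens_lift (tens_lift_rel (tensf_repr _)) big_cons big_nil /= addr0.
Qed.
Lemma tens_liftD : {morph tens_lift : x y / x + y}.
Proof.
elim/tensfW=> s; elim/tensfW=> t; rewrite -[_ + _]/(tens_add _ _) tens_addE.
by rewrite /tens_lift !(tens_lift_rel (tensf_repr _)) big_cat.
Qed.
End Lift.
End Tensor.

Lemma morphD_eq0 (U V : zmodType) (f : U -> V) : {morph f : x y / x + y} -> f 0 = 0.
Proof. by move=> fD; apply: (@addrI _ (f 0)); rewrite -fD !addr0. Qed.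

Section TensorMap.
Variables (A : comNzRingType) (M N N' : lmodType A).
(* [id_M (x) f] *)
Definition tens_map (f : N -> N') : tens M N -> tens M N' :=
  tens_lift (fun m n => tensor m (f n)).
End TensorMap.

Section TensorAlgebra.
Variables (A : comNzRingType) (B C : comAlgType A).
Implicit Types (x y z : tens B C).

Definition talg := tens B C.
HB.instance Definition _ := GRing.Zmodule.on talg.

Definition talg_mul1 (b : B) (c : C) : tens B C -> tens B C :=
  tens_lift (fun b' c' => tensor (b * b') (c * c')).
Definition talg_mul (x y : talg) : talg := tens_lift talg_mul1 x y.

Lemma talg_bal1 b c : balanced (fun b' c' => tensor (b * b') (c * c') : tens B C).
Proof.
split=> [n m m'|m n n'|a m n]; rewrite ?mulrDr ?tensDl ?tensDr //.
by rewrite -!scalerAr tens_balanced.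
Qed.
Lemma talg_bal2 : balanced talg_mul1.
Proof.
split=> [n m m'|m n n'|a m n]; apply/funext => z; elim/tens_ind: z.
- move=> b c; rewrite !fctE /talg_mul1 !(tens_liftE (talg_bal1 _ _)).
  by rewrite mulrDl tensDl.
- move=> x y hx hy; move: hx hy; rewrite !fctE /talg_mul1.
  by rewrite !(tens_liftD (talg_bal1 _ _)) => -> ->; rewrite addrACA.
- move=> b c; rewrite !fctE /talg_mul1 !(tens_liftE (talg_bal1 _ _)).
  by rewrite mulrDl tensDr.
- move=> x y hx hy; move: hx hy; rewrite !fctE /talg_mul1.
  by rewrite !(tens_liftD (talg_bal1 _ _)) => -> ->; rewrite addrACA.
- move=> b c; rewrite /talg_mul1 !(tens_liftE (talg_bal1 _ _)).
  by rewrite -!scalerAl tens_balanced.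
- move=> x y hx hy; move: hx hy; rewrite /talg_mul1.
  by rewrite !(tens_liftD (talg_bal1 _ _)) => -> ->.
Qed.
Lemma talg_mulE b c b' c' :
  talg_mul (tensor b c) (tensor b' c') = tensor (b * b') (c * c').
Proof.
by rewrite /talg_mul (tens_liftE talg_bal2) /talg_mul1 (tens_liftE (talg_bal1 _ _)).
Qed.
Fact talg_mulDl : left_distributive talg_mul +%R.
Proof. by move=> x y z; rewrite /talg_mul (tens_liftD talg_bal2). Qed.
Fact talg_mulC : commutative talg_mul.
Proof.
have mulDr : right_distributive talg_mul +%R.
  move=> x y z; elim/tens_ind: x => [b c|x x' hx hx'].
    rewrite /talg_mul !(tens_liftE talg_bal2) /talg_mul1.
    by rewrite (tens_liftD (talg_bal1 _ _)).
  by rewrite !talg_mulDl hx hx' addrACA.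
elim/tens_ind=> [b c|x x' hx hx'] y; last by rewrite talg_mulDl mulDr hx hx'.
elim/tens_ind: y => [b' c'|y y' hy hy']; last by rewrite talg_mulDl mulDr hy hy'.
by rewrite !talg_mulE mulrC [c * _]mulrC.
Qed.
Fact talg_mulDr : right_distributive talg_mul +%R.
Proof. by move=> x y z; rewrite ![talg_mul x _]talg_mulC talg_mulDl. Qed.
Fact talg_mulA : associative talg_mul.
Proof.
move=> x y z.
elim/tens_ind: x => [a b|x x' hx hx']; last by rewrite !talg_mulDl hx hx'.
elim/tens_ind: y => [c d|y y' hy hy']; last first.
  by rewrite talg_mulDl !talg_mulDr talg_mulDl hy hy'.
elim/tens_ind: z => [e f|z z' hz hz']; last by rewrite !talg_mulDr hz hz'.
by rewrite !talg_mulE !mulrA.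
Qed.
Fact talg_mul1l : left_id (tensor 1 1) talg_mul.
Proof.
elim/tens_ind => [b c|x y hx hy]; last by rewrite talg_mulDr hx hy.
by rewrite talg_mulE !mul1r.
Qed.
HB.instance Definition _ := GRing.Zmodule_isComPzRing.Build talg
  talg_mulA talg_mulC talg_mul1l talg_mulDl.

Definition talg_inl (b : B) : talg := tensor b 1.
Definition talg_inr (c : C) : talg := tensor 1 c.
End TensorAlgebra.

(* The product is typed [C_d x C_e -> C_(d + e)]; equations between elements whose
   degrees are only provably equal are stated in the disjoint union of the
   [C_e] ([Tagged]).  The last axiom is [r . kappa = kappa . r ^ (p ^ e)]. *)
Record cartierAlg (p : nat) (A : comNzRingType) := CartierAlg {
  cpiece :> nat -> zmodType;
  cmul : forall d e, cpiece d -> cpiece e -> cpiece (d + e)%N;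
  cscal : A -> cpiece 0%N;
  cmulDl : forall d e (y : cpiece e), {morph (fun x : cpiece d => cmul x y) : x x' / x + x'};
  cmulDr : forall d e (x : cpiece d), {morph (fun y : cpiece e => cmul x y) : y y' / y + y'};
  cmulA : forall c d e (x : cpiece c) (y : cpiece d) (z : cpiece e),
    Tagged cpiece (cmul x (cmul y z)) = Tagged cpiece (cmul (cmul x y) z);
  cmul1l : forall e (x : cpiece e), Tagged cpiece (cmul (cscal 1) x) = Tagged cpiece x;
  cmul1r : forall e (x : cpiece e), Tagged cpiece (cmul x (cscal 1)) = Tagged cpiece x;
  cscal_bij : bijective cscal;
  cscalD : {morph cscal : a b / a + b};
  cscalM : forall a b, Tagged cpiece (cscal (a * b)) = Tagged cpiece (cmul (cscal a) (cscal b));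
  cscalC : forall e (x : cpiece e) a,
    Tagged cpiece (cmul (cscal a) x) = Tagged cpiece (cmul x (cscal (a ^+ (p ^ e))))
}.

Record cartierHom p A (C D : cartierAlg p A) := CartierHom {
  chom :> forall e, C e -> D e;
  chomD : forall e, {morph @chom e : x y / x + y};
  chomM : forall d e (x : C d) (y : C e), chom (cmul x y) = cmul (chom x) (chom y);
  chom_scal : forall a, chom (cscal C a) = cscal D a
}.

Section Graded.
Variables (C : nat -> Type).
Definition gcast m n (h : m = n) (x : C m) : C n := ecast i (C i) h x.
Lemma Tagged_gcast m n (h : m = n) x : Tagged C (gcast h x) = Tagged C x.
Proof. by case: n / h. Qed.
Lemma gcastP m n (h : m = n) (x : C m) (y : C n) :
  Tagged C x = Tagged C y <-> gcast h x = y.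
Proof.
split=> [|<-]; last by rewrite Tagged_gcast.
by case: n / h y => y; apply: (@eq_from_Tagged nat C m).
Qed.
End Graded.
Arguments gcast C [m n] h x.

Lemma gcastD (C : nat -> zmodType) m n (h : m = n) :
  {morph @gcast C m n h : x y / x + y}.
Proof. by case: n / h. Qed.

Section CartierBimodule.
Variables (p : nat) (A : comNzRingType) (C : cartierAlg p A).

Lemma cmul_Tagged c c' d d' (x : C c) (x' : C c') (y : C d) (y' : C d') :
  Tagged (cpiece C) x = Tagged (cpiece C) x' -> Tagged (cpiece C) y = Tagged (cpiece C) y' ->
  Tagged (cpiece C) (cmul x y) = Tagged (cpiece C) (cmul x' y').
Proof.
move=> hx hy.
pose m (u v : {e & C e}) := Tagged (cpiece C) (cmul (tagged u) (tagged v)).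
by rewrite -[LHS]/(m (Tagged (cpiece C) x) (Tagged (cpiece C) y)) hx hy.
Qed.

Lemma piece_inj e (x y : C e) : Tagged (cpiece C) x = Tagged (cpiece C) y -> x = y.
Proof. exact: (@eq_from_Tagged nat (cpiece C)). Qed.

(* [C_e] as a left and as a right [A]-module; [lpiece C e] and [rpiece C e] have
   the same underlying group [C e]. *)
Definition cleft e (a : A) (x : C e) : C e := cmul (cscal C a) x.
Definition cright e (a : A) (x : C e) : C e := gcast (cpiece C) (addn0 e) (cmul x (cscal C a)).

Lemma cright_Tagged e a (x : C e) : Tagged (cpiece C) (cright a x) = Tagged (cpiece C) (cmul x (cscal C a)).
Proof. exact: (Tagged_gcast (addn0 e)). Qed.
Lemma cleft_cright e a (x : C e) : cleft a x = cright (a ^+ (p ^ e)) x.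
Proof. by apply: piece_inj; exact: etrans (cscalC _ _) (esym (cright_Tagged _ _)). Qed.

Definition lpiece e : Type := C e.
HB.instance Definition _ e := GRing.Zmodule.on (lpiece e).
Definition rpiece e : Type := C e.
HB.instance Definition _ e := GRing.Zmodule.on (rpiece e).

Fact cleftA e a b (x : lpiece e) : cleft a (cleft b x) = cleft (a * b) x.
Proof.
apply: piece_inj; have h := cmul_Tagged (esym (cscalM C a b)) (erefl (Tagged (cpiece C) x)).
exact: (etrans (cmulA (cscal C a) (cscal C b) x) h).
Qed.
Fact cleft1 e : left_id 1 (@cleft e).
Proof. by move=> x; apply: piece_inj; exact: cmul1l. Qed.
Fact cleftDr e : right_distributive (@cleft e) +%R.
Proof. by move=> a x y; exact: (cmulDr (cscal C a) x y). Qed.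
Fact cleftDl e x : {morph (@cleft e)^~ x: a b / a + b}.
Proof. by move=> a b; rewrite /cleft cscalD; exact: (cmulDl x (cscal C a) (cscal C b)). Qed.
HB.instance Definition _ e := GRing.Zmodule_isLmodule.Build A (lpiece e)
  (@cleftA e) (@cleft1 e) (@cleftDr e) (@cleftDl e).

Fact crightA e a b (x : rpiece e) : cright a (cright b x) = cright (a * b) x.
Proof.
apply: piece_inj; rewrite mulrC; apply: etrans (cright_Tagged _ _) _.
apply: etrans (cmul_Tagged (cright_Tagged b x) erefl) _.
apply: etrans (esym (cmulA _ _ _)) _; apply: etrans _ (esym (cright_Tagged _ _)).
exact: cmul_Tagged erefl (esym (cscalM C b a)).
Qed.
Fact cright1 e : left_id 1 (@cright e).
Proof. by move=> x; apply: piece_inj; exact: etrans (cright_Tagged _ _) (cmul1r _). Qed.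
Fact crightDr e : right_distributive (@cright e) +%R.
Proof. by move=> a x y; rewrite /cright cmulDl gcastD. Qed.
Fact crightDl e x : {morph (@cright e)^~ x: a b / a + b}.
Proof. by move=> a b; rewrite /cright cscalD cmulDr gcastD. Qed.
HB.instance Definition _ e := GRing.Zmodule_isLmodule.Build A (rpiece e)
  (@crightA e) (@cright1 e) (@crightDr e) (@crightDl e).
End CartierBimodule.

Section PLinear.
Variables (p : nat) (A : comNzRingType).

(* The underlying set of [F^e_* A] is [A]: an element of [Hom_A(F^e_* A, A)] is
   an additive map [f : A -> A] such that [f (a ^ (p ^ e) x) = a f x]. *)
Definition plinear e (f : A -> A) : Prop :=
  {morph f : x y / x + y} /\ forall a x, f (a ^+ (p ^ e) * x) = a * f x.

Lemma plinear_comp d e f g : plinear d f -> plinear e g -> plinear (d + e) (f \o g).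
Proof.
move=> [fD fM] [gD gM]; split=> [x y|a x] /=; first by rewrite gD fD.
by rewrite expnD exprM gM fM.
Qed.

Record plinFamily := PlinFamily {
  pfam :> nat -> zmodClosed (A -> A);
  pfamP : forall e f, f \in pfam e -> plinear e f;
  pfam_comp : forall d e f g, f \in pfam d -> g \in pfam e -> f \o g \in pfam (d + e)%N;
  pfam_scal : forall a, *%R a \in pfam 0%N
}.

Section FunCartier.
Variable P : plinFamily.
Definition fpiece e : zmodType := zsub (P e).
Definition fmul d e (f : fpiece d) (g : fpiece e) : fpiece (d + e)%N :=
  ZSub (pfam_comp (zvalP f) (zvalP g)).
Definition fscal a : fpiece 0%N := ZSub (pfam_scal P a).

Lemma fpiece_eq d e (f : fpiece d) (g : fpiece e) :
  d = e -> zval f = zval g -> Tagged fpiece f = Tagged fpiece g.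
Proof. by move=> h; case: e / h g => g h; congr existT; apply: val_inj. Qed.

Fact fmulDl d e (y : fpiece e) : {morph (fun x : fpiece d => fmul x y) : x x' / x + x'}.
Proof. by move=> x x'; apply: val_inj. Qed.
Fact fmulDr d e (x : fpiece d) : {morph (fun y : fpiece e => fmul x y) : y y' / y + y'}.
Proof.
move=> y y'; apply: val_inj => /=; apply/funext => a.
by rewrite /= (pfamP (zvalP x)).1.
Qed.
Fact fmulA c d e (x : fpiece c) (y : fpiece d) (z : fpiece e) :
    Tagged fpiece (fmul x (fmul y z)) = Tagged fpiece (fmul (fmul x y) z).
Proof. by apply: fpiece_eq; rewrite ?addnA. Qed.
Fact fmul1l e (x : fpiece e) : Tagged fpiece (fmul (fscal 1) x) = Tagged fpiece x.
Proof. by apply: fpiece_eq => //; apply/funext => a /=; rewrite mul1r. Qed.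
Fact fmul1r e (x : fpiece e) : Tagged fpiece (fmul x (fscal 1)) = Tagged fpiece x.
Proof. by apply: fpiece_eq; rewrite ?addn0 //; apply/funext => a /=; rewrite mul1r. Qed.
Fact fscal_bij : bijective fscal.
Proof.
exists (fun f : fpiece 0%N => zval f 1) => [a|f]; first by rewrite /= mulr1.
apply: val_inj; apply/funext => a /=.
by have /(_ a 1) := (pfamP (zvalP f)).2; rewrite expr1 mulr1 mulrC => ->; rewrite mulrC.
Qed.
Fact fscalD : {morph fscal : a b / a + b}.
Proof. by move=> a b; apply: val_inj; apply/funext => x /=; rewrite mulrDl. Qed.
Fact fscalM a b :
  Tagged fpiece (fscal (a * b)) = Tagged fpiece (fmul (fscal a) (fscal b)).
Proof. by apply: fpiece_eq => //; apply/funext => x /=; rewrite mulrA. Qed.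
Fact fscalC e (x : fpiece e) a :
  Tagged fpiece (fmul (fscal a) x) = Tagged fpiece (fmul x (fscal (a ^+ (p ^ e)))).
Proof.
apply: fpiece_eq; first by rewrite addn0.
by apply/funext => b /=; rewrite (pfamP (zvalP x)).2.
Qed.

Definition funCartier : cartierAlg p A := CartierAlg
  fmulDl fmulDr fmulA fmul1l fmul1r fscal_bij fscalD fscalM fscalC.
End FunCartier.

Definition plin_pred e : {pred A -> A} := fun f => `[< plinear e f >].
Fact plin_zmod e : zmod_closed (plin_pred e).
Proof.
split=> [|f g /asboolP[fD fM] /asboolP[gD gM]]; apply/asboolP; split.
- by move=> x y; rewrite addr0.
- by move=> a x; rewrite mulr0.
- by move=> x y; rewrite !fctE fD gD opprD addrACA.
- by move=> a x; rewrite !fctE fM gM mulrBr.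
Qed.
HB.instance Definition _ e := GRing.isZmodClosed.Build (A -> A) (plin_pred e) (plin_zmod e).
Fact plin_predP e f : f \in plin_pred e -> plinear e f.
Proof. by move/asboolP. Qed.
Fact plin_comp d e f g :
  f \in plin_pred d -> g \in plin_pred e -> f \o g \in plin_pred (d + e).
Proof. by move=> /asboolP hf /asboolP hg; apply/asboolP; apply: plinear_comp. Qed.
Fact plin_scal a : *%R a \in plin_pred 0.
Proof.
apply/asboolP; split=> [x y|b x]; first by rewrite mulrDr.
by rewrite expr1 mulrCA.
Qed.
Definition plinAll : plinFamily := PlinFamily plin_predP plin_comp plin_scal.

(* [C_A = (+)_e Hom_A(F^e_* A, A)] *)
Definition cartierFull : cartierAlg p A := funCartier plinAll.
End PLinear.

(* An action of [C] on [A] is a homomorphism [C -> C_A]; [act k r] is [k . r]. *)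
Definition cartierAction p A (C : cartierAlg p A) := cartierHom C (cartierFull p A).
Definition act p A (C : cartierAlg p A) (phi : cartierAction C) e (k : C e) : A -> A :=
  zval (phi e k).

Section Pullback.
Variables (p : nat) (R : comNzRingType) (S : comAlgType R) (pchS : p \in [pchar S]).
Variable C : cartierAlg p R.

Lemma frobD e (x y : S) : (x + y) ^+ (p ^ e) = x ^+ (p ^ e) + y ^+ (p ^ e).
Proof.
elim: e => [|e IH]; first by rewrite !expr1.
rewrite expnSr !exprM IH; exact: (rmorphD (pFrobenius_aut pchS)).
Qed.

Definition pbpiece e : zmodType := tens (rpiece C e) S.
Definition pbtens e (k : C e) (s : S) : pbpiece e := @tensor R (rpiece C e) S k s.

Lemma pbtensDl e (k k' : C e) s : pbtens (k + k') s = pbtens k s + pbtens k' s.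
Proof. exact: (tensDl s (k : rpiece C e) k'). Qed.
Lemma pbtensDr e (k : C e) s s' : pbtens k (s + s') = pbtens k s + pbtens k s'.
Proof. exact: (tensDr (k : rpiece C e) s s'). Qed.
Lemma pbtens_bal e (k : C e) a s : pbtens (cright a k) s = pbtens k (a *: s).
Proof. exact: (tens_balanced a (k : rpiece C e) s). Qed.
Lemma pbpiece_ind e (P : pbpiece e -> Prop) :
  (forall k s, P (pbtens k s)) -> (forall x y, P x -> P y -> P (x + y)) ->
  forall x, P x.
Proof. exact: (@tens_ind R (rpiece C e) S P). Qed.
Lemma pbtens_gcast d e (h : d = e) (k : C d) s :
  gcast pbpiece h (pbtens k s) = pbtens (gcast (cpiece C) h k) s.
Proof. by case: e / h. Qed.
Lemma pbtens_Tagged d e (k : C d) (k' : C e) s : d = e ->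
  Tagged (cpiece C) k = Tagged (cpiece C) k' ->
  Tagged pbpiece (pbtens k s) = Tagged pbpiece (pbtens k' s).
Proof. by move=> h; case: e / h k' => k' /piece_inj ->. Qed.

(* [(k (x) s) (k' (x) s') = k k' (x) s^(p^e) s'] for [k'] of degree [e]. *)
Definition pbmul1 d e (k : C d) (s : S) : pbpiece e -> pbpiece (d + e)%N :=
  @tens_lift R (rpiece C e) S _
    (fun (k' : C e) s' => pbtens (cmul k k') (s ^+ (p ^ e) * s')).
Definition pbmul d e (x : pbpiece d) (y : pbpiece e) : pbpiece (d + e)%N :=
  @tens_lift R (rpiece C d) S _ (@pbmul1 d e) x y.

Lemma cmul_cright d e (a : R) (k : C d) (k' : C e) :
  cmul k (cright a k') = cright a (cmul k k').
Proof.
apply: piece_inj; apply: etrans (esym (cright_Tagged a (cmul k k'))).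
apply: etrans (cmulA k k' (cscal C a)).
exact: (cmul_Tagged (erefl (Tagged (cpiece C) k)) (cright_Tagged a k')).
Qed.
Lemma cright_cmul d e (a : R) (k : C d) (k' : C e) :
  cmul (cright a k) k' = cright (a ^+ (p ^ e)) (cmul k k').
Proof.
rewrite -cmul_cright -cleft_cright; apply: piece_inj.
apply: etrans (esym (cmulA k (cscal C a) k')).
exact: (cmul_Tagged (cright_Tagged a k) (erefl (Tagged (cpiece C) k'))).
Qed.

Lemma pbmul1_bal d e (k : C d) s :
  @balanced R (rpiece C e) S (pbpiece (d + e)%N)
    (fun (k' : C e) s' => pbtens (cmul k k') (s ^+ (p ^ e) * s')).
Proof.
split=> [n m m'|m n n'|a m n].
- by rewrite -pbtensDl -cmulDr.
- by rewrite mulrDr pbtensDr.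
- by rewrite -[a *: m]/(cright a (m : C e)) cmul_cright pbtens_bal scalerAr.
Qed.
Lemma pbmul1E d e (k : C d) s (k' : C e) s' :
  pbmul1 k s (pbtens k' s') = pbtens (cmul k k') (s ^+ (p ^ e) * s').
Proof. exact: (tens_liftE (@pbmul1_bal d e k s) (k' : rpiece C e) s'). Qed.
Lemma pbmul1D d e (k : C d) s : {morph @pbmul1 d e k s : x y / x + y}.
Proof. by move=> x y; exact: (tens_liftD (@pbmul1_bal d e k s) x y). Qed.
Lemma pbmul_bal d e :
  @balanced R (rpiece C d) S (pbpiece e -> pbpiece (d + e)%N) (@pbmul1 d e).
Proof.
split=> [n m m'|m n n'|a m n]; apply/funext; apply: pbpiece_ind.
- move=> k s; rewrite !fctE !pbmul1E -pbtensDl; congr pbtens.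
  exact: (cmulDl k (m : C d) m').
- by move=> x y hx hy; move: hx hy; rewrite !fctE !pbmul1D => -> ->; rewrite addrACA.
- by move=> k s; rewrite !fctE !pbmul1E frobD mulrDl pbtensDr.
- by move=> x y hx hy; move: hx hy; rewrite !fctE !pbmul1D => -> ->; rewrite addrACA.
- move=> k s; rewrite !pbmul1E -[a *: m]/(cright a (m : C d)).
  by rewrite cright_cmul pbtens_bal exprZn scalerAl.
- by move=> x y; rewrite !pbmul1D => -> ->.
Qed.
Lemma pbmulE d e (k : C d) s (k' : C e) s' :
  pbmul (pbtens k s) (pbtens k' s') = pbtens (cmul k k') (s ^+ (p ^ e) * s').
Proof.
have h := tens_liftE (@pbmul_bal d e) (k : rpiece C d) s.
by rewrite /pbmul -/(pbtens k s) in h *; rewrite h pbmul1E.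
Qed.
Fact pbmulDl d e (y : pbpiece e) :
  {morph (fun x : pbpiece d => pbmul x y) : x x' / x + x'}.
Proof. by move=> x x'; rewrite /pbmul (tens_liftD (@pbmul_bal d e)). Qed.
Fact pbmulDr d e (x : pbpiece d) :
  {morph (fun y : pbpiece e => pbmul x y) : y y' / y + y'}.
Proof.
move=> y y' /=; elim/pbpiece_ind: x => [k s|x x' hx hx'].
  have h := tens_liftE (@pbmul_bal d e) (k : rpiece C d) s.
  by rewrite /pbmul -/(pbtens k s) in h *; rewrite h pbmul1D.
by rewrite !pbmulDl hx hx' addrACA.
Qed.

Definition pbscal (s : S) : pbpiece 0%N := pbtens (cscal C 1) s.

Fact pbmulA c d e (x : pbpiece c) (y : pbpiece d) (z : pbpiece e) :
  Tagged pbpiece (pbmul x (pbmul y z)) = Tagged pbpiece (pbmul (pbmul x y) z).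
Proof.
apply/(gcastP (addnA c d e)).
elim/pbpiece_ind: x => [a s|x x' hx hx']; last by rewrite !pbmulDl gcastD hx hx'.
elim/pbpiece_ind: y => [b t|y y' hy hy']; last first.
  by rewrite pbmulDl !pbmulDr pbmulDl gcastD hy hy'.
elim/pbpiece_ind: z => [k u|z z' hz hz']; last by rewrite !pbmulDr gcastD hz hz'.
rewrite !pbmulE pbtens_gcast (proj1 (gcastP (addnA c d e) _ _) (cmulA a b k)).
by congr pbtens; rewrite exprMn -exprM -expnD mulrA.
Qed.
Fact pbmul1l e (x : pbpiece e) : Tagged pbpiece (pbmul (pbscal 1) x) = Tagged pbpiece x.
Proof.
congr existT; elim/pbpiece_ind: x => [k s|x y hx hy]; last first.
  by rewrite pbmulDr hx hy.
rewrite pbmulE expr1n mul1r; congr pbtens.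
exact: (piece_inj (cmul1l k)).
Qed.
Fact pbmul1r e (x : pbpiece e) : Tagged pbpiece (pbmul x (pbscal 1)) = Tagged pbpiece x.
Proof.
apply/(gcastP (addn0 e)); elim/pbpiece_ind: x => [k s|x y hx hy].
  by rewrite pbmulE pbtens_gcast (proj1 (gcastP _ _ _) (cmul1r k)) expr1 mulr1.
by rewrite pbmulDl gcastD hx hy.
Qed.
Fact pbscalD : {morph pbscal : a b / a + b}.
Proof. by move=> a b; rewrite /pbscal pbtensDr. Qed.
Lemma cscal_cright (r : R) : cscal C r = cright r (cscal C 1).
Proof.
apply: piece_inj; apply: etrans (esym (cright_Tagged _ _)).
by rewrite -cscalM mul1r.
Qed.
Fact pbscal_bij : bijective pbscal.
Proof.
case: (cscal_bij C) => inv invK Kinv.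
have invD : {morph inv : x y / x + y}.
  by move=> x y; apply: (can_inj invK); rewrite cscalD !Kinv.
have invM (a : R) (k : C 0%N) : inv (cright a k) = a * inv k.
  apply: (can_inj invK); rewrite Kinv; apply: piece_inj.
  rewrite -{1}[k]Kinv; apply: etrans (cright_Tagged _ _) _.
  by rewrite -cscalM mulrC.
have bal : @balanced R (rpiece C 0) S S (fun (k : C 0%N) s => inv k *: s).
  split=> [n m m'|m n n'|a m n]; first by rewrite invD scalerDl.
    by rewrite scalerDr.
  by rewrite -[a *: m]/(cright a (m : C 0%N)) invM scalerA mulrC.
exists (@tens_lift R (rpiece C 0) S S (fun (k : C 0%N) s => inv k *: s)) => [s|].
  have h := tens_liftE bal (cscal C 1 : rpiece C 0) s.
  by rewrite /pbscal /pbtens h invK scale1r.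
apply: pbpiece_ind => [k s|x y hx hy].
  have h := tens_liftE bal (k : rpiece C 0) s.
  by rewrite {1}/pbtens h /pbscal -pbtens_bal -cscal_cright Kinv.
by rewrite (tens_liftD bal) pbscalD hx hy.
Qed.
Fact pbscalM s t :
  Tagged pbpiece (pbscal (s * t)) = Tagged pbpiece (pbmul (pbscal s) (pbscal t)).
Proof.
rewrite pbmulE expr1; apply: pbtens_Tagged => //.
by rewrite -cscalM mulr1.
Qed.
Fact pbscalC e (x : pbpiece e) s :
  Tagged pbpiece (pbmul (pbscal s) x) = Tagged pbpiece (pbmul x (pbscal (s ^+ (p ^ e)))).
Proof.
apply/esym/(gcastP (addn0 e)); elim/pbpiece_ind: x => [k t|x y hx hy]; last first.
  by rewrite pbmulDl pbmulDr gcastD hx hy.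
rewrite !pbmulE pbtens_gcast (proj1 (gcastP _ _ _) (cmul1r k)) expr1 mulrC.
by congr pbtens; rewrite (piece_inj (cmul1l k)).
Qed.

Definition pullback : cartierAlg p S := CartierAlg
  pbmulDl pbmulDr pbmulA pbmul1l pbmul1r pbscal_bij pbscalD pbscalM pbscalC.
End Pullback.

Section TransposedAction.
Variables (p : nat) (R : comNzRingType) (S : comAlgType R) (pchS : p \in [pchar S]).

Definition omega_pred : {pred S -> R^o} := fun f => `[< linear f >].
Fact omega_submod : submod_closed omega_pred.
Proof.
split=> [|a f g /asboolP hf /asboolP hg]; apply/asboolP => b x y.
  by rewrite scaler0 addr0.
rewrite !fctE hf hg !scalerDr !scalerA mulrC addrACA.
by [].
Qed.
HB.instance Definition _ := GRing.isSubmodClosed.Build R (S -> R^o) omega_pred omega_submod.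
Record omega := Omega { omega_fun :> S -> R^o; omegaP : omega_fun \in omega_pred }.
HB.instance Definition _ := [isSub for omega_fun].
HB.instance Definition _ := [Choice of omega by <:].
HB.instance Definition _ := [SubChoice_isSubZmodule of omega by <:].
HB.instance Definition _ := [SubZmodule_isSubLmodule of omega by <:].

Variables (C : cartierAlg p R) (phi : cartierAction C).

Definition is_transpose (T : S -> R) e (f : R -> R) (g : S -> S) : Prop :=
  plinear p e g /\ forall x, f (T x) = T (g x).
Definition transposable (T : S -> R) e (f : R -> R) : Prop :=
  exists g, is_transpose T e f g.
Definition transposable_module (T : S -> R) : Prop :=
  forall e (k : C e), transposable T e (act phi k).

Variable sigma : {linear S -> omega}.
Hypothesis sigma_Slin : forall s t x : S, sigma (s * t) x = sigma t (s * x).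
Hypothesis sigma_inj : injective sigma.
Let T : S -> R := sigma 1.
Hypothesis T_trans : transposable_module T.

Lemma act_cmul d e (k : C d) (k' : C e) x : act phi (cmul k k') x = act phi k (act phi k' x).
Proof. by rewrite /act chomM. Qed.
Lemma act_add e (k k' : C e) x : act phi (k + k') x = act phi k x + act phi k' x.
Proof. by rewrite /act chomD. Qed.
Lemma act_cscal a x : act phi (cscal C a) x = a * x.
Proof. by rewrite /act chom_scal. Qed.
Lemma act_plinear e (k : C e) : plinear p e (act phi k).
Proof. exact: pfamP (zvalP (phi e k)). Qed.

Lemma sigma1_lin : linear (T : S -> R^o).
Proof. exact/asboolP/omegaP. Qed.
Lemma sigma1Z a x : T (a *: x) = a * T x.
Proof.
have T0 : T 0 = 0 by have := sigma1_lin (-1) 0 0; rewrite scaler0 addr0 scaleN1r addNr.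
by have := sigma1_lin a x 0; rewrite addr0 T0 addr0.
Qed.
Lemma sigma1_nondeg x y : (forall s, T (s * x) = T (s * y)) -> x = y.
Proof.
move=> h; apply: sigma_inj; apply: val_inj; apply/funext => s /=.
by have := h s; rewrite /T ![s * _]mulrC -!sigma_Slin !mulr1.
Qed.
Lemma transpose_uniq e f g g' :
  is_transpose T e f g -> is_transpose T e f g' -> g = g'.
Proof.
move=> [[gD gM] gT] [[gD' gM'] gT']; apply/funext => x; apply: sigma1_nondeg => s.
by rewrite -gM -gM' -gT -gT'.
Qed.

Definition transpose e (k : C e) : S -> S := projT1 (cid (T_trans k)).
Lemma transposeP e (k : C e) : is_transpose T e (act phi k) (transpose k).
Proof. exact: (projT2 (cid (T_trans k))). Qed.

(* [kappa (x) s] acts through [x |-> kappa^T (s x)]. *)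
Fact pbact_plin e (k : C e) (s : S) : (fun x => transpose k (s * x)) \in plinAll p S e.
Proof.
case: (transposeP k) => [[gD gM] _]; apply/asboolP; split=> [x y|a x].
  by rewrite mulrDr gD.
by rewrite mulrCA gM.
Qed.
Definition pbact1 e (k : C e) (s : S) : cartierFull p S e := ZSub (pbact_plin k s).
Definition pbact e (x : pullback pchS C e) : cartierFull p S e :=
  @tens_lift R (rpiece C e) S _ (@pbact1 e) x.

Lemma transposeD e (k k' : C e) x : transpose (k + k') x = transpose k x + transpose k' x.
Proof.
move: x; apply/funeqP; apply: (transpose_uniq (transposeP _)).
case: (transposeP k) => [[gD gM] gT]; case: (transposeP k') => [[gD' gM'] gT'].
split=> [|x]; first split=> [x y|a x].
- by rewrite gD gD' addrACA.
- by rewrite gM gM' mulrDr.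
- have := sigma1_lin 1 (transpose k x) (transpose k' x).
  by rewrite !scale1r => ->; rewrite act_add gT gT'.
Qed.
Lemma transpose_cmul d e (k : C d) (k' : C e) x :
  transpose (cmul k k') x = transpose k (transpose k' x).
Proof.
move: x; apply/funeqP; apply: (transpose_uniq (transposeP _)).
case: (transposeP k) => [gP gT]; case: (transposeP k') => [gP' gT'].
split=> [|x]; first exact: plinear_comp gP gP'.
by rewrite act_cmul gT' gT.
Qed.
Lemma transpose_cscal a x : transpose (cscal C a) x = a *: x.
Proof.
move: x; apply/funeqP; apply: (transpose_uniq (transposeP _)).
split=> [|x]; first split=> [x y|b x].
- by rewrite scalerDr.
- by rewrite expr1 scalerAr.
- by rewrite act_cscal sigma1Z.
Qed.
Lemma transpose_cright e a (k : C e) x : transpose (cright a k) x = transpose k (a *: x).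
Proof.
have h : forall f (l : C f), Tagged (cpiece C) l = Tagged (cpiece C) (cright a k) ->
    transpose l x = transpose (cright a k) x.
  move=> f l hl.
  exact: (congr1 (fun u : {e & C e} => transpose (tagged u) x) hl).
by rewrite -(h _ _ (esym (cright_Tagged a k))) transpose_cmul transpose_cscal.
Qed.

Lemma pbact_bal e : @balanced R (rpiece C e) S (cartierFull p S e) (@pbact1 e).
Proof.
split=> [n m m'|m n n'|a m n]; apply: val_inj; apply/funext => x.
- exact: transposeD.
- rewrite /= !fctE mulrDl; exact: (transposeP (m : C e)).1.1.
- rewrite /= -[a *: m]/(cright a (m : C e)) transpose_cright.
  by rewrite scalerAl.
Qed.
Lemma pbactE e (k : C e) s : pbact (pbtens k s) = pbact1 k s.
Proof. exact: (tens_liftE (@pbact_bal e) (k : rpiece C e) s). Qed.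
Fact pbactD e : {morph @pbact e : x y / x + y}.
Proof. by move=> x y; exact: (tens_liftD (@pbact_bal e) x y). Qed.
Fact pbactM d e (x : pullback pchS C d) (y : pullback pchS C e) :
  pbact (cmul x y) = cmul (pbact x) (pbact y).
Proof.
elim/(@pbpiece_ind _ _ S C): x => [k s|x x' hx hx']; last first.
  by rewrite cmulDl !pbactD hx hx' cmulDl.
elim/(@pbpiece_ind _ _ S C): y => [k' s'|y y' hy hy']; last first.
  by rewrite cmulDr !pbactD hy hy' cmulDr.
rewrite [cmul _ _](pbmulE pchS) !pbactE; apply: val_inj; apply/funext => x /=.
by rewrite transpose_cmul -mulrA (transposeP k').1.2.
Qed.
Fact pbact_scal s : pbact (cscal (pullback pchS C) s) = cscal (cartierFull p S) s.
Proof.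
rewrite [cscal _ _]/(pbscal C s) pbactE; apply: val_inj; apply/funext => x /=.
by rewrite transpose_cscal scale1r.
Qed.

Definition pullbackAction : cartierAction (pullback pchS C) :=
  CartierHom pbactD pbactM pbact_scal.
End TransposedAction.

Definition idealr_pack (A : nzRingType) (P : {pred A}) (h : idealr_closed P) : idealr A :=
  HB.pack P (isIdealr.Build A P h).

Section CommutativeAlgebra.
Variable A : comNzRingType.

(* [(A, m)] is local: [m] is the ideal of non-units. *)
Definition local_ring (m : idealr A) : Prop :=
  forall a, a \in m <-> ~ exists b, a * b = 1.

Definition in_gen_ideal (s : seq A) (x : A) : Prop :=
  exists c : nat -> A, x = \sum_(i < size s) c i * s`_i.

Definition noetherian : Prop :=
  forall I : idealr A, exists s : seq A, forall x, x \in I <-> in_gen_ideal s x.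

Definition module_finite (B : comNzRingType) (f : A -> B) : Prop :=
  exists s : seq B, forall b, exists c : nat -> A, b = \sum_(i < size s) f (c i) * s`_i.

Definition regular_elt (a : A) : Prop := forall b, a * b = 0 -> b = 0.

Definition regular_seq (s : seq A) : Prop :=
  ~ in_gen_ideal s 1 /\
  forall i a, (i < size s)%N ->
    in_gen_ideal (take i s) (s`_i * a) -> in_gen_ideal (take i s) a.
End CommutativeAlgebra.

Definition F_finite (p : nat) (A : comNzRingType) : Prop :=
  module_finite (fun a : A => a ^+ p).

Section Extended.
Variable RT : realType.

Definition nat_sup (P : set nat) : \bar RT := ereal_sup [set (n%:R)%:E | n in P]%classic.

Definition krull_dim (A : comNzRingType) : \bar RT :=
  nat_sup [set n | exists P : nat -> prime_idealr A, forall i, (i < n)%N ->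
     {subset P i <= P i.+1} /\ exists2 x, x \in P i.+1 & x \notin P i]%classic.

Definition length (A : nzRingType) (M : lmodType A) : \bar RT :=
  nat_sup [set n | exists N : nat -> submodClosed M, forall i, (i < n)%N ->
     {subset N i <= N i.+1} /\ exists2 x, x \in N i.+1 & x \notin N i]%classic.

Definition depth (A : comNzRingType) (I : {pred A}) : \bar RT :=
  nat_sup [set n | exists s : seq A,
     [/\ size s = n, {subset s <= I} & regular_seq s]]%classic.
End Extended.

Section Localization.
Variables (A : comNzRingType) (x : prime_idealr A).

Record denom := Denom { dval : A; dvalP : dval \notin x }.
HB.instance Definition _ := [isSub for dval].
HB.instance Definition _ := [Choice of denom by <:].

Fact denom1P : 1 \notin x. Proof. by rewrite idealr1. Qed.
Definition denom1 := Denom denom1P.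
Fact denomMP (s t : denom) : dval s * dval t \notin x.
Proof. by rewrite prime_idealrM negb_or !dvalP. Qed.
Definition denomM s t := Denom (denomMP s t).

Definition loc_rel : rel (A * denom) := fun u v =>
  `[< exists w : denom, dval w * (u.1 * dval v.2 - v.1 * dval u.2) = 0 >].
Fact loc_rel_equiv : equiv_class_of loc_rel.
Proof.
split=> [u|u v|v u w].
- by apply/asboolP; exists denom1; rewrite subrr mulr0.
- by apply/asboolP/asboolP=> -[w h]; exists w; apply/eqP;
     rewrite -oppr_eq0 -mulrN opprB h.
- move=> /asboolP[a ha] /asboolP[b hb]; apply/asboolP.
  exists (denomM (denomM a b) v.2) => /=.
  rewrite [LHS](_ : _ = dval b * dval w.2 * (dval a * (u.1 * dval v.2 - v.1 * dval u.2)) +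
    dval a * dval u.2 * (dval b * (v.1 * dval w.2 - w.1 * dval v.2))); last by ring.
  by rewrite ha hb !mulr0 addr0.
Qed.
Canonical loc_equiv := EquivRelPack loc_rel_equiv.
Canonical loc_encModRel := defaultEncModRel loc_rel.

Definition loc := {eq_quot loc_rel}.
HB.instance Definition _ : EqQuotient _ loc_rel loc := EqQuotient.on loc.
HB.instance Definition _ := Choice.on loc.

Definition lfrac (u : A * denom) : loc := \pi_loc u.
Lemma lfracP u v : (exists w : denom, dval w * (u.1 * dval v.2 - v.1 * dval u.2) = 0) <->
  lfrac u = lfrac v.
Proof.
split=> [h|/eqP]; first by apply/eqP; rewrite piE; apply/asboolP.
by rewrite piE => /asboolP.
Qed.
Lemma lfracW (P : loc -> Prop) : (forall a s, P (lfrac (a, s))) -> forall z, P z.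
Proof. by move=> h z; rewrite -[z]reprK; case: (repr z) => a s; apply: h. Qed.
Lemma lfrac_repr u :
  exists w : denom, dval w * ((repr (lfrac u)).1 * dval u.2 - u.1 * dval (repr (lfrac u)).2) = 0.
Proof. by apply/lfracP; rewrite /lfrac reprK. Qed.

Definition loc_add (y z : loc) : loc := let u := repr y in let v := repr z in
  lfrac (u.1 * dval v.2 + v.1 * dval u.2, denomM u.2 v.2).
Definition loc_opp (y : loc) : loc := lfrac (- (repr y).1, (repr y).2).
Definition loc_mul (y z : loc) : loc := let u := repr y in let v := repr z in
  lfrac (u.1 * v.1, denomM u.2 v.2).

Lemma loc_addE a s b t : loc_add (lfrac (a, s)) (lfrac (b, t)) =
  lfrac (a * dval t + b * dval s, denomM s t).
Proof.
rewrite /loc_add; apply/lfracP; case: (lfrac_repr (a, s)) => v /=.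
case: (lfrac_repr (b, t)) => w /=; set u' := repr _; set v' := repr _ => hw hv.
exists (denomM v w) => /=.
rewrite [LHS](_ : _ = dval w * dval t * dval u'.2 *
     (dval v * (v'.1 * dval s - a * dval v'.2)) +
    dval v * dval s * dval v'.2 * (dval w * (u'.1 * dval t - b * dval u'.2))); last by ring.
by rewrite hv hw !mulr0 addr0.
Qed.
Lemma loc_oppE a s : loc_opp (lfrac (a, s)) = lfrac (- a, s).
Proof.
rewrite /loc_opp; apply/lfracP; case: (lfrac_repr (a, s)) => w /= h; exists w.
by rewrite !mulNr -opprD mulrN h oppr0.
Qed.
Lemma loc_mulE a s b t : loc_mul (lfrac (a, s)) (lfrac (b, t)) = lfrac (a * b, denomM s t).
Proof.
rewrite /loc_mul; apply/lfracP; case: (lfrac_repr (a, s)) => v /=.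
case: (lfrac_repr (b, t)) => w /=; set u' := repr _; set v' := repr _ => hw hv.
exists (denomM v w) => /=.
rewrite [LHS](_ : _ = dval w * u'.1 * dval t * (dval v * (v'.1 * dval s - a * dval v'.2)) +
    dval v * a * dval v'.2 * (dval w * (u'.1 * dval t - b * dval u'.2))); last by ring.
by rewrite hv hw !mulr0 addr0.
Qed.
Lemma lfrac_eq a s b t : a * dval t = b * dval s -> lfrac (a, s) = lfrac (b, t).
Proof. by move=> h; apply/lfracP; exists denom1; rewrite /= h subrr mulr0. Qed.

Fact loc_addA : associative loc_add.
Proof.
elim/lfracW => a s; elim/lfracW => b t; elim/lfracW => c u.
by rewrite !loc_addE; apply: lfrac_eq => /=; ring.
Qed.
Fact loc_addC : commutative loc_add.
Proof.
elim/lfracW => a s; elim/lfracW => b t.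
by rewrite !loc_addE; apply: lfrac_eq => /=; ring.
Qed.
Fact loc_add0 : left_id (lfrac (0, denom1)) loc_add.
Proof. by elim/lfracW => a s; rewrite !loc_addE; apply: lfrac_eq => /=; ring. Qed.
Fact loc_addN : left_inverse (lfrac (0, denom1)) loc_opp loc_add.
Proof.
by elim/lfracW => a s; rewrite loc_oppE loc_addE; apply: lfrac_eq => /=; ring.
Qed.
HB.instance Definition _ := GRing.isZmodule.Build loc loc_addA loc_addC loc_add0 loc_addN.
Fact loc_mulA : associative loc_mul.
Proof.
elim/lfracW => a s; elim/lfracW => b t; elim/lfracW => c u.
by rewrite !loc_mulE; apply: lfrac_eq => /=; ring.
Qed.
Fact loc_mulC : commutative loc_mul.
Proof.
elim/lfracW => a s; elim/lfracW => b t.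
by rewrite !loc_mulE; apply: lfrac_eq => /=; ring.
Qed.
Fact loc_mul1 : left_id (lfrac (1, denom1)) loc_mul.
Proof. by elim/lfracW => a s; rewrite !loc_mulE; apply: lfrac_eq => /=; ring. Qed.
Fact loc_mulDl : left_distributive loc_mul +%R.
Proof.
elim/lfracW => a s; elim/lfracW => b t; elim/lfracW => c u.
rewrite -[_ + _]/(loc_add _ _) -[RHS]/(loc_add _ _) !(loc_addE, loc_mulE).
by apply: lfrac_eq => /=; ring.
Qed.
Fact loc_1neq0 : lfrac (1, denom1) != 0.
Proof.
apply/eqP => /lfracP /= [w]; rewrite !mul1r mul0r subr0 mulr1 => w0.
by have := dvalP w; rewrite w0 idealr0.
Qed.
HB.instance Definition _ := GRing.Zmodule_isComNzRing.Build loc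
  loc_mulA loc_mulC loc_mul1 loc_mulDl loc_1neq0.

Definition loc_max : {pred loc} := fun z =>
  `[< exists u : A * denom, u.1 \in x /\ z = lfrac u >].
End Localization.

Definition serreS1 (RT : realType) (A : comNzRingType) : Prop :=
  forall x : prime_idealr A,
    (Order.min 1%:E (krull_dim RT (loc x)) <= depth RT (@loc_max A x))%E.

Section ResidueField.
Variables (A : comNzRingType) (x : prime_idealr A).

Definition rdom := {ideal_quot x}.
HB.instance Definition _ := GRing.ComNzRing.on rdom.
Definition rdom_unit : {pred rdom} := fun a => `[< exists b, b * a = 1 >].
Definition rdom_inv (a : rdom) : rdom :=
  if pselect (exists b, b * a = 1) is left h then projT1 (cid h) else a.
Fact rdom_mulVx : {in rdom_unit, left_inverse 1 rdom_inv *%R}.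
Proof.
move=> a /asboolP h; rewrite /rdom_inv; case: pselect => // h'.
exact: (projT2 (cid h')).
Qed.
Fact rdom_unitPl (a b : rdom) : b * a = 1 -> rdom_unit a.
Proof. by move=> h; apply/asboolP; exists b. Qed.
Fact rdom_invr_out : {in [predC rdom_unit], rdom_inv =1 id}.
Proof. by move=> a /asboolPn h; rewrite /rdom_inv; case: pselect. Qed.
HB.instance Definition _ := GRing.ComNzRing_hasMulInverse.Build rdom
  rdom_mulVx rdom_unitPl rdom_invr_out.
Fact rdom_integral : GRing.integral_domain_axiom rdom.
Proof. exact: (@Quotient.rquot_IdomainAxiom A x). Qed.
HB.instance Definition _ := GRing.ComUnitRing_isIntegral.Build rdom rdom_integral.

Definition residue_field : fieldType := {fraction rdom}.
Definition residue (a : A) : residue_field := tofrac (\pi_rdom a : rdom).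
End ResidueField.

(* The rank of [B] over [k] through the ring homomorphism [g] (0 if [B] is not
   free of finite rank). *)
Definition degree (k : comNzRingType) (B : comPzRingType) (g : k -> B) : nat :=
  xget 0%N [set n | exists b : 'I_n -> B,
    forall v, exists! c : {ffun 'I_n -> k}, v = \sum_(i < n) g (c i) * b i]%classic.

(* [[kappa(y) : kappa(x)]] for [theta : A -> B] and primes [y] of [B] and
   [x = theta^-1(y)] of [A]; 0 for other [x] and [y]. *)
Definition residue_degree (A B : comNzRingType) (theta : A -> B)
    (x : {pred A}) (y : {pred B}) : nat :=
  xget 0%N [set d | exists (x' : prime_idealr A) (y' : prime_idealr B)
      (g : {rmorphism residue_field x' -> residue_field y'}),
    [/\ x' =i x, y' =i y, forall a, g (residue x' a) = residue y' (theta a) &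
        d = degree g]]%classic.

(* [[k^(1/p) : k]] for [k = A / m]: the degree of the Frobenius of [k]. *)
Definition p_degree (p : nat) (A : comNzRingType) (m : idealr A) : nat :=
  degree (fun a : {ideal_quot m} => a ^+ p).

Section Generic.
Variables (R : idomainType) (S : comAlgType R).

Definition fracAlg := {fraction R}.
HB.instance Definition _ := GRing.Field.on fracAlg.
Definition frac_scale (r : R) (k : fracAlg) : fracAlg := tofrac r * k.
Fact frac_scaleA a b v : frac_scale a (frac_scale b v) = frac_scale (a * b) v.
Proof. by rewrite /frac_scale mulrA tofracM. Qed.
Fact frac_scale1 : left_id 1 frac_scale.
Proof. by move=> v; rewrite /frac_scale tofrac1 mul1r. Qed.
Fact frac_scaleDr : right_distributive frac_scale +%R.
Proof. by move=> a u v; rewrite /frac_scale mulrDr. Qed.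
Fact frac_scaleDl v : {morph frac_scale^~ v: a b / a + b}.
Proof. by move=> a b; rewrite /frac_scale tofracD mulrDl. Qed.
HB.instance Definition _ := GRing.Zmodule_isLmodule.Build R fracAlg
  frac_scaleA frac_scale1 frac_scaleDr frac_scaleDl.
Fact frac_scaleAl (a : R) (u v : fracAlg) : a *: (u * v) = (a *: u) * v.
Proof. exact: mulrA. Qed.
HB.instance Definition _ := GRing.Lmodule_isLalgebra.Build R fracAlg frac_scaleAl.
HB.instance Definition _ := GRing.Lalgebra_isComAlgebra.Build R fracAlg.

Definition genericAlg : comPzRingType := talg fracAlg S.
Definition generic_inl : fracAlg -> genericAlg := @talg_inl R fracAlg S.
Definition generic_inr : S -> genericAlg := @talg_inr R fracAlg S.

Definition generic_total_fractions : Prop :=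
  [/\ injective generic_inr,
      forall s, regular_elt s -> exists l, generic_inr s * l = 1 &
      forall l, exists a s, regular_elt s /\ l * generic_inr s = generic_inr a].

Definition generic_iso (M N : lmodType R) (f : M -> N) : Prop :=
  bijective (@tens_map R fracAlg M N f).

Lemma generic_iso_inj (sigma : {linear S -> omega S}) :
  generic_total_fractions -> generic_iso sigma -> injective sigma.
Proof.
move=> [inj _ _] /bij_inj sinj s t st; apply: inj; apply: sinj.
have bal : balanced (fun (m : fracAlg) (n : S) => tensor m (sigma n)).
  split=> [n m m'|m n n'|a m n]; first by rewrite tensDl.
    by rewrite linearD tensDr.
  by rewrite linearZ tens_balanced.
by rewrite /tens_map /generic_inr /talg_inr !(tens_liftE bal) st.
Qed.
End Generic.

Section Invariants.
Variables (RT : realType) (p : nat) (A : comNzRingType) (m : idealr A).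
Variables (C : cartierAlg p A) (phi : cartierAction C).

Definition splitting_prime : {pred A} := fun r =>
  `[< forall e (k : C e), (1 <= e)%N -> act phi k r \in m >].

Definition F_pure : Prop := idealr_closed splitting_prime.
Definition F_regular : Prop := forall r, r \in splitting_prime <-> r = 0.

Definition nonsplit e : {pred lpiece C e} := fun k => `[< forall r, act phi (k : C e) r \in m >].
Fact nonsplit_submod e : submod_closed (@nonsplit e).
Proof.
split=> [|a k l /asboolP hk /asboolP hl]; apply/asboolP => r.
  rewrite /act (morphD_eq0 (@chomD _ _ _ _ phi e)); exact: idealr0.
rewrite act_add; apply: rpredD (hl r).
have -> : act phi (cleft a (k : C e)) r = a * act phi (k : C e) r.
  exact: etrans (act_cmul phi (cscal C a) (k : C e) r) (act_cscal phi a _).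
exact: idealMr (hk r).
Qed.
HB.instance Definition _ e :=
  GRing.isSubmodClosed.Build A (lpiece C e) (@nonsplit e) (@nonsplit_submod e).

Definition splitting_number e : \bar RT := length RT (lquot (@nonsplit e)).

(* [gcd {e >= 1 | a_e <> 0}] (0 for the empty set) *)
Definition splitting_index : nat :=
  let E := [set e | (1 <= e)%N /\ splitting_number e <> 0%E]%classic in
  xget 0%N [set n | (forall e, E e -> n %| e)%N /\
                    forall d, (forall e, E e -> d %| e)%N -> (d %| n)%N]%classic.

(* [dim A + log_p [k^(1/p) : k]]; the dimension of a noetherian local ring is finite. *)
Definition splitting_delta : RT :=
  fine (krull_dim RT A) + ln (p_degree p m)%:R / ln p%:R.

Definition F_signature : \bar RT :=
  if pselect (forall e, (1 <= e)%N -> splitting_number e = 0%E) then 0%E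
  else limn (fun e => (splitting_number (e * splitting_index)%N *
    ((p%:R `^ ((e * splitting_index)%N%:R * splitting_delta))^-1)%:E)%E).
End Invariants.

Section QuotientAction.
Variables (RT : realType) (p : nat) (A : comNzRingType) (m : idealr A).
Hypothesis mP : local_ring m.
Variables (C : cartierAlg p A) (phi : cartierAction C).
Hypothesis pure : F_pure m phi.

Definition splitting_ideal : idealr A := idealr_pack pure.
Local Notation Ab := {ideal_quot splitting_ideal}.
Local Notation q := (\pi_Ab).

(* The maps induced on [A / beta] by the elements of [C_e] *)
Definition induced_pred e : {pred Ab -> Ab} := fun psi =>
  `[< exists k : C e, forall x, psi (q x) = q (act phi k x) >].

Fact induced_zmod e : zmod_closed (@induced_pred e).
Proof.
split=> [|f g /asboolP[k hk] /asboolP[l hl]]; apply/asboolP.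
  exists 0 => x; rewrite /act (morphD_eq0 (@chomD _ _ _ _ phi e)).
  exact: (esym (rmorph0 q)).
exists (k - l) => x; rewrite !fctE hk hl -rmorphB; congr q.
by apply/eqP; rewrite subr_eq -act_add subrK.
Qed.
HB.instance Definition _ e :=
  GRing.isZmodClosed.Build (Ab -> Ab) (@induced_pred e) (@induced_zmod e).
Fact induced_plin e f : f \in @induced_pred e -> plinear p e f.
Proof.
move=> /asboolP[k hk]; case: (act_plinear phi k) => kD kM.
split=> [x y|a x]; elim/quotW: x => x.
  by elim/quotW: y => y; rewrite -rmorphD !hk kD rmorphD.
by elim/quotW: a => a; rewrite -rmorphXn -rmorphM !hk kM rmorphM.
Qed.
Fact induced_comp d e f g :
  f \in @induced_pred d -> g \in @induced_pred e -> f \o g \in @induced_pred (d + e).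
Proof.
move=> /asboolP[k hk] /asboolP[l hl]; apply/asboolP; exists (cmul k l) => x /=.
by rewrite hl hk act_cmul.
Qed.
Fact induced_scal (a : Ab) : *%R a \in @induced_pred 0.
Proof.
apply/asboolP; elim/quotW: a => a; exists (cscal C a) => x.
by rewrite act_cscal rmorphM.
Qed.
Definition inducedFamily : plinFamily p Ab :=
  PlinFamily induced_plin induced_comp induced_scal.
Definition inducedAlg : cartierAlg p Ab := funCartier inducedFamily.

Fact induced_full e (f : inducedAlg e) : zval f \in plinAll p Ab e.
Proof. exact/asboolP/(induced_plin (zvalP f)). Qed.
Definition induced_incl e (f : inducedAlg e) : cartierFull p Ab e := ZSub (induced_full f).
Fact induced_inclD e : {morph @induced_incl e : x y / x + y}.
Proof. by move=> x y; apply: val_inj. Qed.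
Fact induced_inclM d e (x : inducedAlg d) (y : inducedAlg e) :
  induced_incl (cmul x y) = cmul (induced_incl x) (induced_incl y).
Proof. exact: val_inj. Qed.
Fact induced_incl_scal a : induced_incl (cscal inducedAlg a) = cscal (cartierFull p Ab) a.
Proof. exact: val_inj. Qed.
Definition inducedAction : cartierAction inducedAlg :=
  CartierHom induced_inclD induced_inclM induced_incl_scal.

Definition quot_max_pred : {pred Ab} := fun z => `[< exists2 x, x \in m & z = q x >].
Lemma splitting_prime_sub x : x \in splitting_prime m phi -> x \in m.
Proof.
move=> xb; apply/mP => -[y xy].
case: pure => b0 b1 bI; move/negP: b1; apply.
by rewrite -xy mulrC -[_ * _]addr0; apply: bI.
Qed.
Fact quot_max_ideal : idealr_closed quot_max_pred.
Proof.
split.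
- by apply/asboolP; exists 0; rewrite ?idealr0 ?rmorph0.
- apply/asboolPn => -[x xm]; rewrite -(rmorph1 q) => /eqP.
  rewrite -Quotient.idealrBE => /splitting_prime_sub h.
  have : 1 \in m by rewrite -(subrK x 1) rpredD.
  by rewrite idealr1.
- move=> a u v /asboolP[x xm ->] /asboolP[y ym ->]; elim/quotW: a => a.
  apply/asboolP; exists (a * x + y); last by rewrite rmorphD rmorphM.
  by rewrite rpredD // idealMr.
Qed.
Definition quot_max : idealr Ab := idealr_pack quot_max_ideal.

Definition pure_splitting_ratio : \bar RT := F_signature RT quot_max inducedAction.
End QuotientAction.

Definition splitting_ratio (RT : realType) p (A : comNzRingType) (m : idealr A)
    (mP : local_ring m) (C : cartierAlg p A) (phi : cartierAction C) : \bar RT :=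
  if pselect (F_pure m phi) is left pure then pure_splitting_ratio RT mP pure else 0%E.

(* Main.v *)
Require Import Defs.
From HB Require Import structures.
From mathcomp Require Import all_boot all_order all_algebra.
From mathcomp Require Import generic_quotient ring_quotient fraction.
From mathcomp Require Import ring lra zify.
From mathcomp Require Import boolp classical_sets.
From mathcomp Require Import reals constructive_ereal ereal topology normedtype sequences exp.

Set Implicit Arguments.
Unset Strict Implicit.
Unset Printing Implicit Defensive.

Import Order.TTheory GRing.Theory Num.Theory.
Import numFieldNormedType.Exports.
Local Open Scope ring_scope.
Local Open Scope quotient_scope.

(* Let [I_e(R)] be the ideal of the [r] with [C_e . r] in [m].  Evaluation is a perfect pairing
   between [C_e / C_e^ns] and [F^e_* (R / I_e(R))] over [k = R / m], so [a_e(R)] is the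
   [k]-dimension of the latter.  Since [T] is surjective and maps [n] into [m], transposition
   gives [s \in I_e(S)] iff [T (s S)] is contained in [I_e(R)], and the same relation for the
   splitting primes, which yields the assertions on [beta], F-purity and F-regularity.
   Dividing by the splitting primes reduces the formulas to a finite extension of domains
   [A -> B] with F-regular pairs.  The form [T (x y)] is nondegenerate there, so for some
   [c <> 0] the modules [B / I_e(B)] and [(A / I_e(A))^r], with [r] the rank of [B], agree up
   to kernels and cokernels killed by [c].  These contribute [O([k : k^q] q^(d-1))] with
   [q = p^e] and [d = dim A], which disappears after division by [[k : k^q] q^d]. *)

(** * Generators and independent families modulo a submodule *)

(** [B] need not be free over [A], and [I_e(B)] need not be generated by [I_e(A)]: it is only known
    to be the largest ideal of [B] that [T] maps into [I_e(A)]. A nondegenerate form turns this into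
    coordinates. If [c0] is a common denominator of [B] for a maximal independent family [b_i], and
    the [t_j] are dual to it up to the scalars [T (t_j b_j)], then [c] is [c0] times the product of
    these scalars. Nondegeneracy on the quotients holds because the splitting prime of [S] consists
    of the [s] with [T (s S)] inside that of [R]. Counting is done over the residue field of [A],
    whence the residue degree on one side and the rank on the other. Both sides have the same
    normalisation: dimensions agree in a finite extension, and [[k : k^q]] does not change under a
    finite extension of [k]. Modules stay implicit: a quotient [V / N] is given by a predicate [N]
    and an action, so that Frobenius pushforwards need no new types. Ideals are predicates that may
    hold at [1], since [I_e] is the unit ideal in every degree with [a_e = 0]. *)

Definition is_ideal (A : comNzRingType) (I : A -> Prop) : Prop :=
  [/\ I 0, forall x y, I x -> I y -> I (x + y) & forall a x, I x -> I (a * x)].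

Definition is_prime (A : comNzRingType) (P : A -> Prop) : Prop :=
  [/\ is_ideal P, ~ P 1 & forall x y, P (x * y) -> P x \/ P y].

Section Ideals.
Variables (A : comNzRingType) (I : A -> Prop).
Hypothesis idI : is_ideal I.
Lemma is_ideal0 : I 0. Proof. by case: idI. Qed.
Lemma is_idealD x y : I x -> I y -> I (x + y). Proof. by case: idI => _ h _; apply: h. Qed.
Lemma is_idealMl a x : I x -> I (a * x). Proof. by case: idI => _ _ h; apply: h. Qed.
Lemma is_idealMr a x : I x -> I (x * a). Proof. by rewrite mulrC; apply: is_idealMl. Qed.
Lemma is_idealN x : I x -> I (- x). Proof. by move=> h; rewrite -mulN1r; apply: is_idealMl. Qed.
Lemma is_idealB x y : I x -> I y -> I (x - y).
Proof. by move=> hx hy; apply: is_idealD => //; apply: is_idealN. Qed.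
Lemma is_ideal_sum (J : finType) (F : J -> A) : (forall i, I (F i)) -> I (\sum_i F i).
Proof. by move=> h; apply: (big_ind I) => //; [exact: is_ideal0 | exact: is_idealD]. Qed.
End Ideals.

(** Fraction-free Gaussian elimination modulo [P]. It uses no inverses, so [P] can be any prime: [m]
    gives linear algebra over the residue field, [0] over the fraction field of a domain. *)
Lemma hom_sys_ord (A : comNzRingType) (P : A -> Prop) (n s : nat) (f : 'I_s -> 'I_n -> A) :
  is_prime P -> (n < s)%N ->
  exists c : 'I_s -> A, (exists i, ~ P (c i)) /\ forall j, P (\sum_i c i * f i j).
Proof.
move=> pP; case: (pP) => idP P1 PM; elim: n s f => [|n IH] [|s] f // ns.
  by exists (fun=> 1); split=> [|[]//]; exists ord0.
(* A pivot [f i0 ord0] outside [P]; without one, the first equation holds modulo [P] for every [c]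
   and is dropped. *)
case: (pselect (exists i, ~ P (f i ord0))) => [[i0 h]|h]; last first.
  have [c [ci cj]] := IH s.+1 (fun i j => f i (lift ord0 j)) (ltnW ns).
  exists c; split=> // j; case: (unliftP ord0 j) => [k ->|->]; first exact: cj.
  apply: is_ideal_sum => // i; apply: is_idealMl => //.
  by apply: contrapT => hi; apply: h; exists i.
(* Cross-multiplication with the pivot eliminates the unknown [i0]. *)
pose f' (i : 'I_s) (j : 'I_n) := f i0 ord0 * f (lift i0 i) (lift ord0 j) -
  f (lift i0 i) ord0 * f i0 (lift ord0 j).
have [c' [[k ck] cj]] := IH s f' ns.
pose c i := if unlift i0 i is Some k then f i0 ord0 * c' k
            else - \sum_k c' k * f (lift i0 k) ord0.
exists c; split=> [|j].
  by exists (lift i0 k); rewrite /c liftK => /PM[].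
rewrite (bigD1_ord i0) //= {1}/c unlift_none.
under eq_bigr => i _ do rewrite /c liftK.
case: (unliftP ord0 j) => [l ->|->].
  rewrite [X in P X](_ : _ = \sum_i c' i * f' i l) //.
  rewrite mulNr mulr_suml -sumrN -big_split /=; apply: eq_bigr => i _.
  by rewrite /f'; ring.
rewrite [X in P X](_ : _ = 0); first exact: is_ideal0.
rewrite mulNr mulr_suml -sumrN -big_split /=; apply: big1 => i _; ring.
Qed.

Lemma sum_enum_val (V : zmodType) (I : finType) (F : I -> V) :
  \sum_(i < #|I|) F (enum_val i) = \sum_i F i.
Proof. by rewrite [RHS](reindex (@enum_val I predT)) //; apply: onW_bij; apply: enum_val_bij. Qed.

Lemma hom_sys (A : comNzRingType) (P : A -> Prop) (I J : finType) (f : I -> J -> A) :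
  is_prime P -> (#|J| < #|I|)%N ->
  exists c : I -> A, (exists i, ~ P (c i)) /\ forall j, P (\sum_i c i * f i j).
Proof.
move=> pP lt; have [c [[i ci] cj]] :=
  hom_sys_ord (fun i j => f (enum_val i) (enum_val j)) pP lt.
exists (fun i => c (enum_rank i)); split.
  by exists (enum_val i); rewrite enum_valK.
move=> j; have := cj (enum_rank j).
rewrite -(sum_enum_val (fun i => c (enum_rank i) * f i j)); congr P.
by apply: eq_bigr => k _; rewrite enum_valK enum_rankK.
Qed.

(* [V / N] is a module over [A / M], the scalars acting through [s]. *)
Record kspace (A : comNzRingType) (V : zmodType) (M : A -> Prop) (s : A -> V -> V)
    (N : V -> Prop) : Prop := KSpace {
  ksDl : forall v, {morph s^~ v : a b / a + b};
  ksDr : forall a, {morph s a : u v / u + v};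
  ksM : forall a b v, s (a * b) v = s a (s b v);
  ks1 : forall v, s 1 v = v;
  ksN0 : N 0;
  ksNB : forall u v, N u -> N v -> N (u - v);
  ksNs : forall a v, N v -> N (s a v);
  ksNk : forall a v, M a -> N (s a v)
}.

Section Families.
Variables (A : comNzRingType) (V : zmodType) (M : A -> Prop) (s : A -> V -> V) (N : V -> Prop).
Definition gen (I : finType) (v : I -> V) : Prop :=
  forall x, exists c : I -> A, N (x - \sum_i s (c i) (v i)).
Definition ind (I : finType) (v : I -> V) : Prop :=
  forall c : I -> A, N (\sum_i s (c i) (v i)) -> forall i, M (c i).
(** A free basis of [V / N] over [A / M]. For maximal [M] this is the dimension; [ffun_dim] uses it
    over [A / I_e], which in general is not a field. *)
Definition has_dim (d : nat) : Prop := exists v : 'I_d -> V, gen v /\ ind v.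
Definition gen_by (d : nat) : Prop := exists v : 'I_d -> V, gen v.

Lemma gen_fin (I : finType) (v : I -> V) : gen v -> gen (fun i : 'I_#|I| => v (enum_val i)).
Proof.
move=> h x; have [c hc] := h x; exists (fun i => c (enum_val i)).
by rewrite (sum_enum_val (fun i => s (c i) (v i))).
Qed.
Lemma gen_by_fin (I : finType) (v : I -> V) d : gen v -> #|I| = d -> gen_by d.
Proof. by move=> /gen_fin h <-; eexists; exact: h. Qed.
Lemma ind_fin (I : finType) (v : I -> V) : ind v -> ind (fun i : 'I_#|I| => v (enum_val i)).
Proof.
move=> h c hc i; have := h (c \o enum_rank); rewrite -sum_enum_val /=.
under eq_bigr => j _ do rewrite enum_valK.
by move=> /(_ hc (enum_val i)); rewrite enum_valK.
Qed.
Lemma has_dim_fin (I : finType) (v : I -> V) d : gen v -> ind v -> #|I| = d -> has_dim d.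
Proof. by move=> /gen_fin h /ind_fin h' <-; eexists; split; [exact: h|exact: h']. Qed.
Lemma has_dim_gen d : has_dim d -> gen_by d.
Proof. by move=> [v [h _]]; exists v. Qed.

Hypothesis ks : kspace M s N.
Lemma ks0l v : s 0 v = 0. Proof. exact: (morphD_eq0 (ksDl ks v)). Qed.
Lemma ks0r a : s a 0 = 0. Proof. exact: (morphD_eq0 (ksDr ks a)). Qed.
Lemma ksNl a v : s (- a) v = - s a v.
Proof. by apply/eqP; rewrite -addr_eq0 -(ksDl ks) addNr ks0l. Qed.
Lemma ks_suml (I : finType) (F : I -> A) v : s (\sum_i F i) v = \sum_i s (F i) v.
Proof. exact: (big_morph (s^~ v) (ksDl ks v) (ks0l v)). Qed.
Lemma ks_sumr (I : finType) (F : I -> V) a : s a (\sum_i F i) = \sum_i s a (F i).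
Proof. exact: (big_morph (s a) (ksDr ks a) (ks0r a)). Qed.
Lemma ksNN x : N x -> N (- x).
Proof. by move=> h; rewrite -sub0r; apply: (ksNB ks) => //; apply: (ksN0 ks). Qed.
Lemma ksND x y : N x -> N y -> N (x + y).
Proof. by move=> hx hy; rewrite -[y]opprK; apply: (ksNB ks) => //; apply: ksNN. Qed.
Lemma ksN_sum (I : finType) (F : I -> V) : (forall i, N (F i)) -> N (\sum_i F i).
Proof. by move=> h; apply: (big_ind N) => //; [exact: (ksN0 ks) | exact: ksND]. Qed.
Lemma ksN_trans y x z : N (x - y) -> N (y - z) -> N (x - z).
Proof. by move=> h k; have := ksND h k; rewrite addrA subrK. Qed.

(** If [w] were longer, its expression through [v] would have a kernel vector with an entry outside
    [M] by [hom_sys], which is a forbidden relation among the [w j]. *)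
Lemma steinitz (I J : finType) (v : I -> V) (w : J -> V) :
  is_prime M -> gen v -> ind w -> (#|J| <= #|I|)%N.
Proof.
move=> pM gv iw; rewrite leqNgt; apply/negP => lt.
have /choice [f hf] : forall j, exists c : I -> A, N (w j - \sum_i s (c i) (v i)).
  by move=> j; apply: gv.
have [c [[j cj] hc]] := hom_sys f pM lt.
apply: cj; apply: iw j.
rewrite [X in N X](_ : _ = \sum_j s (c j) (w j - \sum_i s (f j i) (v i)) +
    \sum_i s (\sum_j c j * f j i) (v i)).
  apply: ksND; apply: ksN_sum => k; first exact: (ksNs ks).
  exact: (ksNk ks).
under [X in _ = _ + X]eq_bigr => i _ do rewrite ks_suml.
rewrite exchange_big -big_split /=; apply: eq_bigr => k _.
under [X in _ = _ + X]eq_bigr => i _ do rewrite (ksM ks).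
by rewrite -ks_sumr -(ksDr ks) subrK.
Qed.

Lemma dim_le d I (v : 'I_d -> V) : is_prime M -> ind v -> gen_by I -> (d <= I)%N.
Proof. by move=> pM iv [w gw]; have := steinitz pM gw iv; rewrite !card_ord. Qed.
Lemma has_dim_le d e : is_prime M -> has_dim d -> gen_by e -> (d <= e)%N.
Proof. by move=> pM [v [_ iv]]; apply: dim_le iv. Qed.
Lemma has_dim_uniq d e : is_prime M -> has_dim d -> has_dim e -> d = e.
Proof.
move=> pM hd he; apply/eqP; rewrite eqn_leq.
by rewrite !(has_dim_le pM) //; apply: has_dim_gen.
Qed.
Lemma ind_dim_le (J : finType) (w : J -> V) d : is_prime M -> ind w -> has_dim d ->
  (#|J| <= d)%N.
Proof. by move=> pM iw [v [gv _]]; have := steinitz pM gv iw; rewrite card_ord. Qed.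

(** In a generating family of least size every relation has its coefficients in [M]: a coefficient
    outside [M] is invertible, and its generator could be omitted. *)
Lemma exists_dim d : (forall a, ~ M a -> exists b, b * a = 1) -> gen_by d ->
  exists e, has_dim e.
Proof.
move=> unit hd.
have hd' : exists d, `[< gen_by d >] by exists d; apply/asboolP.
case: (ex_minnP hd') => {hd hd'} {}d /asboolP[v gv] dmin; exists d, v; split=> // c hc i0.
apply: contrapT => /unit[b bc].
case: d => [|d] in v gv dmin c hc i0 bc *; first by case: (i0).
suff : (d.+1 <= d)%N by rewrite ltnn.
apply: dmin; apply/asboolP; exists (v \o lift i0) => x.
have [e he] := gv x.
exists (fun k => e (lift i0 k) - e i0 * b * c (lift i0 k)).
move: he hc; rewrite !(bigD1_ord i0) //= => he hc.
have {}hc := ksNs ks (e i0 * b) hc.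
rewrite (ksDr ks) -(ksM ks) -mulrA bc mulr1 in hc.
have := ksND he hc; congr N.
rewrite (_ : \sum_i s (_ - _) _ = \sum_i s (e (lift i0 i)) (v (lift i0 i)) -
  s (e i0 * b) (\sum_i s (c (lift i0 i)) (v (lift i0 i)))).
  by rewrite !opprD opprK !addrA [_ - s _ _ - _]addrAC subrK.
rewrite ks_sumr -sumrB; apply: eq_bigr => k _.
by rewrite (ksDl ks) ksNl (ksM ks (e i0 * b)).
Qed.
End Families.

Section Tower.
Variables (A1 A2 : comNzRingType) (V : zmodType) (M1 : A1 -> Prop) (M : A2 -> Prop).
Variables (N : V -> Prop) (s1 : A1 -> A2 -> A2) (s2 : A2 -> V -> V) (s : A1 -> V -> V).
Hypothesis ks2 : kspace M s2 N.
Hypothesis s12 : forall a b v, s2 (s1 a b) v = s a (s2 b v).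
Variables (I J : finType) (v : I -> V) (w : J -> A2).

Lemma tower_sum (c : I * J -> A1) : \sum_u s (c u) (s2 (w u.2) (v u.1)) =
  \sum_i s2 (\sum_j s1 (c (i, j)) (w j)) (v i).
Proof.
under [RHS]eq_bigr => i _ do rewrite (ks_suml ks2).
rewrite pair_bigA /=; apply: eq_bigr => -[i j] _ /=; by rewrite s12.
Qed.
Lemma gen_tower : gen s1 M w -> gen s2 N v ->
  gen s N (fun u : I * J => s2 (w u.2) (v u.1)).
Proof.
move=> gw gv x; have [c hc] := gv x.
have /choice [d hd] : forall i, exists d : J -> A1, M (c i - \sum_j s1 (d j) (w j)).
  by move=> i; apply: gw.
exists (fun u => d u.1 u.2); rewrite tower_sum.
apply: (ksN_trans ks2 hc); rewrite -sumrB; apply: (ksN_sum ks2) => i.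
by rewrite -(ksNl ks2) -(ksDl ks2); apply: (ksNk ks2).
Qed.
Lemma ind_tower : ind M1 s1 M w -> ind M s2 N v ->
  ind M1 s N (fun u : I * J => s2 (w u.2) (v u.1)).
Proof.
move=> iw iv c; rewrite tower_sum => h [i j].
by apply: (iw (fun j => c (i, j))); move: h => /iv/(_ i).
Qed.
End Tower.

(** The tower law. The three actions are linked only by compatibility, so it covers iterated
    Frobenius, the residue extension, and the passage from [(A / I)^r] to the residue field. *)
Lemma has_dim_tower (A1 A2 : comNzRingType) (V : zmodType) (M1 : A1 -> Prop) (M : A2 -> Prop)
    (N : V -> Prop) (s1 : A1 -> A2 -> A2) (s2 : A2 -> V -> V) (s : A1 -> V -> V) d e :
  kspace M s2 N -> (forall a b v, s2 (s1 a b) v = s a (s2 b v)) ->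
  has_dim M1 s1 M d -> has_dim M s2 N e -> has_dim M1 s N (e * d).
Proof.
move=> ks2 s12 [w [gw iw]] [v [gv iv]].
apply: has_dim_fin (gen_tower ks2 s12 gw gv) (ind_tower ks2 s12 iw iv) _.
by rewrite card_prod !card_ord.
Qed.

Lemma gen_by_tower (A1 A2 : comNzRingType) (V : zmodType) (M : A2 -> Prop)
    (N : V -> Prop) (s1 : A1 -> A2 -> A2) (s2 : A2 -> V -> V) (s : A1 -> V -> V) d e :
  kspace M s2 N -> (forall a b v, s2 (s1 a b) v = s a (s2 b v)) ->
  gen_by s1 M d -> gen_by s2 N e -> gen_by s N (e * d).
Proof.
move=> ks2 s12 [w gw] [v gv].
apply: gen_by_fin (gen_tower ks2 s12 gw gv) _.
by rewrite card_prod !card_ord.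
Qed.

(** * Length of a vector space *)

Lemma nat_sup_max (RT : realType) (P : set nat) d :
  P d -> (forall n, P n -> (n <= d)%N) -> nat_sup RT P = (d%:R)%:E.
Proof.
move=> Pd dmax; apply/eqP; rewrite eq_le; apply/andP; split.
  by apply: ge_ereal_sup => _ [n /dmax nd <-]; rewrite lee_fin ler_nat.
by apply: ereal_sup_ubound; exists d.
Qed.

Section Length.
Variables (A : comNzRingType) (M : A -> Prop).
Hypothesis pM : is_prime M.
Hypothesis unitM : forall a, ~ M a -> exists b, b * a = 1.

Section Span.
Variables (W : lmodType A) (d : nat) (v : 'I_d -> W) (i : nat).
Definition span_pred : {pred W} := fun x =>
  `[< exists c : 'I_d -> A, x = \sum_(j < d | (j < i)%N) c j *: v j >].
Fact span_submod : submod_closed span_pred.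
Proof.
split=> [|a x y /asboolP[c ->] /asboolP[e ->]]; apply/asboolP.
  by exists (fun=> 0); rewrite big1 // => j _; rewrite scale0r.
exists (fun j => a * c j + e j); rewrite scaler_sumr -big_split /=.
by apply: eq_bigr => j _; rewrite scalerDl scalerA.
Qed.
Definition span : submodClosed W :=
  HB.pack span_pred (GRing.isSubmodClosed.Build A W span_pred span_submod).
Lemma spanP x : x \in span <-> exists c : 'I_d -> A, x = \sum_(j < d | (j < i)%N) c j *: v j.
Proof. by split=> [/asboolP|h] //; apply/asboolP. Qed.
End Span.

(** In a relation, let [k] be the last index whose coefficient is outside [M]. That coefficient is a
    unit and the earlier [x j] lie in [L k], so the relation would put [x k] into [L k]. *)
Lemma strict_chain_ind (W : lmodType A) n (L : nat -> submodClosed W) (x : 'I_n -> W) :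
  (forall a (w : W), M a -> a *: w = 0) ->
  (forall i, (i < n)%N -> {subset L i <= L i.+1}) ->
  (forall i : 'I_n, x i \in L i.+1 /\ x i \notin L i) ->
  ind M (fun a w => a *: w) (fun w => w = 0) x.
Proof.
move=> kill sub xP c hc i; apply: contrapT => ci.
have exi : exists i, ~~ `[< M (c i) >] by exists i; apply/asboolPn.
case: (@arg_maxnP _ (i : 'I_n) (fun i => ~~ `[< M (c i) >]) val) => [|k /asboolPn ck kmax].
  exact/asboolPn.
have mono j l : (j <= l)%N -> (l <= n)%N -> {subset L j <= L l}.
  elim: l => [|l IH]; first by rewrite leqn0 => /eqP -> _ y.
  rewrite leq_eqVlt => /orP[/eqP -> _ y //|jl] ln y yj.
  exact: (sub _ ln _ (IH jl (ltnW ln) y yj)).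
have [b bc] := unitM ck; have [_ /negP] := xP k; apply.
rewrite -[x k]scale1r -bc -scalerA; apply: rpredZ.
have /eqP := hc; rewrite (bigD1 k) //= addr_eq0 => /eqP ->.
rewrite -scaleN1r; apply: rpredZ; apply: rpred_sum => j jk.
case: (ltngtP j k) => [lt|lt|/val_inj e]; last by rewrite e eqxx in jk.
  by apply: rpredZ; apply: (mono j.+1) => //; [exact: ltnW | case: (xP j)].
rewrite kill ?rpred0 //; apply: contrapT => cj.
have /kmax h : ~~ `[< M (c j) >] by exact/asboolPn.
by have := leq_ltn_trans (h : (j <= k)%N) lt; rewrite ltnn.
Qed.

Lemma length_dim (RT : realType) (W : lmodType A) d :
  (forall a (w : W), M a -> a *: w = 0) ->
  has_dim M (fun a w => a *: w) (fun w : W => w = 0) d -> length RT W = (d%:R)%:E.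
Proof.
move=> kill hd.
have ks : kspace M (fun a w => a *: w) (fun w : W => w = 0).
  split=> // [v a b|a u v|a b v|v|u v -> ->|a v ->].
  - exact: scalerDl.
  - exact: scalerDr.
  - by rewrite scalerA.
  - exact: scale1r.
  - exact: subr0.
  - exact: scaler0.
apply: nat_sup_max => [|n [L hL]].
  have [v [gv iv]] := hd; exists (span v) => i id; split=> [x|].
    move=> /spanP[c ->]; apply/spanP; exists (fun j : 'I_d => if (j < i)%N then c j else 0).
    rewrite big_mkcond [RHS]big_mkcond; apply: eq_bigr => j _ /=.
    by case: ltnP => h; [rewrite ltnW | rewrite scale0r if_same].
  exists (v (Ordinal id)); first apply/spanP.
    exists (fun j => (j == Ordinal id)%:R); rewrite (bigD1 (Ordinal id)) //= eqxx scale1r.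
    by rewrite big1 ?addr0 // => j /andP[_ /negPf ->]; rewrite scale0r.
  apply/negP => /spanP[c hc].
  pose e (j : 'I_d) := (if (j < i)%N then c j else 0) - (j == Ordinal id)%:R.
  have : \sum_j e j *: v j = 0.
    rewrite /e; under eq_bigr => j _ do rewrite scalerBl.
    rewrite sumrB [X in _ - X](bigD1 (Ordinal id)) //= eqxx scale1r.
    rewrite [X in _ - (_ + X)]big1 => [|j /negPf ->]; last by rewrite scale0r.
    rewrite addr0 hc [X in _ - X]big_mkcond -sumrB big1 // => j _.
    by case: ifP; rewrite ?scale0r subrr.
  move=> /iv/(_ (Ordinal id)); rewrite /e ltnn eqxx sub0r.
  case: pM => idM M1 _ /(is_idealN idM); rewrite opprK; exact: M1.
have /choice [x xP] : forall i : 'I_n, exists x, x \in L i.+1 /\ x \notin L i.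
  by move=> i; have [_ [x x1 x2]] := hL i (ltn_ord i); exists x.
have /(ind_dim_le ks pM)/(_ hd) := strict_chain_ind kill (fun i h => (hL i h).1) xP.
by rewrite card_ord.
Qed.

Lemma length_lquot (RT : realType) (V : lmodType A) (N : submodClosed V) d :
  (forall a v, M a -> a *: v \in N) ->
  has_dim M (fun a w => a *: w) (fun v : V => v \in N) d ->
  length RT (lquot N) = (d%:R)%:E.
Proof.
move=> kill [v [gv iv]].
have pi0 (x : V) : \pi_(lquot N) x = 0 <-> x \in N.
  have e0 : 0 = \pi_(lquot N) 0 by apply: (@addrI _ (\pi_(lquot N) 0)); rewrite addr0 -lquotD addr0.
  split=> [/eqP|h]; last by rewrite e0; apply: lquot_eq; rewrite subr0.
  by rewrite e0 -Quotient.idealrBE subr0.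
have piS I (c : 'I_I -> A) w : \sum_i c i *: (\pi_(lquot N) (w i) : lquot N) = \pi_(lquot N) (\sum_i c i *: w i).
  elim: I c w => [|I IH] c w; first by rewrite !big_ord0; apply/esym/pi0; rewrite rpred0.
  by rewrite !big_ord_recr lquotD /= IH; congr (_ + _); exact: lquot_scaleE.
apply: length_dim => [a|].
  by elim/lquot_ind => w Ma; rewrite -[LHS]/(lquot_scale a _) lquot_scaleE; apply/pi0/kill.
exists (fun i => \pi_(lquot N) (v i) : lquot N); split=> [|c].
  elim/lquot_ind => w; have [c hc] := gv w; exists c; rewrite piS.
  apply/eqP; rewrite subr_eq0 -Quotient.idealrBE; exact: hc.
by rewrite piS => /pi0/iv.
Qed.
End Length.

(** * Splitting numbers *)

(** Dual to [exists_dim]: an independent family of greatest size generates. It serves for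
    [C_e / C_e^ns], where no finite generating family is at hand and the bound comes from the
    evaluation pairing. *)
Lemma exists_dim_bounded (A : comNzRingType) (V : zmodType) (M : A -> Prop) (s : A -> V -> V)
    (N : V -> Prop) d :
  kspace M s N -> is_prime M -> (forall a, ~ M a -> exists b, b * a = 1) ->
  (forall e (w : 'I_e -> V), ind M s N w -> (e <= d)%N) ->
  exists e, has_dim M s N e.
Proof.
move=> ks pM unit bnd.
have ex : exists e, `[< exists w : 'I_e -> V, ind M s N w >].
  by exists 0%N; apply/asboolP; exists (fun=> 0) => c _ [].
have bnd' e : `[< exists w : 'I_e -> V, ind M s N w >] -> (e <= d)%N.
  by move=> /asboolP[w /bnd].
case: (ex_maxnP ex bnd') => {ex bnd'} e /asboolP[w iw] emax; exists e, w; split=> // x.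
apply: contrapT => nx.
pose w' (i : 'I_e.+1) := if unlift ord0 i is Some k then w k else x.
suff /asboolP/emax : exists w' : 'I_e.+1 -> V, ind M s N w' by rewrite ltnn.
exists w' => c; rewrite big_ord_recl {1}/w' unlift_none.
under eq_bigr => i _ do rewrite /w' liftK.
move=> h; have c0 : M (c ord0).
  apply: contrapT => /unit[b bc]; apply: nx.
  exists (fun k => - (b * c (lift ord0 k))).
  have := ksNs ks b h; rewrite (ksDr ks) -(ksM ks) bc (ks1 ks) (ks_sumr ks); congr (N (_ + _)).
  by rewrite -sumrN; apply: eq_bigr => k _; rewrite (ksNl ks) opprK (ksM ks).
have hw : N (\sum_(i < e) s (c (lift ord0 i)) (w i)).
  have := ksNB ks h (ksNk ks x c0); by rewrite addrAC subrr add0r.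
move=> i; case: (unliftP ord0 i) => [k ->|-> //].
exact: (iw (fun k => c (lift ord0 k))).
Qed.

Section LocalRing.
Variables (A : comNzRingType) (m : idealr A).
Hypothesis mP : local_ring m.
Lemma idealr_is_ideal (I : idealr A) : is_ideal (fun a => a \in I).
Proof. by split=> [|x y xI yI|a x xI]; [exact: idealr0 | exact: rpredD | exact: idealMr]. Qed.
Lemma local_unit a : ~ a \in m -> exists b, b * a = 1.
Proof.
move=> am; apply: contrapT => h; apply: am; apply/mP => -[b ab]; apply: h.
by exists b; rewrite mulrC.
Qed.
Lemma local_prime : is_prime (fun a => a \in m).
Proof.
split; [exact: idealr_is_ideal | by rewrite idealr1 | move=> x y xy].
apply: contrapT => h; have /local_unit[b bx] : ~ x \in m by move=> ?; apply: h; left.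
apply: h; right; rewrite -[y]mul1r -bx -mulrA; exact: idealMr.
Qed.
Lemma ideal_local (I : A -> Prop) a : is_ideal I -> ~ I 1 -> I a -> a \in m.
Proof.
move=> idI I1 Ia; apply/mP => -[b ab]; apply: I1; rewrite -ab.
exact: (is_idealMr idI).
Qed.
End LocalRing.

(* The action of [A] on [F^e_* B] along [th : A -> B]. *)
Definition frob (A B : comNzRingType) (th : A -> B) p e (a : A) (x : B) : B :=
  th a ^+ (p ^ e) * x.

Lemma expr_pcharD (A : comNzRingType) p e (x y : A) : p \in [pchar A] ->
  (x + y) ^+ (p ^ e) = x ^+ (p ^ e) + y ^+ (p ^ e).
Proof. by move=> pA; apply: exprDn_pchar; rewrite pnatX pnatE ?pA ?(pcharf_prime pA). Qed.

Lemma frob_kspace (A B : comNzRingType) (th : {rmorphism A -> B}) p e (M : A -> Prop)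
    (N : B -> Prop) :
  p \in [pchar B] -> is_ideal N -> (forall a, M a -> N (th a ^+ (p ^ e))) ->
  kspace M (frob th p e) N.
Proof.
move=> pB idN MN; rewrite /frob; split.
- by move=> v a b; rewrite rmorphD expr_pcharD // mulrDl.
- by move=> a u v; rewrite mulrDr.
- by move=> a b v; rewrite rmorphM exprMn mulrA.
- by move=> v; rewrite rmorph1 expr1n mul1r.
- exact: is_ideal0.
- exact: is_idealB.
- by move=> a v; apply: is_idealMl.
- by move=> a v /MN; apply: is_idealMr.
Qed.

Lemma frob0_ideal (A : comNzRingType) : is_ideal (fun x : A => x = 0).
Proof. by split=> [|x y -> ->|a x ->]; rewrite ?addr0 ?mulr0. Qed.

Lemma frob_comp (A B C : comNzRingType) (th : {rmorphism A -> B}) (ph : {rmorphism B -> C}) p e f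
    (a : A) (b : B) (x : C) :
  frob ph p f (frob th p e a b) x = frob (ph \o th) p (e + f) a (frob ph p f b x).
Proof. by rewrite /frob /= rmorphM rmorphXn exprMn -exprM -expnD mulrA. Qed.

Lemma gen_mono (A : comNzRingType) (V : zmodType) (s : A -> V -> V) (N N' : V -> Prop)
    (I : finType) (v : I -> V) :
  (forall x, N x -> N' x) -> gen s N v -> gen s N' v.
Proof. by move=> NN gv x; have [c /NN h] := gv x; exists c. Qed.

Lemma F_finite_gen (A : comNzRingType) p e (N : A -> Prop) : p \in [pchar A] -> F_finite p A ->
  is_ideal N -> exists g, gen_by (frob idfun p e) N g.
Proof.
move=> pA [l hl] idN.
suff [g [v gv]] : exists g, gen_by (frob (@idfun A) p e) (fun x => x = 0) g.
  by exists g, v; apply: gen_mono gv => x ->; apply: is_ideal0.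
have g1 : gen_by (frob (@idfun A) p 1) (fun x => x = 0) (size l).
  exists (fun i : 'I_(size l) => l`_i) => x; have [c ->] := hl x; exists (fun i : 'I_(size l) => c i).
  by rewrite /frob expn1 subrr.
elim: e => [|e [g IH]].
  exists 1%N, (fun=> 1) => x; exists (fun=> x).
  by rewrite big_ord1 /frob expn0 mulr1 subrr.
exists (size l * g)%N; apply: gen_by_tower IH g1.
  apply: (@frob_kspace _ _ idfun p 1 (fun x => x = 0)) => //; first exact: frob0_ideal.
  by move=> a -> /=; rewrite expn1 expr0n; case: (p) (pcharf_prime pA).
by move=> a b v; rewrite (frob_comp idfun idfun) addn1.
Qed.

(** The source of the factor [N ^ e] in the estimates of growth: [N] is [[k : k^p]], and the tower
    law gives [[k : k^q] = N ^ e] for [q = p ^ e]. *)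
Lemma residue_frob_dim (A : comNzRingType) (m : A -> Prop) p e N : p \in [pchar A] ->
  is_prime m -> has_dim m (frob idfun p 1) m N -> has_dim m (frob idfun p e) m (N ^ e).
Proof.
move=> pA [idm m1 mM] h1; have p0 := prime_gt0 (pcharf_prime pA).
elim: e => [|e IH].
  exists (fun=> 1); split=> [x|c].
    exists (fun=> x); rewrite big_ord1 /frob expn0 mulr1 subrr; exact: is_ideal0.
  by rewrite big_ord1 /frob expn0 mulr1 => h i; rewrite ord1.
rewrite expnS; apply: has_dim_tower IH h1.
  apply: (@frob_kspace _ _ idfun p 1 m) => // a ma /=; rewrite expn1 -(prednK p0) exprS.
  exact: is_idealMr.
by move=> a b v; rewrite (frob_comp idfun idfun) addn1.
Qed.

Section SplittingNumber.
Variables (RT : realType) (p : nat) (A : comNzRingType) (m : idealr A).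
Hypotheses (pA : p \in [pchar A]) (mP : local_ring m).
Variables (C : cartierAlg p A) (phi : cartierAction C).

Definition split_ideal e (x : A) : Prop := forall k : C e, act phi k x \in m.

Lemma act_cright e a (k : C e) x : act phi (cright a k) x = act phi k (a * x).
Proof.
have h : forall f (l : C f), Tagged (cpiece C) l = Tagged (cpiece C) (cright a k) ->
    act phi l x = act phi (cright a k) x.
  move=> f l hl.
  exact: (congr1 (fun u : {e & C e} => act phi (tagged u) x) hl).
by rewrite -(h _ _ (esym (cright_Tagged a k))) act_cmul act_cscal.
Qed.
Lemma act_cleft e a (k : C e) x : act phi (cleft a k) x = a * act phi k x.
Proof. exact: etrans (act_cmul phi (cscal C a) k x) (act_cscal phi a _). Qed.
Lemma actD e (k : C e) : {morph act phi k : x y / x + y}.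
Proof. by case: (act_plinear phi k). Qed.
Lemma act0 e (k : C e) : act phi k 0 = 0.
Proof. exact: morphD_eq0 (actD k). Qed.
Lemma actZ e (k : C e) a x : act phi k (a ^+ (p ^ e) * x) = a * act phi k x.
Proof. by case: (act_plinear phi k). Qed.
Lemma act_sum (I : finType) (F : I -> A) e (k : C e) :
  act phi k (\sum_i F i) = \sum_i act phi k (F i).
Proof. exact: (big_morph _ (actD k) (act0 k)). Qed.
Lemma act0l e x : act phi (0 : C e) x = 0.
Proof. by apply: (@addrI _ (act phi (0 : C e) x)); rewrite -act_add !addr0. Qed.
Lemma act_suml (I : finType) e (k : I -> lpiece C e) (c : I -> A) x :
  act phi (\sum_i c i *: k i : lpiece C e) x = \sum_i c i * act phi (k i : C e) x.
Proof.
rewrite (big_morph (fun k : lpiece C e => act phi (k : C e) x) (fun k l => act_add phi k l x) (act0l e x)).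
apply: eq_bigr => i _; exact: act_cleft.
Qed.

Lemma split_ideal_ideal e : is_ideal (split_ideal e).
Proof.
split=> [k|x y hx hy k|a x hx k]; first by rewrite act0 idealr0.
  by rewrite actD rpredD.
by rewrite -act_cright.
Qed.
Lemma split_ideal_frob e a : a \in m -> split_ideal e (a ^+ (p ^ e)).
Proof. by move=> am k; rewrite -[_ ^+ _]mulr1 actZ mulrC idealMr. Qed.
Lemma split_kspace e : kspace (fun a => a \in m) (frob idfun p e) (split_ideal e).
Proof.
apply: (@frob_kspace _ _ idfun) => // [|a /=]; first exact: split_ideal_ideal.
exact: split_ideal_frob.
Qed.
Lemma split_dim_exists e : F_finite p A ->
  exists d, has_dim (fun a => a \in m) (frob idfun p e) (split_ideal e) d.
Proof.
move=> fA; have [g hg] := F_finite_gen e pA fA (split_ideal_ideal e).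
apply: exists_dim hg; [exact: split_kspace | exact: local_unit].
Qed.

(* Evaluation pairs [C_e / C_e^ns] perfectly with [F^e_* (A / I_e)]. *)
Lemma splitting_number_dim e d :
  has_dim (fun a => a \in m) (frob idfun p e) (split_ideal e) d ->
  splitting_number RT m phi e = (d%:R)%:E.
Proof.
move=> hd; have pm := local_prime mP; have um := local_unit mP.
have [v [gv iv]] := hd.
pose s (a : A) (k : lpiece C e) := a *: k.
pose N (k : lpiece C e) := k \in @nonsplit p A m C phi e.
have NP (k : lpiece C e) : N k <-> forall r, act phi (k : C e) r \in m.
  by split=> [/asboolP|h] //; apply/asboolP.
have ks : kspace (fun a => a \in m) s N.
  rewrite /s; split=> [k a b|a k l|a b k|k||k l hk hl|a k hk|a k am].
  - exact: scalerDl.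
  - exact: scalerDr.
  - by rewrite scalerA.
  - exact: scale1r.
  - exact: rpred0.
  - rewrite /N -scaleN1r addrC; apply: rpredD hk; exact: rpredZ.
  - exact: rpredZ.
  - by apply/NP => r; rewrite act_cleft mulrC idealMr.
have Nv (k : lpiece C e) : (forall j, act phi (k : C e) (v j) \in m) -> N k.
  move=> h; apply/NP => x; have [c hc] := gv x.
  rewrite -[x](subrK (\sum_i frob idfun p e (c i) (v i))) actD rpredD //.
  rewrite act_sum; apply: rpred_sum => i _.
  by rewrite actZ idealMr.
(* More than [d] maps [w i] have a nontrivial combination that sends every [v j] into [m], and such
   a combination is nonsplit. *)
have bnd n (w : 'I_n -> lpiece C e) : ind (fun a => a \in m) s N w -> (n <= d)%N.
  move=> iw; rewrite leqNgt; apply/negP => lt.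
  have lt' : (#|'I_d| < #|'I_n|)%N by rewrite !card_ord.
  have [c [[i ci] hc]] := hom_sys (fun i j => act phi (w i : C e) (v j)) pm lt'.
  by apply: ci; apply: (iw c _ i); apply: Nv => j; rewrite act_suml.
have [n hn] := exists_dim_bounded ks pm um bnd.
suff -> : d = n by apply: length_lquot hn => // a k; apply: (ksNk ks).
have [w [gw iw]] := hn.
(* Conversely, if [n < d], a nontrivial combination of the [v j] is sent into [m] by all [w i],
   hence by all of [C_e], so it lies in [I_e]. *)
apply/eqP; rewrite eqn_leq (bnd _ _ iw) andbT leqNgt; apply/negP => lt.
have lt' : (#|'I_n| < #|'I_d|)%N by rewrite !card_ord.
have [c [[i ci] hc]] := hom_sys (fun j i => act phi (w i : C e) (v j)) pm lt'.
apply: ci; apply: (iv c _ i) => k; have [b /NP hb] := gw k.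
have := rpredD (hb (\sum_i frob idfun p e (c i) (v i)))
  (_ : act phi (\sum_i s (b i) (w i) : lpiece C e) (\sum_i frob idfun p e (c i) (v i)) \in m).
rewrite -act_add subrK; apply.
rewrite act_suml; apply: rpred_sum => j _; apply: idealMr.
by rewrite act_sum; under eq_bigr => l _ do rewrite actZ /=.
Qed.
End SplittingNumber.
Arguments split_ideal_ideal [p A] m [C] phi e.
Arguments split_kspace [p A] m pA [C] phi e.

(** * Noetherian rings and systems of parameters *)

Section Noetherian.
Variable A : comNzRingType.
Implicit Types (I J P : A -> Prop).

Lemma idealr_of I : is_ideal I -> ~ I 1 -> exists J : idealr A, forall x, x \in J <-> I x.
Proof.
move=> idI I1; pose S : {pred A} := fun x => `[< I x >].
have SP x : x \in S <-> I x by split=> [/asboolP|h] //; apply/asboolP.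
have cS : idealr_closed S.
  split; [by apply/SP; apply: is_ideal0 | exact/negP/SP | move=> a u v /SP hu /SP hv].
  by apply/SP; apply: is_idealD => //; apply: is_idealMl.
by exists (idealr_pack cS).
Qed.

Lemma prime_idealr_of P : is_prime P -> exists Q : prime_idealr A, forall x, x \in Q <-> P x.
Proof.
move=> [idP P1 PM]; pose S : {pred A} := fun x => `[< P x >].
have SP x : x \in S <-> P x by split=> [/asboolP|h] //; apply/asboolP.
have cS : idealr_closed S.
  split; [by apply/SP; apply: is_ideal0 | exact/negP/SP | move=> a u v /SP hu /SP hv].
  by apply/SP; apply: is_idealD => //; apply: is_idealMl.
have pS : prime_idealr_closed S.
  by move=> u v /SP/PM[h|h]; apply/orP; [left|right]; apply/SP.
pose Q : prime_idealr A := HB.pack S (isIdealr.Build A S cS) (isPrimeIdealrClosed.Build A S pS).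
by exists Q.
Qed.

Lemma prime_idealr_prime (P : prime_idealr A) : is_prime (fun x => x \in P).
Proof.
split; [exact: idealr_is_ideal | by rewrite idealr1 |].
by move=> x y; rewrite prime_idealrM => /orP.
Qed.

Definition add1 I a : A -> Prop := fun x => exists y b, I y /\ x = y + b * a.
Lemma add1_ideal I a : is_ideal I -> is_ideal (add1 I a).
Proof.
move=> idI; split.
- by exists 0, 0; split; [exact: is_ideal0 | rewrite mul0r addr0].
- move=> _ _ [y [b [hy ->]]] [z [c [hz ->]]]; exists (y + z), (b + c).
  by split; [exact: is_idealD | ring].
- move=> r _ [y [b [hy ->]]]; exists (r * y), (r * b).
  by split; [exact: is_idealMl | ring].
Qed.
Lemma add1_sub I a x : I x -> add1 I a x.
Proof. by move=> h; exists x, 0; rewrite mul0r addr0. Qed.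
Lemma add1_mem I a : is_ideal I -> add1 I a a.
Proof. by move=> h; exists 0, 1; rewrite mul1r add0r; split=> //; apply: is_ideal0. Qed.
Lemma add1_min I a J : is_ideal J -> (forall x, I x -> J x) -> J a -> forall x, add1 I a x -> J x.
Proof.
move=> idJ IJ Ja _ [y [b [/IJ hy ->]]].
by apply: is_idealD => //; apply: is_idealMl.
Qed.

Hypothesis noethA : noetherian A.

(** If no member of [F] were maximal, dependent choice would give a strictly increasing sequence;
    finitely many generators of its union lie in one stage. *)
Lemma noeth_max (F : (A -> Prop) -> Prop) I0 : is_ideal I0 -> F I0 ->
  exists I, [/\ is_ideal I, F I & forall J, is_ideal J -> F J -> (forall x, I x -> J x) ->
    forall x, J x -> I x].
Proof.
move=> idI0 FI0; apply: contrapT => none.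
pose good := {I : A -> Prop | is_ideal I /\ F I}.
have step (I : good) : exists J : good, (forall x, sval I x -> sval J x) /\
    exists x, sval J x /\ ~ sval I x.
  apply: contrapT => h; apply: none; case: I h => I [idI FI] h; exists I; split=> // J idJ FJ IJ x Jx.
  apply: contrapT => Ix; apply: h; exists (exist _ J (conj idJ FJ)); split=> //.
  by exists x.
have [next nextP] := choice step.
pose u n := iter n next (exist _ I0 (conj idI0 FI0) : good).
have mono i j x : (i <= j)%N -> sval (u i) x -> sval (u j) x.
  elim: j => [|j IH]; first by rewrite leqn0 => /eqP ->.
  by rewrite leq_eqVlt => /orP[/eqP -> //|/IH h /h]; apply: (nextP _).1.
have idu n : is_ideal (sval (u n)) by case: (svalP (u n)).
pose U x := exists n, sval (u n) x.
have idU : is_ideal U.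
  split=> [|x y [i hi] [j hj]|a x [i hi]].
  - by exists 0%N; apply: is_ideal0.
  - by exists (maxn i j); apply: is_idealD => //; apply: mono;
      [exact: leq_maxl | exact: hi | exact: leq_maxr | exact: hj].
  - by exists i; apply: is_idealMl.
suff [n hn] : exists n, forall x, U x -> sval (u n) x.
  by have [_ [x [x1 x2]]] := nextP (u n); apply: x2; apply: hn; exists n.+1.
(* [noetherian] speaks of [idealr], hence of proper ideals; a union that contains [1] is treated
   apart. *)
case: (pselect (U 1)) => [[n hn]|U1].
  by exists n => x _; rewrite -[x]mulr1; apply: is_idealMl.
have [J JP] := idealr_of idU U1; have [s sP] := noethA J.
have /choice [k kP] : forall i : 'I_(size s), exists k, sval (u k) s`_i.
  move=> i; suff /JP : s`_i \in J by [].
  apply/sP; exists (fun j : nat => (j == i :> nat)%:R); rewrite (bigD1 i) //= eqxx mul1r big1 ?addr0 // => j.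
  by move=> /negPf h; rewrite (val_eqE j i) h mul0r.
exists (\max_i k i) => x /JP/sP[c ->].
apply: is_ideal_sum => // i; apply: is_idealMl => //.
by apply: mono (kP i); apply: leq_bigmax.
Qed.

Lemma noeth_ind (Q : (A -> Prop) -> Prop) :
  (forall I, is_ideal I -> (forall J, is_ideal J -> (forall x, I x -> J x) ->
    (exists x, J x /\ ~ I x) -> Q J) -> Q I) ->
  forall I, is_ideal I -> Q I.
Proof.
move=> step I0 id0; apply: contrapT => Q0.
have [I [idI QI max]] := noeth_max (F := fun I => ~ Q I) id0 Q0.
apply: QI; apply: step => // J idJ IJ [x [Jx Ix]]; apply: contrapT => QJ.
by apply: Ix; apply: max Jx.
Qed.

(** Noetherian induction: if [x y] is in [I] but [x] and [y] are not, a prime over [I] contains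
    [I + (x)] or [I + (y)]. Among the [Q i] are all minimal primes of [I]. *)
Lemma finite_primes I : is_ideal I -> exists n (Q : nat -> A -> Prop),
  (forall i, (i < n)%N -> is_prime (Q i) /\ forall x, I x -> Q i x) /\
  forall P, is_prime P -> (forall x, I x -> P x) -> exists2 i, (i < n)%N & forall x, Q i x -> P x.
Proof.
move: I; apply: noeth_ind => I idI IH.
case: (pselect (I 1)) => [I1|I1].
  by exists 0%N, (fun _ _ => True); split=> // P [_ P1 _] /(_ _ I1).
case: (pselect (exists x y, [/\ I (x * y), ~ I x & ~ I y])) => [|h]; last first.
  exists 1%N, (fun=> I); split=> [_ _|P _ IP]; last by exists 0%N.
  split=> //; split=> // x y xy; apply: contrapT => /not_orP[hx hy].
  by apply: h; exists x, y.
move=> [x [y [xy hx hy]]].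
have [n1 [Q1 [h1 k1]]] := IH (add1 I x) (add1_ideal x idI) (@add1_sub I x)
  (ex_intro _ x (conj (add1_mem x idI) hx)).
have [n2 [Q2 [h2 k2]]] := IH (add1 I y) (add1_ideal y idI) (@add1_sub I y)
  (ex_intro _ y (conj (add1_mem y idI) hy)).
exists (n1 + n2)%N, (fun i => if (i < n1)%N then Q1 i else Q2 (i - n1)%N); split=> [i hi|P pP IP].
  case: ifP => i1.
    by have [q1 q2] := h1 i i1; split=> // z /add1_sub - /(_ x) /q2.
  have [|q1 q2] := h2 (i - n1)%N; first by rewrite ltn_subLR // leqNgt i1.
  by split=> // z /add1_sub - /(_ y) /q2.
case: (pP) => idP P1 PM; have [Px|Py] := PM _ _ (IP _ xy).
  have [i i1 hi] := k1 P pP (add1_min idP IP Px).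
  by exists i; [exact: ltn_addr | rewrite i1].
have [i i2 hi] := k2 P pP (add1_min idP IP Py).
by exists (n1 + i)%N; [rewrite ltn_add2l | rewrite ltnNge leq_addr /= addKn].
Qed.

(** An ideal over [I] that is maximal among those containing no power of [a] is prime. *)
Lemma radical_nilpotent I a : is_ideal I ->
  (forall P, is_prime P -> (forall x, I x -> P x) -> P a) -> exists h, I (a ^+ h).
Proof.
move=> idI hP; apply: contrapT => /forallNP nil.
have [J [idJ [IJ nJ] maxJ]] := noeth_max
  (F := fun J => (forall x, I x -> J x) /\ forall h, ~ J (a ^+ h)) idI (conj (fun x h => h) nil).
have step x : ~ J x -> exists h, add1 J x (a ^+ h).
  move=> Jx; apply: contrapT => /forallNP h; apply: Jx.
  apply: (maxJ (add1 J x)); [exact: add1_ideal | | exact: add1_sub | exact: add1_mem].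
  by split=> // y /IJ; apply: add1_sub.
apply: (nJ 1%N); rewrite expr1; apply: hP => //; split=> // [|x y xy].
  exact: (nJ 0%N).
apply: contrapT => /not_orP[/step[h [u [b [hu eu]]]] /step[k [v [c [hv ev]]]]].
apply: (nJ (h + k)%N); rewrite exprD eu ev.
rewrite (_ : _ * _ = (v + c * y) * u + b * x * v + b * c * (x * y)); last by ring.
by apply: is_idealD => //; [apply: is_idealD => // |]; apply: is_idealMl.
Qed.

(** Induction on the number of primes. Avoiding all but one of them, in every possible way, either
    settles the claim or yields [x0] in [Q i0] only and, for each [i] in [l], some [x i] in [Q i]
    only; then [x0 + \prod x i] works. *)
Lemma prime_avoidance (J : A -> Prop) (Q : nat -> A -> Prop) (l : seq nat) : is_ideal J ->
  (forall i, i \in l -> is_prime (Q i) /\ exists x, J x /\ ~ Q i x) ->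
  exists x, J x /\ forall i, i \in l -> ~ Q i x.
Proof.
move=> idJ; elim: {l}_.+1 {-2}l (ltnSn (size l)) => // n IH [|i0 l] sl h.
  by exists 0; split=> //; apply: is_ideal0.
rewrite /= ltnS in sl.
have [|x0 [Jx0 x0P]] := IH l sl; first by move=> i il; apply: h; rewrite inE il orbT.
case: (pselect (Q i0 x0)) => [Qx0|Qx0]; last first.
  by exists x0; split=> // i; rewrite inE => /orP[/eqP ->|/x0P].
case: (boolP (i0 \in l)) => [/x0P //|i0l].
have /choice [x xP] : forall i, exists x, i \in l -> J x /\ forall j, j \in i0 :: l -> j != i -> ~ Q j x.
  move=> i; case: (boolP (i \in l)) => il; last by exists 0.
  have [||x [Jx xP]] := IH [seq j <- i0 :: l | j != i].
  - rewrite /= (_ : i0 != i) /=; last by apply: contraNneq i0l => ->.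
    apply: leq_trans sl; rewrite ltnS size_filter -(count_predC (fun j => j != i) l).
    rewrite -[X in (X < _)%N]addn0 ltn_add2l -has_count.
    by apply/hasP; exists i; rewrite //= negbK.
  - by move=> j; rewrite mem_filter => /andP[_ /h].
  by exists x => _; split=> // j jl ji; apply: xP; rewrite mem_filter ji.
case: (pselect (exists2 i, i \in l & ~ Q i (x i))) => [[i il Qi]|hx].
  exists (x i); have [Jx xQ] := xP i il; split=> // j jl.
  by case: (eqVneq j i) => [->|/xQ h'] //; apply: h'.
have Qx i : i \in l -> Q i (x i) by move=> il; apply: contrapT => q; apply: hx; exists i.
pose y := \prod_(i <- l) x i.
have Qy i (il : i \in l) : Q i y.
  have il' : i \in i0 :: l by rewrite inE il orbT.
  have [[idQ _ _] _] := h i il'.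
  by rewrite /y (perm_big _ (perm_to_rem il)) /= big_cons; apply: is_idealMr => //; apply: Qx.
have Qy0 : ~ Q i0 y.
  have [[_ Q1 QM] _] := h i0 (mem_head _ _); rewrite /y big_seq.
  apply: (big_ind (fun y => ~ Q i0 y)) => // [u v hu hv /QM[]//|i il].
  by have [_ hi] := xP i il; apply: hi; rewrite ?mem_head //; apply: contraNneq i0l => ->.
(* An empty product is [1], which need not lie in [J]; hence the separate case [l = [::]]. *)
have Jy : l <> [::] -> J y.
  move=> l0; case: l => // i l in x0P h i0l xP Qx y Qy Qy0 hx sl l0 *.
  rewrite /y big_cons; apply: is_idealMr => //.
  by have [] := xP i (mem_head _ _).
case: (eqVneq l [::]) => [l0|/eqP/Jy {}Jy].
  have [_ [z [Jz Qz]]] := h i0 (mem_head _ _).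
  by exists z; split=> // i; rewrite l0 inE => /eqP ->.
exists (x0 + y); split; first exact: is_idealD.
move=> i; rewrite inE => /orP[/eqP ->|il] q.
  have [[idQ _ _] _] := h i0 (mem_head _ _).
  by apply: Qy0; rewrite -(addKr x0 y) addrC; apply: is_idealB.
have il' : i \in i0 :: l by rewrite inE il orbT.
have [[idQ _ _] _] := h i il'.
apply: (x0P i il); rewrite -(addrK y x0); apply: is_idealB => //; exact: Qy.
Qed.

Definition pchain n (P : nat -> A -> Prop) : Prop :=
  (forall i, (i <= n)%N -> is_prime (P i)) /\
  forall i, (i < n)%N -> (forall x, P i x -> P i.+1 x) /\ exists x, P i.+1 x /\ ~ P i x.

(** The inequality [dim (A / I) <= k], without forming the quotient. *)
Definition dim_over I k : Prop :=
  forall n (P : nat -> A -> Prop), pchain n P -> (forall x, I x -> P 0%N x) -> (n <= k)%N.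

Lemma pchain_cons n (P : nat -> A -> Prop) (Q : A -> Prop) : is_prime Q -> pchain n P -> (forall x, Q x -> P 0%N x) ->
  (exists x, P 0%N x /\ ~ Q x) -> pchain n.+1 (fun i => if i is j.+1 then P j else Q).
Proof. by move=> pQ [pP sP] QP ex; split=> [[|i] //|[|i] //]; [exact: pP | exact: sP]. Qed.

Fixpoint adds I (xs : seq A) : A -> Prop := if xs is x :: xs' then adds (add1 I x) xs' else I.
Lemma adds_ideal I xs : is_ideal I -> is_ideal (adds I xs).
Proof. by elim: xs I => //= x xs IH I /(add1_ideal x)/IH. Qed.

(* A parameter outside finitely many primes other than [m], one of which lies below each prime
   over [I], lowers the dimension: prime avoidance suffices, without Krull's height theorem. *)
Lemma system_of_parameters (m : idealr A) k I : local_ring m -> is_ideal I -> dim_over I k ->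
  exists xs : seq A, [/\ (size xs <= k)%N, forall x, x \in xs -> x \in m &
    forall a, a \in m -> exists h, adds I xs (a ^+ h)].
Proof.
move=> mP; elim: k I => [|k IH] I idI dI;
  case: (pselect (forall P, is_prime P -> (forall x, I x -> P x) -> forall a, a \in m -> P a)) => hP.
1,3: by exists [::]; split=> // a am; apply: radical_nilpotent => // P pP IP; apply: hP.
- exfalso; apply: hP => P pP IP a am; apply: contrapT => Pa.
  suff : (1 <= 0)%N by [].
  apply: (dI 1%N (fun i => if i is j.+1 then (fun x => x \in m) else P)) => //.
  apply: (@pchain_cons 0%N (fun=> (fun x => x \in m))) => //.
  + by split=> // i _; apply: local_prime.
  + by case: (pP) => idP P1 _ x; apply: ideal_local.
  + by exists a.
have [n [Q [Q1 Q2]]] := finite_primes idI.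
pose l := [seq i <- iota 0 n | ~~ `[< forall x, x \in m -> Q i x >]].
have [|x [xm xQ]] := @prime_avoidance (fun x => x \in m) Q l (idealr_is_ideal m).
  move=> i; rewrite mem_filter mem_iota add0n => /andP[/asboolPn hi iN].
  split; first by case: (Q1 i iN).
  apply: contrapT => h; apply: hi => y ym; apply: contrapT => qy.
  by apply: h; exists y.
have [|xs [s1 s2 s3]] := IH (add1 I x) (add1_ideal x idI).
  move=> r P [pP sP] IP; rewrite leqNgt; apply/negP => kr.
  have IP0 y : I y -> P 0%N y by move=> /add1_sub - /(_ x); apply: IP.
  have [i iN QP] := Q2 (P 0%N) (pP 0%N (leq0n _)) IP0.
  (* If [Q i] is [m], then so is [P 0], and the chain cannot continue. Otherwise [x] separates [P 0]
     from [Q i], and [Q i] in front of the chain makes it too long. *)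
  case: (pselect (forall x, x \in m -> Q i x)) => [hm|hm].
    have r0 : (0 < r)%N by apply: leq_trans kr.
    have [_ [y [y1 y2]]] := sP 0%N r0; apply: y2; apply/QP/hm.
    by have [idP1 P11 _] := pP 1%N r0; apply: ideal_local y1.
  have Qx : ~ Q i x by apply: xQ; rewrite mem_filter mem_iota iN; apply/andP; split=> //; apply/asboolPn.
  suff : (r.+1 <= k.+1)%N by rewrite ltnS leqNgt kr.
  have [q1 q2] := Q1 i iN.
  apply: (dI _ (fun i' => if i' is j.+1 then P j else Q i)) => //.
  apply: pchain_cons => //; exists x; split=> //.
  by apply: IP; apply: add1_mem.
exists (x :: xs); split=> //= y; rewrite inE => /orP[/eqP -> //|]; exact: s2.
Qed.
End Noetherian.

Lemma krull_dimE (RT : realType) (A : comNzRingType) :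
  krull_dim RT A = nat_sup RT [set n | exists P : nat -> A -> Prop, pchain n P]%classic.
Proof.
congr nat_sup; apply/seteqP; split=> n /=.
  move=> [P hP]; exists (fun i x => x \in P i); split=> i hi; first exact: prime_idealr_prime.
  have [h1 [x x1 x2]] := hP i hi; split=> //; exists x; split=> //; exact/negP.
move=> [P [pP sP]].
have /choice [Q hQ] : forall i, exists Q : prime_idealr A, (i <= n)%N -> forall x, x \in Q <-> P i x.
  move=> i; case: (leqP i n) => h; first by have [Q hQ] := prime_idealr_of (pP i h); exists Q.
  by have [Q _] := prime_idealr_of (pP 0%N (leq0n _)); exists Q.
exists Q => i hi; have [h1 [x [x1 x2]]] := sP i hi.
have hi' := ltnW hi; split=> [y /(hQ _ hi')/h1/(hQ _ hi) //|].
by exists x; [apply/(hQ _ hi) | apply/negP => /(hQ _ hi')].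
Qed.

(** * Frobenius generators and finite extensions *)

(** A property rather than an [idomainType], since the quotients by splitting primes are built as
    quotients by a mere [idealr]. *)
Definition integral_ring (A : comNzRingType) : Prop := forall x y : A, x * y = 0 -> x = 0 \/ y = 0.

Lemma integral_prime0 (A : comNzRingType) : integral_ring A -> is_prime (fun x : A => x = 0).
Proof. by move=> dA; split=> //; [exact: frob0_ideal | exact/eqP/oner_neq0]. Qed.

Section FrobeniusGenerators.
Variables (A : comNzRingType) (p e : nat).
Notation gens L := (gen_by (frob (@idfun A) p e) L).

Lemma gen_by_mono (L L' : A -> Prop) s : (forall x, L x -> L' x) -> gens L s -> gens L' s.
Proof. by move=> LL [v gv]; exists v; apply: gen_mono gv. Qed.

(** Filter by powers of [x]: each layer [x^i A / x^(i+1) A] is a quotient of [A / x], so the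
    [x^i v_j] with [i < h] generate. *)
Lemma gens_power (L : A -> Prop) x s h : is_ideal L ->
  gens (add1 L x) s -> gens (add1 L (x ^+ h)) (h * s).
Proof.
move=> idL [v gv].
apply: (@gen_by_fin _ _ _ _ _ (fun u : 'I_h * 'I_s => x ^+ u.1 * v u.2)); last first.
  by rewrite card_prod !card_ord.
move=> a; suff [c [l [b [Ll ea]]]] : exists (c : nat -> 'I_s -> A) l b, L l /\
    a = \sum_(i < h) \sum_j frob idfun p e (c i j) (x ^+ i * v j) + l + b * x ^+ h.
  exists (fun u : 'I_h * 'I_s => c u.1 u.2), l, b; split=> //.
  rewrite {1}ea -(pair_bigA _ (fun (i : 'I_h) j => frob idfun p e (c i j) (x ^+ i * v j))) /=.
  by set S := \sum_(i < h) _; ring.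
elim: h => [|h [c [l [b [Ll ->]]]]].
  exists (fun _ _ => 0), 0, a; split; first exact: is_ideal0.
  by rewrite big_ord0 expr0 mulr1 !add0r.
have [d [l' [b' [Ll' eb]]]] := gv b.
have {}eb : b = \sum_j frob idfun p e (d j) (v j) + (l' + b' * x) by rewrite -eb addrC subrK.
exists (fun i => if (i < h)%N then c i else d), (l + l' * x ^+ h), b'; split.
  by apply: is_idealD => //; apply: is_idealMr.
rewrite big_ord_recr /= ltnn; under [in RHS]eq_bigr => i _ do rewrite ltn_ord.
rewrite {1}eb; under [\sum_j frob idfun p e (d j) (x ^+ h * v j)]eq_bigr => j _.
  rewrite (_ : frob _ _ _ _ _ = frob idfun p e (d j) (v j) * x ^+ h); last by rewrite /frob; ring.
  over.
rewrite -mulr_suml exprS; ring.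
Qed.

Lemma adds_sub (I : A -> Prop) xs x : I x -> adds I xs x.
Proof. by elim: xs I => //= y xs IH I Ix; apply: IH; apply: add1_sub. Qed.
Lemma adds_mem (I : A -> Prop) xs x : is_ideal I -> x \in xs -> adds I xs x.
Proof.
elim: xs I => //= y xs IH I idI; rewrite inE => /orP[/eqP ->|]; last exact/IH/add1_ideal.
by apply: adds_sub; apply: add1_mem.
Qed.

(** Each [x] in [xs] costs a factor [h], by [gens_power]. It is used with a fixed exponent to
    compare [m] with a system of parameters, and with [h = p ^ e] to reach [L]. *)
Lemma gens_adds (L L' : A -> Prop) xs s h : is_ideal L -> is_ideal L' ->
  (forall x, L x -> L' x) -> (forall x, x \in xs -> L' (x ^+ h)) ->
  gens (adds L xs) s -> gens L' (h ^ size xs * s).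
Proof.
elim: xs L L' => [|x xs IH] L L' idL idL' LL hx /=.
  by rewrite mul1n; apply: gen_by_mono.
move=> /(IH _ (add1 L' x) (add1_ideal x idL) (add1_ideal x idL')) h1.
rewrite expnS -mulnA; apply: (@gen_by_mono (add1 L' (x ^+ h))).
  by apply: add1_min => //; apply: hx; rewrite mem_head.
apply: gens_power => //; apply: h1.
  by move=> _ [y [b [/LL hy ->]]]; exists y, b.
by move=> y hy; apply: add1_sub; apply: hx; rewrite inE hy orbT.
Qed.
End FrobeniusGenerators.

Lemma nat_sup_le (RT : realType) (P : set nat) d n :
  nat_sup RT P = (d%:R)%:E -> P n -> (n <= d)%N.
Proof.
move=> e Pn; rewrite -(ler_nat RT) -lee_fin -e.
by apply: ereal_sup_ubound; exists n.
Qed.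

Lemma nat_sup_cases (RT : realType) (P : set nat) n0 : P n0 ->
  (exists d, nat_sup RT P = (d%:R)%:E) \/
  (nat_sup RT P = +oo%E /\ forall B, exists2 n, P n & (B <= n)%N).
Proof.
move=> Pn0; case: (pselect (exists B, forall n, P n -> (n <= B)%N)) => [[B hB]|h].
  left; have ex : exists n, `[< P n >] by exists n0; apply/asboolP.
  have bnd n : `[< P n >] -> (n <= B)%N by move=> /asboolP/hB.
  case: (ex_maxnP ex bnd) => d /asboolP Pd dmax; exists d.
  by apply: nat_sup_max => // n Pn; apply: dmax; apply/asboolP.
right; have unb B : exists2 n, P n & (B <= n)%N.
  apply: contrapT => hB; apply: h; exists B => n Pn; rewrite leqNgt; apply/negP => lt.
  by apply: hB; exists n => //; apply: ltnW.
split=> //; apply/eqyP => r r0; have [n Pn bn] := unb (Num.bound r).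
apply: (@le_trans _ _ (n%:R)%:E); last by apply: ereal_sup_ubound; exists n.
rewrite lee_fin; apply/ltW/(lt_le_trans (archi_boundP (ltW r0))).
by rewrite ler_nat.
Qed.

(* [A / c] has dimension at most [d - 1], so by a system of parameters [F^e_* (A / (m^[q], c))]
   has [O(N^e q^(d-1))] generators, where [q = p ^ e] and [N] is the [p]-degree. *)
Lemma frob_gens_bound (RT : realType) (A : comNzRingType) (m : idealr A) p N d (c : A) :
  noetherian A -> local_ring m -> integral_ring A -> p \in [pchar A] ->
  has_dim (fun a => a \in m) (frob idfun p 1) (fun a => a \in m) N ->
  krull_dim RT A = (d%:R)%:E -> c <> 0 ->
  exists B, forall e (L : A -> Prop), is_ideal L -> L c ->
    (forall x, x \in m -> L (x ^+ (p ^ e))) ->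
    exists g, gen_by (frob idfun p e) L g /\ (g * p ^ e <= B * (N ^ e * (p ^ e) ^ d))%N.
Proof.
move=> nA mP dA pA hN hd c0; have pm := local_prime mP.
have p0 := prime_gt0 (pcharf_prime pA).
(* If [c] is a unit, [L] is the unit ideal and the empty family generates. *)
case: (boolP (c \in m)) => [cm|/negP/(local_unit mP)[b bc]]; last first.
  exists 0%N => e L idL Lc _; exists 0%N; split=> //.
  exists (fun=> 0) => x; exists (fun=> 0); rewrite big_ord0 subr0.
  by rewrite -[x]mulr1 -bc mulrA; apply: is_idealMl.
have p0A := integral_prime0 dA; have idz := @frob0_ideal A.
pose I := add1 (fun x : A => x = 0) c.
have idI : is_ideal I by apply: add1_ideal.
have Ic : I c by apply: add1_mem.
rewrite krull_dimE in hd; have dmax n (P : nat -> A -> Prop) : pchain n P -> (n <= d)%N.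
  by move=> hP; apply: (nat_sup_le hd); exists P.
(* [d] is positive: [c] is a nonzero element of [m], so [0] and [m] are different primes. *)
have [k dk] : exists k, d = k.+1.
  suff : (1 <= d)%N by case: (d) => // k _; exists k.
  apply: (dmax _ (fun i => if i is j.+1 then (fun x => x \in m) else (fun x => x = 0))).
  apply: (@pchain_cons _ 0%N (fun=> (fun x => x \in m))) => // [x ->|]; first exact: idealr0.
  by exists c.
have dI : dim_over I k.
  move=> n P hP IP; rewrite -ltnS -dk.
  apply: (dmax _ (fun i => if i is j.+1 then P j else (fun x => x = 0))).
  apply: pchain_cons => // [x ->|]; last by exists c; split=> //; apply: IP.
  by case: hP => /(_ 0%N (leq0n _)) [idP _ _] _; apply: is_ideal0.
have [xs [s1 s2 s3]] := system_of_parameters nA mP idI dI.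
have [zs hzs] := nA m.
have /choice [h hP] : forall z, exists h, z \in zs -> adds I xs (z ^+ h).
  move=> z; case: (boolP (z \in zs)) => zz; last by exists 0%N.
  have [|h hh] := s3 z; last by exists h.
  apply/hzs; exists (fun j : nat => (j == index z zs)%:R).
  have iz : (index z zs < size zs)%N by rewrite index_mem.
  rewrite (bigD1 (Ordinal iz)) //= eqxx mul1r nth_index // big1 ?addr0 // => j.
  by move=> /negPf jz; rewrite -(val_eqE j (Ordinal iz)) /= in jz; rewrite jz mul0r.
(* One exponent with [z ^ H] in [I + (xs)] for every generator [z] of [m]; it does not depend on
   [e]. *)
pose H := (\sum_(z <- zs) h z)%N.
have hH z : z \in zs -> adds I xs (z ^+ H).
  move=> zz; rewrite /H (perm_big _ (perm_to_rem zz)) /= big_cons exprD.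
  by apply: is_idealMr; [apply: adds_ideal | apply: hP].
exists (H ^ size zs)%N => e L idL Lc Lm.
(* From [m] to [I + (xs)] the [N ^ e] generators of [F^e_* k] are multiplied by [H ^ size zs]; from
   there to [L] by at most [q ^ (d - 1)] for [q = p ^ e], since [x ^ q] is in [L] for the at most
   [d - 1] elements of [xs]. *)
exists ((p ^ e) ^ size xs * (H ^ size zs * N ^ e))%N; split; last first.
  rewrite mulnAC -expnSr [X in (X <= _)%N]mulnC mulnA.
  by rewrite leq_mul2l dk leq_pexp2l ?orbT ?expn_gt0 ?p0.
apply: (@gens_adds _ _ _ I) => //.
- by apply: add1_min => // x ->; apply: is_ideal0.
- by move=> x /s2 /Lm.
apply: (@gens_adds _ _ _ (fun x => x = 0)) => //; first exact: adds_ideal.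
  by move=> x ->; apply: is_ideal0; apply: adds_ideal.
apply: gen_by_mono (has_dim_gen (residue_frob_dim e pA pm hN)) => x /hzs[a ->].
apply: is_ideal_sum => [|i]; first exact: adds_ideal.
by apply: is_idealMl; [apply: adds_ideal | apply: adds_mem => //; apply: mem_nth].
Qed.

(** * Integrality, incomparability and going up *)

Section FiniteExtension.
Variables (A B : comNzRingType) (th : {rmorphism A -> B}).
Hypothesis finB : module_finite th.

(** The determinant trick: multiplication by [b] on the generators has a matrix [M] over [A], and
    [\det (b - M)] kills all generators, hence [1]. *)
Lemma finite_integral b : exists n (a : nat -> A), b ^+ n + \sum_(i < n) th (a i) * b ^+ i = 0.
Proof.
have [s sP] := finB.
have /choice [X hX] : forall i : 'I_(size s), exists X : nat -> A, b * s`_i = \sum_(j < size s) th (X j) * s`_j.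
  by move=> i; apply: sP.
pose M := \matrix_(i < size s, j < size s) X i j.
pose v := \col_(i < size s) s`_i.
have hv : (b%:M - map_mx th M) *m v = 0.
  apply/matrixP => i j; rewrite mulmxBl mul_scalar_mx !mxE hX.
  by apply/eqP; rewrite subr_eq0; apply/eqP; apply: eq_bigr => k _; rewrite !mxE.
pose D := \det (b%:M - map_mx th M).
have Ds i : D * s`_(i : 'I_(size s)) = 0.
  have : \adj (b%:M - map_mx th M) *m ((b%:M - map_mx th M) *m v) = 0 by rewrite hv mulmx0.
  by rewrite mulmxA mul_adj_mx mul_scalar_mx => /matrixP/(_ i 0); rewrite !mxE.
have D0 : D = 0.
  have [c hc] := sP 1; rewrite -[D]mulr1 hc mulr_sumr big1 // => i _.
  by rewrite mulrCA Ds mulr0.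
have hD : (map_poly th (char_poly M)).[b] = 0.
  rewrite -D0 map_char_poly /char_poly -horner_evalE -det_map_mx; congr (\det _).
  by apply/matrixP => i j; rewrite !mxE /= /horner_eval !hornerE hornerMn hornerX.
have sz : size (map_poly th (char_poly M)) = (size s).+1.
  by rewrite map_char_poly size_char_poly.
exists (size s), (fun i => (char_poly M)`_i).
rewrite -[RHS]hD horner_coef sz big_ord_recr /= addrC; congr (_ + _).
  have lc : (char_poly M)`_(size s) = 1.
    by have /monicP := char_poly_monic M; rewrite lead_coefE size_char_poly.
  by rewrite coef_map /= lc rmorph1 mul1r.
by apply: eq_bigr => i _; rewrite coef_map.
Qed.
Notation contr Q := (fun a => Q (th a)).

Lemma contr_prime (Q : B -> Prop) : is_prime Q -> is_prime (contr Q).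
Proof.
move=> [[Q0 QD QM] Q1 Qp]; split.
- split=> [|x y|a x]; first by rewrite rmorph0.
    by rewrite rmorphD; apply: QD.
  by rewrite rmorphM; apply: QM.
- by rewrite rmorph1.
- by move=> x y; rewrite rmorphM; apply: Qp.
Qed.

(** Take a monic relation of [x] modulo [Q] of least degree. Its constant term lies in [Q'], hence
    in [Q], and cancelling [x] gives a shorter one. *)
Lemma incomparable (Q Q' : B -> Prop) : is_prime Q -> is_prime Q' ->
  (forall x, Q x -> Q' x) -> (forall a, Q' (th a) -> Q (th a)) -> forall x, Q' x -> Q x.
Proof.
move=> [idQ Q1 QM] [idQ' _ _] QQ' h x Q'x; apply: contrapT => Qx.
have ex : exists n, `[< exists a : nat -> A, Q (x ^+ n + \sum_(i < n) th (a i) * x ^+ i) >].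
  by have [n [a e]] := finite_integral x; exists n; apply/asboolP; exists a; rewrite e; apply: is_ideal0.
case: (ex_minnP ex) => -[|n] /asboolP[a ha] nmin.
  by apply: Q1; move: ha; rewrite big_ord0 addr0.
suff /asboolP/nmin : exists a : nat -> A, Q (x ^+ n + \sum_(i < n) th (a i) * x ^+ i) by rewrite ltnn.
exists (fun i => a i.+1).
have e : x ^+ n.+1 + \sum_(i < n.+1) th (a i) * x ^+ i =
    th (a 0%N) + x * (x ^+ n + \sum_(i < n) th (a i.+1) * x ^+ i).
  rewrite big_ord_recl /= mulr1 addrCA mulrDr -exprS mulr_sumr; congr (_ + (_ + _)).
  by apply: eq_bigr => i _; rewrite /bump /= add1n exprS mulrCA.
rewrite e in ha; have Qa : Q (th (a 0%N)).
  apply: h; rewrite -[th _](addrK (x * (x ^+ n + \sum_(i < n) th (a i.+1) * x ^+ i))).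
  by apply: is_idealB => //; [exact: QQ' | apply: is_idealMr].
by have := is_idealB idQ ha Qa; rewrite addrC addKr => /QM[].
Qed.

(** Lying over is the case [Q = 0]. An ideal maximal among those over [Q] that contract into [P] is
    prime; integrality makes its contraction all of [P]. *)
Lemma going_up (P : A -> Prop) (Q : B -> Prop) : noetherian B -> is_prime P -> is_ideal Q ->
  (forall a, Q (th a) -> P a) ->
  exists Q', [/\ is_prime Q', forall x, Q x -> Q' x & forall a, Q' (th a) <-> P a].
Proof.
move=> nB [idP P1 PM] idQ QP.
have [J [idJ [QJ JP] maxJ]] := noeth_max nB
  (F := fun J => (forall x, Q x -> J x) /\ forall a, J (th a) -> P a) idQ (conj (fun x h => h) QP).
have step x : ~ J x -> exists a, add1 J x (th a) /\ ~ P a.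
  move=> Jx; apply: contrapT => /forallNP h; apply: Jx.
  apply: (maxJ (add1 J x)); [exact: add1_ideal | | exact: add1_sub | exact: add1_mem].
  split=> [y /QJ|a ha]; first exact: add1_sub.
  by apply: contrapT => Pa; apply: (h a).
have Pexp a n : P (a ^+ n) -> P a.
  by elim: n => [/P1 //|n IH]; rewrite exprS => /PM[].
exists J; split=> //.
  split=> // [J1|x y xy]; first by apply: P1; apply: JP; rewrite rmorph1.
  apply: contrapT => /not_orP[/step[a [[u [b [hu eu]]] Pa]] /step[a' [[v [c [hv ev]]] Pa']]].
  suff : P (a * a') by case/PM.
  apply: JP; rewrite rmorphM eu ev.
  rewrite (_ : _ * _ = (v + c * y) * u + b * x * v + b * c * (x * y)); last by ring.
  by apply: is_idealD => //; [apply: is_idealD => // |]; apply: is_idealMl.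
move=> x; split=> [|Px]; first exact: JP.
apply: contrapT => /step[a [[u [b [hu eu]]] Pa]]; apply: Pa.
(* Modulo [J], [th a] is [b * th x]. Multiplying the integral equation of [b] by [th x ^ n] gives a
   monic equation for [b * th x] whose lower coefficients are multiples of [x], so [a ^ n] is in
   [P]. *)
have [n [c hc]] := finite_integral b.
apply: (Pexp _ n).
pose F i := c i * (a ^+ i * x ^+ (n - i.+1)).
suff JF : J (th (a ^+ n + x * \sum_(i < n) F i)).
  move: (JP _ JF) => PF; rewrite -[a ^+ n](addrK (x * \sum_(i < n) F i)).
  by apply: is_idealB => //; apply: is_idealMr.
pose G w := w ^+ n + \sum_(i < n) th (c i) * (w ^+ i * th x ^+ (n - i)).
have -> : th (a ^+ n + x * \sum_(i < n) F i) = G (th a).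
  rewrite rmorphD rmorphXn rmorphM rmorph_sum mulr_sumr; congr (_ + _).
  apply: eq_bigr => i _; rewrite !rmorphM !rmorphXn subnS.
  have ni : (n - i = (n - i).-1.+1)%N by rewrite prednK // subn_gt0.
  by rewrite [in RHS]ni exprS; ring.
have G0 : G (b * th x) = 0.
  rewrite -[RHS](mulr0 (th x ^+ n)) -hc mulrDr mulr_sumr /G exprMn [_ * th x ^+ n]mulrC.
  congr (_ + _); apply: eq_bigr => i _; rewrite exprMn -mulrA -exprD.
  by rewrite subnKC 1?ltnW //; ring.
have Jpow i : J (th a ^+ i - (b * th x) ^+ i).
  by rewrite subrXX; apply: is_idealMr => //; rewrite eu addrK.
rewrite -[G (th a)]subr0 -G0 /G opprD addrACA -sumrB; apply: is_idealD => //.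
apply: is_ideal_sum => // i; rewrite -mulrBr -mulrBl.
by apply: is_idealMl => //; apply: is_idealMr.
Qed.

(** Contracted chains stay strict by incomparability, and going up lifts chains. *)
Lemma krull_dim_finite_ext (RT : realType) : injective th -> integral_ring B -> noetherian B ->
  krull_dim RT B = krull_dim RT A.
Proof.
move=> inj dB nB; rewrite !krull_dimE; congr nat_sup; apply/seteqP; split=> n /=.
  move=> [Q [pQ sQ]]; exists (fun i a => Q i (th a)); split=> i hi.
    exact/contr_prime/pQ.
  have [h1 [x [x1 x2]]] := sQ i hi; split=> [a|]; first exact: h1.
  apply: contrapT => h; apply: x2.
  apply: (incomparable (pQ _ (ltnW hi)) (pQ _ hi) h1) => // a Qa.
  by apply: contrapT => Qa'; apply: h; exists a.
move=> [P]; suff : pchain n P -> exists Q, pchain n Q /\ forall i a, (i <= n)%N -> Q i (th a) <-> P i a.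
  by move=> h /h[Q [hQ _]]; exists Q.
elim: n => [|n IH] [pP sP].
  have [|Q [pQ _ QP]] := going_up nB (pP 0%N (leqnn _)) (@frob0_ideal B).
    move=> a /eqP; rewrite raddf_eq0 // => /eqP ->.
    by have [idP _ _] := pP 0%N (leqnn _); apply: is_ideal0.
  by exists (fun=> Q); split=> [|i a]; [split | rewrite leqn0 => /eqP ->].
have [|Q [[pQ sQ] QP]] := IH.
  by split=> i hi; [apply: pP; apply: ltnW | apply: sP; apply: ltnW].
have [idQn _ _] := pQ n (leqnn n).
have [|Q' [pQ' QQ' Q'P]] := going_up nB (pP n.+1 (leqnn _)) idQn.
  by move=> a /(QP n a (leqnn _)).1; apply: (sP n (ltnSn n)).1.
exists (fun i => if (i <= n)%N then Q i else Q'); split=> [|i a]; last first.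
  by case: (leqP i n) => [h _|h1 h2]; [exact: QP | rewrite (_ : i = n.+1) //; apply/eqP; rewrite eqn_leq h2].
split=> i hi; first by case: leqP => // h; apply: pQ.
case: (ltngtP i n) => [h|h|->].
- exact: sQ.
- by rewrite ltnS leqNgt h in hi.
split=> //; have [_ [x [x1 x2]]] := sP n (ltnSn n).
by exists (th x); split; [apply/Q'P | move=> /(QP n x (leqnn n)).1].
Qed.
End FiniteExtension.

(** * Limits and the splitting index *)

Section Limits.
Variable RT : realType.
Local Open Scope classical_set_scope.

Lemma limn_ext (u v : nat -> \bar RT) :
  (forall l : \bar RT, (u @ \oo --> l) <-> (v @ \oo --> l)) -> limn u = limn v.
Proof.
move=> h; rewrite /lim /lim_in; congr (get _); apply/funext => l; apply/propext; exact: h.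
Qed.

(* [limn] of a divergent sequence is the default point [0]; hence neither this lemma nor
   [limn_scale] assumes convergence, and the existence of the F-signature as a limit is
   not needed. *)
Lemma limn_close (x y : nat -> RT) : (fun n => x n - y n) @ \oo --> (0 : RT) ->
  limn (fun n => (x n)%:E) = limn (fun n => (y n)%:E).
Proof.
move=> xy; apply: limn_ext => l.
have aux (u v : nat -> RT) : (fun n => u n - v n) @ \oo --> (0 : RT) ->
    (fun n => (v n)%:E) @ \oo --> l -> (fun n => (u n)%:E) @ \oo --> l.
  move=> uv vl.
  have uv' : (fun n => (u n - v n)%:E) @ \oo --> (0%:E : \bar RT) by apply: cvg_EFin => //; near=> n.
  have fin0 : (0%:E +? l)%E by rewrite fin_num_adde_defr.
  have := cvgeD fin0 uv' vl; rewrite add0e => h.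
  rewrite (_ : (fun n => (u n)%:E) = (fun n => ((u n - v n)%R%:E + (v n)%:E)%E)); first exact: h.
  by apply/funext => n; rewrite -EFinD subrK.
split; apply: aux => //.
rewrite -oppr0 [X in X @ _ --> _](_ : _ = (fun n => - (x n - y n))); first exact: cvgN.
by apply/funext => n; rewrite opprB.
Unshelve. all: by end_near.
Qed.

Lemma limn_scale (c : RT) (u : nat -> \bar RT) : 0 < c ->
  (c%:E * limn u = limn (fun n => c%:E * u n))%E.
Proof.
move=> c0; case: (pselect (cvgn u)) => [cu|ncu].
  by apply/esym/cvg_lim => //; apply: cvgeZl.
have point_lim (v : nat -> \bar RT) : ~ cvgn v -> limn v = 0%E.
  move=> nv; apply: xgetPN => l vl; apply: nv.
  by apply/cvg_ex; exists l.
rewrite (point_lim u ncu) mule0; apply/esym/point_lim => ccu; apply: ncu.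
have h : cvgn (fun n => (c^-1)%:E * (c%:E * u n))%E.
  by move/cvg_ex: ccu => [l hl]; apply/cvg_ex; exists ((c^-1)%:E * l)%E; apply: cvgeZl.
rewrite (_ : u = (fun n => (c^-1)%:E * (c%:E * u n))%E) //.
by apply/funext => n; rewrite muleA -EFinM mulVf ?gt_eqF // mul1e.
Qed.
End Limits.

(** The normalising factor in [F_signature]: for [q = p ^ E] and [delta = d + log_p N] it is the
    integer [q ^ d * N ^ E]. *)
Lemma powR_log (RT : realType) (p N d E : nat) : (1 < p)%N -> (0 < N)%N ->
  (p%:R : RT) `^ (E%:R * (d%:R + ln N%:R / ln p%:R)) = ((p ^ E) ^ d * N ^ E)%:R.
Proof.
move=> p1 N0; have p0 : (0 : RT) < p%:R by rewrite ltr0n ltnW.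
have lp : ln (p%:R : RT) != 0 by rewrite gt_eqF // ln_gt0 // ltr1n.
rewrite mulrDr powRD; last by rewrite (gt_eqF p0) implybT.
rewrite natrM; congr (_ * _).
  by rewrite -natrM powR_mulrn ?ltW // -natrX expnM.
rewrite mulrC powRrM powR_mulrn ?powR_ge0 // natrX; congr (_ ^+ _).
by rewrite /powR (gt_eqF p0) divfK // lnK // posrE ltr0n.
Qed.

(** * Numerical semigroups *)

Section NumericalSemigroup.
Variable E : nat -> Prop.
Hypothesis E_gt0 : forall e, E e -> (0 < e)%N.

Lemma gcd_attained e0 : E e0 -> exists n,
  [/\ (0 < n)%N, forall e, E e -> (n %| e)%N &
      exists2 s : seq nat, (forall x, x \in s -> E x) & n = \big[gcdn/0%N]_(x <- s) x].
Proof.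
move=> Ee0.
pose F n := (0 < n)%N /\ exists2 s : seq nat, (forall x, x \in s -> E x) & n = \big[gcdn/0%N]_(x <- s) x.
have ex : exists n, `[< F n >].
  exists e0; apply/asboolP; split; first exact: E_gt0.
  by exists [:: e0]; [move=> x; rewrite inE => /eqP -> | rewrite big_seq1].
case: (ex_minnP ex) => n /asboolP[n0 [s sE ns]] nmin; exists n; split=> //; last by exists s.
move=> e Ee; suff : (n <= gcdn e n)%N.
  move=> h; rewrite -(_ : gcdn e n = n) ?dvdn_gcdl //; apply/eqP.
  by rewrite eqn_leq h dvdn_leq // dvdn_gcdr.
apply: nmin; apply/asboolP; split; first by rewrite gcdn_gt0 n0 orbT.
exists (e :: s); last by rewrite big_cons ns.
by move=> x; rewrite inE => /orP[/eqP ->|/sE].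
Qed.

Hypothesis ED : forall d e, E d -> E e -> E (d + e)%N.

(** Bezout gives elements [a = b + n] of the semigroup with [0] adjoined. With [b = n * beta] and
    [k = u * beta + v], where [v < beta <= u], one has [n * k = (u - v) * b + v * a]. *)
Lemma semigroup_multiples (s : seq nat) : (forall x, x \in s -> E x) ->
  let n := \big[gcdn/0%N]_(x <- s) x in (0 < n)%N -> (forall e, E e -> (n %| e)%N) ->
  exists K, forall k, (K <= k)%N -> E (n * k)%N.
Proof.
move=> sE n n0 nE; pose E0 e := e = 0%N \/ E e.
have E0D d e : E0 d -> E0 e -> E0 (d + e)%N.
  move=> [->|hd] [->|he]; rewrite ?addn0 ?add0n; [by left|by right|by right|].
  by right; apply: ED.
have E0M k e : E0 e -> E0 (k * e)%N.
  by move=> he; elim: k => [|k IH]; [left | rewrite mulSn; apply: E0D].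
have [a [b [ha [hb ab]]]] : exists a b, E0 a /\ E0 b /\ a = (b + n)%N.
  rewrite /n; elim: (s) sE => [_|x l IH sE].
    by exists 0%N, 0%N; rewrite big_nil; split; [left | split; [left|]].
  have [|a [b [ha [hb ab]]]] := IH; first by move=> y yl; apply: sE; rewrite inE yl orbT.
  have Ex : E x by apply: sE; rewrite mem_head.
  rewrite big_cons; set g := \big[_/_]_(_ <- _) _ in ab *.
  case: (egcdnP g (E_gt0 Ex)) => u v uv _.
  exists (u * x + v * b)%N, (v * a)%N; split; first by apply: E0D; apply: E0M => //; right.
  by split; [exact: E0M | rewrite uv ab; lia].
have [beta bn] : exists beta, b = (n * beta)%N.
  case: hb => [->|/nE/dvdnP[q ->]]; first by exists 0%N; rewrite muln0.
  by exists q; rewrite mulnC.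
have pos k : (0 < k)%N -> E0 (n * k)%N -> E (n * k)%N.
  by move=> k0 [/eqP|//]; rewrite muln_eq0 !gtn_eqF.
exists (beta * beta).+1 => k hk; apply: pos; first exact: leq_trans hk.
case: (posnP beta) => [b0|b0].
  by rewrite mulnC; apply: E0M; move: ha; rewrite ab bn b0 muln0 add0n.
have rb := ltn_pmod k b0.
have qb : (beta <= k %/ beta)%N by rewrite leq_divRL // ltnW.
rewrite (_ : n * k = (k %/ beta - k %% beta) * b + (k %% beta) * a)%N.
  by apply: E0D; apply: E0M.
rewrite {1}(divn_eq k beta) ab bn; nia.
Qed.
End NumericalSemigroup.

Section SplittingIndex.
Variables (RT : realType) (p : nat) (A : comNzRingType) (m : idealr A).
Hypotheses (pA : p \in [pchar A]) (mP : local_ring m) (fA : F_finite p A).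
Variables (C : cartierAlg p A) (phi : cartierAction C).

Lemma splitting_number_exists : exists D : nat -> nat,
  (forall e, has_dim (fun a => a \in m) (frob idfun p e) (split_ideal m phi e) (D e)) /\
  forall e, splitting_number RT m phi e = ((D e)%:R)%:E.
Proof.
have /choice [D hD] := fun e => split_dim_exists pA mP phi e fA.
by exists D; split=> // e; apply: splitting_number_dim.
Qed.

Lemma splitting_number_eq0 e : splitting_number RT m phi e = 0%E <-> split_ideal m phi e 1.
Proof.
have [D [hD ->]] := splitting_number_exists.
have [v [gv iv]] := hD e; split=> [|h].
  move=> [/eqP]; rewrite pnatr_eq0 => D0.
  have [c] := gv 1; rewrite big1 ?subr0 // => -[i hi].
  by exfalso; move: (hi); rewrite (eqP D0) ltn0.
have [//|D0] := posnP (D e); first by move=> ->.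
have [_ m1 _] := local_prime mP; exfalso; apply: m1.
apply: (iv (fun=> 1) _ (Ordinal D0)).
rewrite -[X in split_ideal _ _ _ X]mulr1; apply: (is_idealMl (split_ideal_ideal m phi e)); exact: h.
Qed.

Lemma split_unit e : ~ split_ideal m phi e 1 -> exists k : C e, act phi k 1 = 1.
Proof.
move=> /existsNP[k /(local_unit mP)[b bk]]; exists (cleft b k).
by rewrite act_cleft.
Qed.
Lemma split_unitD d e : ~ split_ideal m phi d 1 -> ~ split_ideal m phi e 1 ->
  ~ split_ideal m phi (d + e) 1.
Proof.
move=> /split_unit[k hk] /split_unit[l hl] /(_ (cmul k l)).
by rewrite act_cmul hl hk idealr1.
Qed.
(** If [k . 1 = 1] in degree [d], then [l . (k . x^(p^d)) = l . x], and the left side is the value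
    at [x] of an element of degree [e + d]. *)
Lemma split_ideal_sub d e x : ~ split_ideal m phi d 1 ->
  split_ideal m phi (e + d) x -> split_ideal m phi e x.
Proof.
move=> /split_unit[k hk] hx l.
have := hx (cmul l (cright (x ^+ (p ^ d).-1) k)).
rewrite act_cmul act_cright -exprSr prednK ?expn_gt0 ?prime_gt0 ?(pcharf_prime pA) //.
by rewrite -[x ^+ _]mulr1 actZ hk mulr1.
Qed.

Definition split_degree e : Prop := (1 <= e)%N /\ ~ split_ideal m phi e 1.

(** The degrees with a split map are closed under addition, so they contain all large multiples of
    their gcd. *)
Lemma splitting_indexE : (exists e, split_degree e) -> exists n,
  [/\ splitting_index RT m phi = n, (0 < n)%N, forall e, split_degree e -> (n %| e)%N &
      exists K, forall k, (K <= k)%N -> split_degree (n * k)%N].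
Proof.
move=> [e0 he0].
have E0 e : split_degree e -> (0 < e)%N by case.
have [n [n0 nE [s sE ns]]] := gcd_attained E0 he0.
exists n; split=> //; last first.
  rewrite ns; apply: semigroup_multiples => //; rewrite -?ns // => d e [d0 hd] [e1 he].
  by split; [rewrite addn_gt0 d0 | exact: split_unitD].
have EE e : (1 <= e)%N /\ splitting_number RT m phi e <> 0%E <-> split_degree e.
  by split=> -[h1 h2]; split=> // /splitting_number_eq0.
have nd d : (forall e, split_degree e -> d %| e)%N -> (d %| n)%N.
  move=> hd; rewrite ns; elim: (s) sE => [|x l IH] sE; first by rewrite big_nil dvdn0.
  rewrite big_cons dvdn_gcd hd ?IH //; first by move=> y yl; apply: sE; rewrite inE yl orbT.
  by apply: sE; rewrite mem_head.
rewrite /splitting_index; case: xgetP => [x _ [x1 x2]|].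
  apply/eqP; rewrite eqn_dvd; apply/andP; split.
    by apply: nd => e /EE; apply: x1.
  by apply: x2 => e /EE; apply: nE.
move=> /(_ n) []; split=> [e /EE|d hd]; first exact: nE.
by apply: nd => e /EE; apply: hd.
Qed.
End SplittingIndex.

(** * Degrees, and growth of the splitting numbers *)

Section Degree.
Variables (k : comNzRingType) (B : comPzRingType) (g : k -> B).
Hypotheses (gD : {morph g : x y / x + y}) (gM : {morph g : x y / x * y}) (g1 : g 1 = 1).

Definition free_basis n (b : 'I_n -> B) : Prop :=
  forall v, exists! c : {ffun 'I_n -> k}, v = \sum_(i < n) g (c i) * b i.

(** The two change-of-basis matrices have product [1], which bounds the sizes over any nonzero
    commutative ring. *)
Lemma free_basis_le n n' (b : 'I_n -> B) (b' : 'I_n' -> B) :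
  free_basis b -> free_basis b' -> (n <= n')%N.
Proof.
move=> hb hb'.
have /choice [P hP] : forall i, exists c : {ffun 'I_n' -> k}, b i = \sum_j g (c j) * b' j.
  by move=> i; have [c [hc _]] := hb' (b i); exists c.
have /choice [Q hQ] : forall j, exists c : {ffun 'I_n -> k}, b' j = \sum_i g (c i) * b i.
  by move=> j; have [c [hc _]] := hb (b' j); exists c.
have g0 := morphD_eq0 gD.
have gS (I : finType) (F : I -> k) : g (\sum_i F i) = \sum_i g (F i) by apply: big_morph.
apply: (@mulmx1_min _ _ _ (\matrix_(i, j) P i j) (\matrix_(j, i) Q j i)).
apply/matrixP => i l; rewrite !mxE; under eq_bigr => j _ do rewrite !mxE.
have [c [hc cu]] := hb (b i).
have e1 : c = [ffun l => \sum_j P i j * Q j l].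
  apply: cu; rewrite {1}hP; under eq_bigr => j _ do rewrite hQ mulr_sumr.
  rewrite exchange_big /=; apply: eq_bigr => a _.
  by rewrite ffunE gS mulr_suml; apply: eq_bigr => j _; rewrite gM mulrA.
have e2 : c = [ffun l => (i == l)%:R].
  apply: cu; rewrite (bigD1 i) //= ffunE eqxx g1 mul1r big1 ?addr0 // => j.
  by rewrite ffunE eq_sym => /negPf ->; rewrite g0 mul0r.
by move: (congr1 (fun h : {ffun _ -> k} => h l) (etrans (esym e1) e2)); rewrite !ffunE.
Qed.

Lemma degree_basis n (b : 'I_n -> B) : free_basis b -> degree g = n.
Proof.
move=> hb; rewrite /degree; case: xgetP => [n' _ [b' hb']|/(_ n)]; last by case; exists b.
by apply/eqP; rewrite eqn_leq (free_basis_le hb' hb) (free_basis_le hb hb').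
Qed.
End Degree.

Lemma p_degree_dim (p : nat) (A : comNzRingType) (m : idealr A) N : p \in [pchar A] ->
  has_dim (fun a => a \in m) (frob idfun p 1) (fun a => a \in m) N -> p_degree p m = N.
Proof.
move=> pA [v [gv iv]].
pose Q : comNzRingType := {ideal_quot m}.
pose pi (a : A) : Q := \pi_({ideal_quot m}) a.
have piD x y : pi (x + y) = pi x + pi y by exact: rmorphD.
have piM x y : pi (x * y) = pi x * pi y by exact: rmorphM.
have piS I (F : 'I_I -> A) : pi (\sum_i F i) = \sum_i pi (F i) by exact: rmorph_sum.
have piX x n : pi (x ^+ n) = pi x ^+ n by exact: rmorphXn.
have pi_eq x y : x - y \in m -> pi x = pi y.
  by move=> h; apply/eqP; rewrite /pi -Quotient.idealrBE.
have Epi x y : pi x = pi y -> x - y \in m.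
  by move=> /eqP; rewrite /pi -Quotient.idealrBE.
have pQ : p \in [pchar Q].
  rewrite inE (pcharf_prime pA) /=; apply/eqP.
  have := congr1 pi (pcharf0 pA).
  rewrite [pi 0](rmorph0 (\pi_({ideal_quot m}))) => <-.
  by rewrite /pi (rmorph_nat (\pi_({ideal_quot m}))).
apply: (@degree_basis _ _ _ _ _ _ _ (fun i => pi (v i))) => [x y|x y||].
- by rewrite -(expn1 p) expr_pcharD.
- by rewrite exprMn.
- by rewrite expr1n.
elim/quotW => x; rewrite -[\pi x]/(pi x).
have [c hc] := gv x; exists [ffun i => pi (c i)]; split.
  rewrite (pi_eq _ _ hc) piS; apply: eq_bigr => i _.
  by rewrite /frob expn1 piM piX ffunE.
move=> c' hc'; apply/ffunP => i; rewrite ffunE.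
pose d i := repr (c' i); have dE i' : pi (d i') = c' i' by rewrite /pi reprK.
rewrite -dE; apply: (pi_eq).
move: i; apply: iv => /=.
rewrite (_ : \sum_i _ = \sum_i frob idfun p 1 (c i) (v i) - \sum_i frob idfun p 1 (d i) (v i)).
  apply: Epi; rewrite -(pi_eq _ _ hc) hc' piS; apply: eq_bigr => i _.
  by rewrite /frob expn1 piM piX dE.
rewrite -sumrB; apply: eq_bigr => i _.
have ks : kspace (fun x : A => x = 0) (frob idfun p 1) (fun x : A => x = 0).
  apply: (@frob_kspace _ _ idfun) => // [|a ->]; first exact: frob0_ideal.
  by rewrite rmorph0 expr0n expn1; case: (p) (pcharf_prime pA).
by rewrite (ksDl ks) (ksNl ks).
Qed.

Section Unbounded.
Variables (p : nat) (A : comNzRingType) (m : idealr A).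
Hypotheses (pA : p \in [pchar A]) (mP : local_ring m) (dA : integral_ring A).
Variables (C : cartierAlg p A) (phi : cartierAction C).
Hypothesis reg : F_regular m phi.

Lemma regular_split x : (forall e, (1 <= e)%N -> split_ideal m phi e x) -> x = 0.
Proof. by move=> h; apply/reg/asboolP => e k e1; apply: h. Qed.

(** Intersections, because the [I_e] need not decrease: [I_e] is the unit ideal in degrees without a
    split map. *)
Definition split_cap j (x : A) : Prop := forall i, (1 <= i <= j)%N -> split_ideal m phi i x.
Lemma split_cap_ideal j : is_ideal (split_cap j).
Proof.
split=> [i _|x y hx hy i ij|a x hx i ij].
- exact: is_ideal0 (split_ideal_ideal m phi i).
- by apply: (is_idealD (split_ideal_ideal m phi i)); [exact: hx | exact: hy].
- by apply: (is_idealMl (split_ideal_ideal m phi i)); exact: hx.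
Qed.
Lemma split_cap_le j j' x : (j <= j')%N -> split_cap j' x -> split_cap j x.
Proof. by move=> jj h i /andP[i1 i2]; apply: h; rewrite i1 (leq_trans i2). Qed.
Lemma split_cap_frob j e a : (j <= e)%N -> a \in m -> split_cap j (a ^+ (p ^ e)).
Proof.
move=> je am i /andP[i1 ij]; have ie := leq_trans ij je.
rewrite -(subnK ie) expnD exprM; apply: split_ideal_frob.
rewrite -(prednK (_ : 0 < p ^ (e - i))%N) ?expn_gt0 ?(prime_gt0 (pcharf_prime pA)) //.
by rewrite exprS mulrC idealMr.
Qed.

(* The intersections of the [I_e] cannot stabilize, as they have intersection [0]
   and contain Frobenius powers of [m]. *)
Lemma split_dim_unbounded c N n K B : c \in m -> c <> 0 ->
  has_dim (fun a => a \in m) (frob idfun p 1) (fun a => a \in m) N -> (0 < n)%N ->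
  (forall e, split_degree m phi e -> n %| e)%N ->
  (forall k, (K <= k)%N -> split_degree m phi (n * k)) ->
  exists K', forall k d, (K' <= k)%N ->
    has_dim (fun a => a \in m) (frob idfun p (n * k)) (split_ideal m phi (n * k)) d ->
    (B * N ^ (n * k) <= d)%N.
Proof.
move=> cm c0 hN n0 nE KE; have pm := local_prime mP; have [idm m1 mM] := pm.
have /choice [nx nxP] : forall j, exists j', exists x, [/\ (j <= j')%N, split_cap j x & ~ split_cap j' x].
  move=> j; apply: contrapT => /forallNP h.
  have stab j' x : split_cap j x -> split_cap j' x.
    move=> hx; case: (leqP j j') => jj; last exact: split_cap_le (ltnW jj) hx.
    by apply: contrapT => hx'; apply: (h j'); exists x.
  have : c ^+ (p ^ j) = 0.
    apply: regular_split => e e1; apply: (stab e); last by rewrite e1 leqnn.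
    exact: split_cap_frob.
  elim: (p ^ j)%N => [/eqP|i IH]; first by rewrite expr0 oner_eq0.
  by rewrite exprS => /dA[].
have /choice [x xP] := nxP.
(* Infinitely many drops: [xs i] is in [split_cap (js i)] but not in [split_cap (js i.+1)]. *)
pose js i := iter i nx 0%N.
have jsS i : (js i <= js i.+1)%N by case: (xP (js i)).
have jsM i i' : (i <= i')%N -> (js i <= js i')%N.
  elim: i' => [|i' IH]; first by rewrite leqn0 => /eqP ->.
  by rewrite leq_eqVlt => /orP[/eqP -> //|/IH h]; apply: leq_trans (jsS i').
pose xs i := x (js i).
have xs1 i : split_cap (js i) (xs i) by case: (xP (js i)).
have xs2 i : ~ split_cap (js i.+1) (xs i) by case: (xP (js i)).
exists (K + js B)%N => k d kK hd; set e := (n * k)%N in hd *.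
have jke : (js B <= e)%N by rewrite /e; nia.
(* [I_e] is contained in each [I_i] with [1 <= i <= js B]: either [I_i] is the unit ideal, or [n]
   divides [i] and [e - i] is a degree with a split map. *)
have sub y : split_ideal m phi e y -> split_cap (js B) y.
  move=> hy i /andP[i1 iB]; case: (pselect (split_ideal m phi i 1)) => hi.
    by rewrite -[y]mulr1; apply: is_idealMl hi; apply: split_ideal_ideal.
  have /dvdnP[i' ei] : (n %| i)%N by apply: nE.
  have [_ h'] : split_degree m phi (n * (k - i'))%N by apply: KE; nia.
  apply: (split_ideal_sub pA mP h'); rewrite (_ : _ + _ = e)%N //.
  by rewrite ei mulnC -mulnDr subnKC //; nia.
(* For a basis [u] of [F^e_* k], the [B * N ^ e] products [u j * xs i] are independent modulo [I_e].
   At the first [i] with a coefficient outside [m], the earlier terms involve Frobenius powers of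
   elements of [m], so all other terms lie in [split_cap (js i.+1)], which would force [xs i] into
   it. *)
have [u [gu iu]] := residue_frob_dim e pA pm hN.
have ks := split_kspace m pA phi e.
suff : (#|{: 'I_B * 'I_(N ^ e)}| <= d)%N by rewrite card_prod !card_ord.
apply: (ind_dim_le ks (w := fun v : 'I_B * 'I_(N ^ e) => u v.2 * xs v.1) pm _ hd).
move=> a ha; pose y i := \sum_j frob idfun p e (a (i, j)) (u j).
have {}ha : split_ideal m phi e (\sum_i y i * xs i).
  move: ha; congr (split_ideal _ _ _ _).
  under [RHS]eq_bigr => i _ do rewrite /y mulr_suml.
  by rewrite pair_bigA; apply: eq_bigr => -[i j] _ /=; rewrite /frob mulrA.
suff main i : (forall i' : 'I_B, (i' < i)%N -> forall j, a (i', j) \in m) ->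
    forall j, (i < B)%N -> forall hi : (i < B)%N, a (Ordinal hi, j) \in m.
  move=> [i j]; have : forall i0 (hi : (i0 < B)%N) j, a (Ordinal hi, j) \in m.
    elim/ltn_ind => i0 IH hi j0; apply: main => // i' lt j1.
    by have := IH i' lt (ltn_ord i') j1; congr (a (_, _) \in m); apply: val_inj.
  by move=> /(_ i (ltn_ord i) j); congr (a (_, _) \in m); apply: val_inj.
move=> low j _ hi; set io := Ordinal hi; move: j.
apply: iu; rewrite -/(y io); apply: contrapT => /(local_unit mP)[b bc].
apply: (xs2 i); rewrite -[xs i]mul1r -bc -mulrA.
have idc := split_cap_ideal (js i.+1).
apply: (is_idealMl idc).
have -> : y io * xs i = \sum_i y i * xs i - \sum_(i' | i' != io) y i' * xs i'.
  by rewrite [X in _ = X - _](bigD1 io) //= addrK.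
apply: (is_idealB idc); first exact: split_cap_le (jsM _ _ hi) (sub _ ha).
apply: (big_ind (split_cap (js i.+1))) => [||i' ii'].
- exact: (is_ideal0 idc).
- by move=> ? ? ? ?; apply: (is_idealD idc).
case: (ltngtP i' i) => h.
- apply: (is_idealMr idc); apply: (is_ideal_sum idc) => j; rewrite /frob.
  by apply: (is_idealMr idc); apply: split_cap_frob; [apply: leq_trans jke; apply: jsM | apply: low].
- by apply: (is_idealMl idc); apply: split_cap_le (xs1 i'); apply: jsM.
- by case/eqP: ii'; apply: val_inj.
Qed.
End Unbounded.

(** * The F-signature under finite extensions of domains *)

Section Signature.
Variables (RT : realType) (p : nat) (A : comNzRingType) (m : idealr A).
Hypotheses (pA : p \in [pchar A]) (mP : local_ring m) (dA : integral_ring A) (fA : F_finite p A).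
Variables (C : cartierAlg p A) (phi : cartierAction C).

Lemma regular_split_degree : F_regular m phi -> exists e, split_degree m phi e.
Proof.
move=> reg; apply: contrapT => h.
have /eqP : (1 : A) = 0; last by rewrite oner_eq0.
apply: (regular_split reg) => e e1; apply: contrapT => h'; apply: h; by exists e.
Qed.

Lemma F_signatureE : (exists e, split_degree m phi e) ->
  F_signature RT m phi = limn (fun e => (splitting_number RT m phi (e * splitting_index RT m phi)%N *
    ((p%:R `^ ((e * splitting_index RT m phi)%N%:R * splitting_delta RT p m))^-1)%:E)%E).
Proof.
move=> [e [e1 he]]; rewrite /F_signature; case: pselect => // h.
by exfalso; apply: he; apply/(splitting_number_eq0 RT pA mP fA); apply: h.
Qed.

Lemma residue_dim_exists : exists N, (0 < N)%N /\
  has_dim (fun a => a \in m) (frob idfun p 1) (fun a => a \in m) N.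
Proof.
have [idm m1 mM] := local_prime mP; have p0 := prime_gt0 (pcharf_prime pA).
have ks : kspace (fun a => a \in m) (frob idfun p 1) (fun a => a \in m).
  apply: (@frob_kspace _ _ idfun) => // a am /=; rewrite expn1 -(prednK p0) exprS.
  exact: (is_idealMr idm).
have [g hg] := F_finite_gen 1 pA fA idm.
have [N hN] := exists_dim ks (local_unit mP) hg; exists N; split=> //.
case: N hN => // -[v [gv _]]; exfalso; apply: m1.
by have [c] := gv 1; rewrite big_ord0 subr0.
Qed.

(* [fine] sends an infinite Krull dimension to [0].  That noetherian local rings have finite
   dimension is not proved here: if it failed, the lengths of the [A / I_e] would still tend
   to infinity, because the [I_e] have intersection [0]. *)
Lemma F_signature_infinite : F_regular m phi -> krull_dim RT A = +oo%E ->
  F_signature RT m phi = +oo%E.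
Proof.
move=> reg koo; have pm := local_prime mP.
have [c cm c0] : exists2 c, c \in m & c <> 0.
  have h0 : [set n | exists P : nat -> A -> Prop, pchain n P]%classic 0%N.
    by exists (fun=> (fun a => a \in m)); split.
  rewrite krull_dimE in koo; case: (nat_sup_cases RT h0) => [[d]|[_ /(_ 1%N)]]; first by rewrite koo.
  move=> [n [P [pP sP]] n1]; have [_ [x [x1 x2]]] := sP 0%N n1; exists x.
    by have [idP P1 _] := pP 1%N n1; apply: ideal_local x1.
  by move=> x0; apply: x2; rewrite x0; have [idP _ _] := pP 0%N (leq0n _); apply: is_ideal0.
have hE := regular_split_degree reg; rewrite (F_signatureE hE).
have [n [-> n0 nE [K KE]]] := splitting_indexE RT pA mP fA hE.
have [D [hD DE]] := splitting_number_exists RT pA mP fA phi.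
have [N [N0 hN]] := residue_dim_exists.
apply: cvg_lim => //.
rewrite (_ : (fun e => _) = (fun e => ((D (e * n)%N)%:R / (N ^ (e * n))%:R)%:E)); last first.
  apply/funext => e; rewrite DE /splitting_delta koo (p_degree_dim pA hN) -EFinM.
  by rewrite (powR_log _ 0 _ (prime_gt1 (pcharf_prime pA)) N0) expn0 mul1n.
apply/cvgeryP/cvgryPge => r.
have [K' hK'] := split_dim_unbounded pA mP dA reg (Num.bound `|r|) cm c0 hN n0 nE KE.
near=> k.
have kK' : (K' <= k)%N by near: k; exact: nbhs_infty_ge.
have := hK' k _ kK' (hD _); rewrite [(n * k)%N]mulnC => h.
rewrite ler_pdivlMr ?ltr0n ?expn_gt0 ?N0 //.
apply: (@le_trans _ _ ((Num.bound `|r|)%:R * (N ^ (k * n))%:R)); last by rewrite -natrM ler_nat.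
rewrite ler_wpM2r // (le_trans (ler_norm r)) //.
exact/ltW/archi_boundP.
Unshelve. all: by end_near.
Qed.
End Signature.

Section Core.
Variables (RT : realType) (p : nat) (A B : comNzRingType) (mA : idealr A) (mB : idealr B).
Hypotheses (pA : p \in [pchar A]) (pB : p \in [pchar B]) (nA : noetherian A) (nB : noetherian B).
Hypotheses (lA : local_ring mA) (lB : local_ring mB) (dA : integral_ring A) (dB : integral_ring B).
Hypotheses (fA : F_finite p A) (fB : F_finite p B).
Variable th : {rmorphism A -> B}.
Hypotheses (th_inj : injective th) (th_fin : module_finite th).
Hypothesis th_loc : forall a, a \in mA -> th a \in mB.
Variable T : B -> A.
Hypotheses (TD : {morph T : x y / x + y}) (TZ : forall a x, T (th a * x) = a * T x).
Hypothesis T1 : exists t, T t = 1.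
Hypothesis T_nondeg : forall x, (forall t, T (t * x) = 0) -> x = 0.
Variables (C : cartierAlg p A) (phi : cartierAction C) (D : cartierAlg p B) (psi : cartierAction D).
Hypotheses (regA : F_regular mA phi) (regB : F_regular mB psi).
Hypothesis rel : forall e x, (1 <= e)%N ->
  split_ideal mB psi e x <-> forall t, split_ideal mA phi e (T (t * x)).
Variables (f r : nat) (b : 'I_r -> B) (c0 : A).
Hypothesis hf : has_dim (fun a => a \in mA) (frob th p 0) (fun x => x \in mB) f.
Hypothesis b_ind : forall a : 'I_r -> A, \sum_i th (a i) * b i = 0 -> forall i, a i = 0.
Hypotheses (c0_neq0 : c0 <> 0)
  (b_gen : forall x, exists a : 'I_r -> A, th c0 * x = \sum_i th (a i) * b i).

Let T_sum (I : finType) (F : I -> B) : T (\sum_i F i) = \sum_i T (F i).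
Proof. exact: (big_morph T TD (morphD_eq0 TD)). Qed.

(* The dual basis for the nondegenerate form [T (x * y)] gives [c] times the largest ideal of
   [B] mapped into [I] by [T] as a part of [\sum_i I b_i]. *)
Lemma rank_denominator : exists c, [/\ c <> 0,
  forall x, exists a : 'I_r -> A, th c * x = \sum_i th (a i) * b i &
  forall (I : A -> Prop) x, is_ideal I -> (forall t, I (T (t * x))) ->
    exists a : 'I_r -> A, (forall i, I (a i)) /\ th c * x = \sum_i th (a i) * b i].
Proof.
have p0 := integral_prime0 dA.
(* [t] is orthogonal to the [b k] with [k != j]: [r] unknowns and [r - 1] equations. Were it
   orthogonal to [b j] as well, nondegeneracy would give [t = 0]. *)
have dual j : exists t c, [/\ c <> 0, forall k, k != j -> T (t * b k) = 0 & T (t * b j) = c].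
  have lt : (#|{: {k : 'I_r | k != j}}| < #|'I_r|)%N.
    by rewrite card_sig (cardC1 j) card_ord prednK // (leq_ltn_trans (leq0n j)).
  have [x [[i xi] hx]] := hom_sys (fun i (k : {k : 'I_r | k != j}) => T (b i * b (val k))) p0 lt.
  pose t := \sum_i th (x i) * b i.
  have Tt y : T (t * y) = \sum_i x i * T (b i * y).
    by rewrite /t mulr_suml T_sum; apply: eq_bigr => l _; rewrite -mulrA TZ.
  have tk k : k != j -> T (t * b k) = 0 by move=> kj; rewrite Tt; apply: (hx (exist _ k kj)).
  exists t, (T (t * b j)); split=> // tj; apply: xi; apply: b_ind i.
  apply: T_nondeg => y; rewrite -/t mulrC; have [a ha] := b_gen y.
  have : c0 * T (t * y) = 0.
    rewrite -TZ mulrCA ha mulr_sumr T_sum big1 // => k _; rewrite mulrCA TZ.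
    by case: (eqVneq k j) => [->|/tk ->]; rewrite ?tj mulr0.
  by move/dA => [].
have /choice [t /choice [c hc]] := dual.
have prod_neq0 (s : seq 'I_r) : \prod_(j <- s) c j <> 0.
  elim: s => [|j s IH]; first by rewrite big_nil => /eqP; rewrite oner_eq0.
  by rewrite big_cons => /dA[]//; have [] := hc j.
pose P := \prod_j c j.
exists (c0 * P); split=> [/dA[] // | x | I x idI hx].
- exact: prod_neq0.
- have [a ha] := b_gen x; exists (fun i => P * a i).
  rewrite rmorphM [th c0 * _]mulrC -mulrA ha mulr_sumr.
  by apply: eq_bigr => i _; rewrite rmorphM mulrA.
- have [a ha] := b_gen x; exists (fun i => P * a i); split=> [j|]; last first.
    rewrite rmorphM [th c0 * _]mulrC -mulrA ha mulr_sumr.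
    by apply: eq_bigr => i _; rewrite rmorphM mulrA.
  suff : I (a j * c j).
    by rewrite /P (bigD1 j) //= mulrAC [c j * _]mulrC => /(is_idealMr idI); apply.
  have [_ tk tj] := hc j.
  have -> : a j * c j = c0 * T (t j * x).
    rewrite -TZ mulrCA ha mulr_sumr T_sum (bigD1 j) //= mulrCA TZ tj big1 ?addr0 // => k kj.
    by rewrite mulrCA TZ tk ?mulr0.
  exact: (is_idealMl idI).
Qed.

Lemma ffun_kspace (V : zmodType) (M : A -> Prop) (s0 : A -> V -> V) (N : V -> Prop) :
  kspace M s0 N ->
  kspace M (fun a (v : {ffun 'I_r -> V}) => [ffun i => s0 a (v i)]) (fun v => forall i, N (v i)).
Proof.
move=> ks; split.
- by move=> v a a'; apply/ffunP => i; rewrite !ffunE (ksDl ks).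
- by move=> a u v; apply/ffunP => i; rewrite !ffunE (ksDr ks).
- by move=> a a' v; apply/ffunP => i; rewrite !ffunE (ksM ks).
- by move=> v; apply/ffunP => i; rewrite !ffunE (ks1 ks).
- by move=> i; rewrite ffunE; apply: (ksN0 ks).
- by move=> u v hu hv i; rewrite !ffunE; apply: (ksNB ks).
- by move=> a v hv i; rewrite ffunE; apply: (ksNs ks).
- by move=> a v Ma i; rewrite ffunE; apply: (ksNk ks).
Qed.

Lemma ffun_dim (I : A -> Prop) : is_ideal I ->
  has_dim I (fun a (v : {ffun 'I_r -> A}) => [ffun i => a * v i]) (fun v => forall i, I (v i)) r.
Proof.
move=> idI; exists (fun j => [ffun i => (i == j)%:R]).
have E (c : 'I_r -> A) i : (\sum_j [ffun k => c j * ([ffun i => (i == j)%:R] : {ffun 'I_r -> A}) k]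
    : {ffun 'I_r -> A}) i = c i.
  rewrite sum_ffunE (bigD1 i) //= !ffunE eqxx mulr1 big1 ?addr0 // => j.
  by rewrite !ffunE eq_sym => /negPf ->; rewrite mulr0.
split=> [v|c hc i]; last by have := hc i; rewrite E.
by exists v => i; rewrite !ffunE E subrr; apply: is_ideal0.
Qed.

Let split_scaled e x : (1 <= e)%N -> forall a, split_ideal mA phi e a -> split_ideal mB psi e (th a * x).
Proof.
move=> e1 a ha; apply/rel => // t; rewrite mulrCA TZ.
exact: (is_idealMr (split_ideal_ideal mA phi e)).
Qed.

(** The tower law for the residue extension; this is where the residue degree enters the formula. *)
Lemma split_dim_ext e d : has_dim (fun a => a \in mB) (frob idfun p e) (split_ideal mB psi e) d ->
  has_dim (fun a => a \in mA) (frob th p e) (split_ideal mB psi e) (d * f).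
Proof.
apply: has_dim_tower hf; first exact: split_kspace.
by move=> a x y; exact: (frob_comp th idfun).
Qed.

Lemma split_kspace_ext e : kspace (fun a => a \in mA) (frob th p e) (split_ideal mB psi e).
Proof.
apply: frob_kspace => // [|a /th_loc]; first exact: split_ideal_ideal.
exact: split_ideal_frob.
Qed.

(** Multiplication by [c] maps [B] into [\sum A b_i] and [I_e(B)] into [\sum I_e(A) b_i]. The
    defects are generated over [A / (I_e(A), c)] by the [mu] generators of [B] in one direction and
    by the [r] coordinates in the other. *)
Lemma split_dim_compare : exists c mu, c <> 0 /\ forall e g d d', (1 <= e)%N ->
  has_dim (fun a => a \in mA) (frob idfun p e) (split_ideal mA phi e) d ->
  has_dim (fun a => a \in mB) (frob idfun p e) (split_ideal mB psi e) d' ->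
  gen_by (frob idfun p e) (add1 (split_ideal mA phi e) c) g ->
  (d' * f <= r * d + mu * g)%N /\ (r * d <= d' * f + r * g)%N.
Proof.
have [c [c_neq0 c_gen c_ideal]] := rank_denominator.
have [s sP] := th_fin; exists c, (size s); split=> // e g d d' e1 hd hd' [w gw].
have pm := local_prime lA.
have idA := split_ideal_ideal mA phi e; have idB := split_ideal_ideal mB psi e.
have hd2 := split_dim_ext hd'.
split.
  apply: (has_dim_le (split_kspace_ext e) pm hd2).
  have [y [gy _]] := hd.
  (* The [y l * b i] account for the multiples of [c], which lie in [\sum A b_i]; the [w l * s_j]
     account for [B] modulo [c]. *)
  pose F (u : 'I_r * 'I_d + 'I_(size s) * 'I_g) : B :=
    match u with inl v => th (y v.2) * b v.1 | inr v => th (w v.2) * s`_(v.1) end.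
  apply: (@gen_by_fin _ _ _ _ _ F); last by rewrite card_sum !card_prod !card_ord.
  move=> x; have [a ->] := sP x.
  have /choice [k /choice [i' /choice [h hk]]] : forall j : 'I_(size s), exists k i' h,
      split_ideal mA phi e i' /\ a j = \sum_l frob idfun p e (k l) (w l) + (i' + h * c).
    move=> j; have [k [i' [h [hi ea]]]] := gw (a j); exists k, i', h; split=> //.
    by rewrite -ea addrC subrK.
  have [a' ha'] := c_gen (\sum_j th (h j) * s`_(val j)).
  have /choice [k' hk'] : forall l, exists k', split_ideal mA phi e (a' l - \sum_i frob idfun p e (k' i) (y i)).
    by move=> l; apply: gy.
  exists (fun u => match u with inl v => k' v.1 v.2 | inr v => k v.1 v.2 end).
  rewrite big_sumType /= -(pair_bigA _ (fun j i => frob th p e (k' j i) (th (y i) * b j))) /=.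
  rewrite -(pair_bigA _ (fun j i => frob th p e (k j i) (th (w i) * s`_(val j)))) /=.
  have E1 n (z : 'I_n -> A) (q : 'I_n -> A) (x' : B) :
      \sum_i frob th p e (q i) (th (z i) * x') = th (\sum_i frob idfun p e (q i) (z i)) * x'.
    rewrite rmorph_sum mulr_suml; apply: eq_bigr => i _.
    by rewrite /frob rmorphM rmorphXn mulrA.
  under eq_bigr => j _ do rewrite (hk j).2 !rmorphD !mulrDl -E1.
  under [X in _ - (X + _)]eq_bigr => j _ do rewrite E1.
  have E3 : \sum_j th (h j * c) * s`_(val j) = \sum_l th (a' l) * b l.
    by rewrite -ha' mulr_sumr; apply: eq_bigr => j _; rewrite rmorphM; ring.
  rewrite !big_split /= E3 (_ : _ - _ = \sum_j th (i' j) * s`_(val j) +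
      \sum_l th (a' l - \sum_i frob idfun p e (k' l i) (y i)) * b l); last first.
    under [X in _ = _ + X]eq_bigr => l _ do rewrite rmorphB mulrBl.
    by rewrite sumrB; ring.
  by apply: (is_idealD idB); apply: (is_ideal_sum idB) => j; apply: split_scaled => //; have [] := hk j.
have ksI : kspace (split_ideal mA phi e) (fun a x : A => a * x) (split_ideal mA phi e).
  split=> [v a a'|a u v|a a' v|v||u v|a v|a v].
  - exact: mulrDl.
  - exact: mulrDr.
  - by rewrite mulrA.
  - exact: mul1r.
  - exact: (is_ideal0 idA).
  - exact: (is_idealB idA).
  - exact: (is_idealMl idA).
  - exact: (is_idealMr idA).
have hr := ffun_dim idA.
pose sF a (v : {ffun 'I_r -> A}) := [ffun i => frob idfun p e a (v i)].
have hrd : has_dim (fun a => a \in mA) sF (fun v => forall i, split_ideal mA phi e (v i)) (r * d).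
  apply: has_dim_tower hd hr; first exact: (ffun_kspace ksI).
  by move=> a x v; apply/ffunP => i; rewrite !ffunE /frob mulrA.
apply: (has_dim_le (ffun_kspace (split_kspace mA pA phi e)) pm hrd).
have [z [gz _]] := hd2.
have /choice [W hW] : forall l, exists W, th c * z l = \sum_i th (W i) * b i by move=> l; apply: c_gen.
(* [W l] holds the coordinates of [c z_l]. These account for [c h] with [h] in [A^r]: [\sum h_i b_i]
   is a combination of the [z_l] up to some [y] in [I_e(B)], and [c y] has coordinates in
   [I_e(A)]. *)
pose F (u : 'I_(d' * f) + 'I_r * 'I_g) : {ffun 'I_r -> A} :=
  match u with inl l => [ffun i => W l i] | inr v => [ffun i => (i == v.1)%:R * w v.2] end.
apply: (@gen_by_fin _ _ _ _ _ F); last by rewrite card_sum !card_prod !card_ord.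
move=> v.
have /choice [k /choice [i' /choice [h hk]]] : forall j : 'I_r, exists k i' h,
    split_ideal mA phi e i' /\ v j = \sum_l frob idfun p e (k l) (w l) + (i' + h * c).
  move=> j; have [k [i' [h [hi ea]]]] := gw (v j); exists k, i', h; split=> //.
  by rewrite -ea addrC subrK.
have [q hq] := gz (\sum_i th (h i) * b i); set y := _ - _ in hq.
have [a [aI ha]] := c_ideal _ y idA ((rel y e1).1 hq).
exists (fun u => match u with inl l => q l | inr u => k u.1 u.2 end) => i.
have ce : h i * c = \sum_l frob idfun p e (q l) (W l i) + a i.
  apply/eqP; rewrite -subr_eq0; apply/eqP; move: i.
  apply: (@b_ind (fun i => h i * c - (\sum_l frob idfun p e (q l) (W l i) + a i))).
  under eq_bigr => i _ do rewrite rmorphB rmorphD mulrBl mulrDl rmorph_sum mulr_suml.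
  rewrite sumrB big_split /= -ha exchange_big /=.
  have -> : \sum_j \sum_i th (frob idfun p e (q j) (W j i)) * b i = \sum_j th c * frob th p e (q j) (z j).
    apply: eq_bigr => j _; rewrite /frob mulrCA hW mulr_sumr; apply: eq_bigr => i _.
    by rewrite rmorphM rmorphXn mulrA.
  rewrite -mulr_sumr -mulrDr (_ : _ + y = \sum_i th (h i) * b i); last by rewrite /y addrC subrK.
  rewrite mulr_sumr -sumrB big1 // => i _.
  by rewrite rmorphM; ring.
rewrite big_sumType /= ffunE [X in _ + X]ffunE ffunE !sum_ffunE.
under [X in _ - (X + _)]eq_bigr => l _ do rewrite /sF !ffunE.
under [X in _ - (_ + X)]eq_bigr => l _ do rewrite /sF !ffunE.
rewrite -(pair_bigA _ (fun j l => frob idfun p e (k j l) ((i == j)%:R * w l))) /=.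
rewrite [X in _ - (_ + X)](bigD1 i) //= [X in _ - (_ + (_ + X))]big1 => [|j]; last first.
  by rewrite eq_sym => /negPf ->; apply: big1 => l _; rewrite /frob mul0r mulr0.
rewrite eqxx addr0; under [X in _ - (_ + X)]eq_bigr => l _ do rewrite mul1r.
rewrite (hk i).2 ce (_ : _ - _ = i' i + a i); last by ring.
by apply: (is_idealD idA) => //; have [] := hk i.
Qed.

Let split_ideal1 e : (1 <= e)%N -> split_ideal mB psi e 1 <-> split_ideal mA phi e 1.
Proof.
move=> e1; have idA := split_ideal_ideal mA phi e.
split=> [/(rel _ e1) h|h]; first by have [t <-] := T1; rewrite -[t]mulr1; apply: h.
by apply/rel => // t; rewrite -[T _]mulr1; apply: (is_idealMl idA).
Qed.

Let index_eq : splitting_index RT mB psi = splitting_index RT mA phi.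
Proof.
rewrite /splitting_index (_ : [set e | (1 <= e)%N /\ splitting_number RT mB psi e <> 0%E]%classic =
  [set e | (1 <= e)%N /\ splitting_number RT mA phi e <> 0%E]%classic) //.
apply/seteqP; split=> e /= [e1 h]; split=> // h'; apply: h.
  by apply/(splitting_number_eq0 RT pB lB fB)/split_ideal1/(splitting_number_eq0 RT pA lA fA).
by apply/(splitting_number_eq0 RT pA lA fA)/split_ideal1/(splitting_number_eq0 RT pB lB fB).
Qed.

Let f_gt0 : (0 < f)%N.
Proof.
have [_ m1 _] := local_prime lB.
case: (f) hf => // -[v [gv _]]; exfalso; apply: m1.
by have [c] := gv 1; rewrite big_ord0 subr0.
Qed.

Let r_gt0 : (0 < r)%N.
Proof.
case: (r) b b_gen => // b' /(_ 1) [a]; rewrite big_ord0 mulr1 => h.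
by exfalso; apply: c0_neq0; apply: th_inj; rewrite h rmorph0.
Qed.

(** Both [N' * f] and [f * N] are the dimension of [F_* kappa(mB)] over [kappa(mA)]. *)
Lemma residue_dim_ext N N' :
  has_dim (fun a => a \in mA) (frob idfun p 1) (fun a => a \in mA) N ->
  has_dim (fun a => a \in mB) (frob idfun p 1) (fun a => a \in mB) N' -> N' = N.
Proof.
move=> hN hN'; have p0 := prime_gt0 (pcharf_prime pA); have pm := local_prime lA.
have [idB _ _] := local_prime lB.
have hp (x : B) : x \in mB -> x ^+ (p ^ 1) \in mB.
  by move=> xB; rewrite expn1 -(prednK p0) exprS; apply: (is_idealMr idB).
have ks1 : kspace (fun a => a \in mB) (frob idfun p 1) (fun a => a \in mB).
  exact: (@frob_kspace _ _ idfun).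
have ks2 : kspace (fun a => a \in mA) (frob th p 0) (fun a => a \in mB).
  by apply: frob_kspace => // a; apply: th_loc.
have ks : kspace (fun a => a \in mA) (frob th p 1) (fun a => a \in mB).
  by apply: frob_kspace => // a /th_loc/hp.
have h1 : has_dim (fun a => a \in mA) (frob th p 1) (fun a => a \in mB) (N' * f).
  by apply: (has_dim_tower ks1 _ hf hN') => a x y; exact: (frob_comp th idfun).
have h2 : has_dim (fun a => a \in mA) (frob th p 1) (fun a => a \in mB) (f * N).
  by apply: (has_dim_tower ks2 _ hN hf) => a x y; exact: (frob_comp idfun th).
apply/eqP; rewrite -(eqn_pmul2l f_gt0); apply/eqP.
by rewrite mulnC; apply: (has_dim_uniq ks pm).
Qed.

Theorem F_signature_finite_ext :
  ((f%:R)%:E * F_signature RT mB psi = (r%:R)%:E * F_signature RT mA phi)%E.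
Proof.
have hE := regular_split_degree regA.
have hE' : exists e, split_degree mB psi e.
  by have [e [e1 he]] := hE; exists e; split=> // /(split_ideal1 e1).
have kd : krull_dim RT B = krull_dim RT A by apply: (krull_dim_finite_ext th_fin).
have h0 : [set n | exists P : nat -> A -> Prop, pchain n P]%classic 0%N.
  by exists (fun=> (fun a => a \in mA)); split=> // i _; apply: local_prime.
have := nat_sup_cases RT h0; rewrite -krull_dimE => -[[d kA]|[kA _]]; last first.
  rewrite (F_signature_infinite pA lA dA fA regA kA).
  rewrite (F_signature_infinite pB lB dB fB regB) ?kd //.
  by rewrite !gt0_muley ?lte_fin ?ltr0n.
rewrite (F_signatureE RT pA lA fA hE) (F_signatureE RT pB lB fB hE') index_eq.
have [n [-> n0 _ _]] := splitting_indexE RT pA lA fA hE.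
have [N [N0 hN]] := residue_dim_exists pA lA fA.
have [N' [_ hN']] := residue_dim_exists pB lB fB.
rewrite /splitting_delta kd kA (p_degree_dim pA hN) (p_degree_dim pB hN').
rewrite (residue_dim_ext hN hN') /=.
have [u [hu uE]] := splitting_number_exists RT pA lA fA phi.
have [v [hv vE]] := splitting_number_exists RT pB lB fB psi.
have [c [mu [c_neq0 hc]]] := split_dim_compare.
have [K hK] := frob_gens_bound nA lA dA pA hN kA c_neq0.
rewrite !limn_scale ?ltr0n //.
have p1 := prime_gt1 (pcharf_prime pA).
pose P k : RT := ((p ^ (k * n)) ^ d * N ^ (k * n))%:R.
have PE k : (p%:R : RT) `^ ((k * n)%N%:R * (d%:R + ln N%:R / ln p%:R)) = P k by apply: powR_log.
rewrite (_ : (fun k => _) = (fun k => (f%:R * ((v (k * n)%N)%:R * (P k)^-1))%:E)); last first.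
  by apply/funext => k; rewrite vE PE -!EFinM.
rewrite [in RHS](_ : (fun k => _) = (fun k => (r%:R * ((u (k * n)%N)%:R * (P k)^-1))%:E)); last first.
  by apply/funext => k; rewrite uE PE -!EFinM.
(* With [q = p ^ E], the difference is at most [(mu + r) * g / P k], and [g * q <= K * P k] bounds
   this by [M / q]; finally [q >= k]. *)
apply: limn_close. apply/cvgr0Pnorm_le => eps eps0.
pose M : RT := ((mu + r) * K)%:R.
near=> k.
have k0 : (0 < k)%N by near: k; exact: nbhs_infty_gt.
have Mk : M <= eps * k%:R.
  rewrite -ler_pdivrMl //; apply: (@le_trans _ _ (Num.bound (eps^-1 * M))%:R).
    by apply/ltW/archi_boundP; rewrite mulr_ge0 // invr_ge0 ltW.
  by rewrite ler_nat; near: k; exact: nbhs_infty_ge.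
set E := (k * n)%N; have E1 : (1 <= E)%N by rewrite muln_gt0 k0.
have [|||g [hg gE]] := hK E (add1 (split_ideal mA phi E) c).
- exact/add1_ideal/split_ideal_ideal.
- exact/add1_mem/split_ideal_ideal.
- by move=> x xm; apply/add1_sub/split_ideal_frob.
have [U L] := hc E g _ _ E1 (hu E) (hv E) hg.
have P0 : 0 < P k by rewrite ltr0n muln_gt0 !expn_gt0 N0 ltnW.
rewrite !mulrA -mulrBl normrM (gtr0_norm (_ : 0 < (P k)^-1)) ?invr_gt0 // ler_pdivrMr //.
have b1 : `|f%:R * (v E)%:R - r%:R * (u E)%:R : RT| <= ((mu + r) * g)%:R.
  have U' : f%:R * (v E)%:R <= r%:R * (u E)%:R + mu%:R * g%:R :> RT.
    by rewrite -!natrM -natrD ler_nat mulnC.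
  have L' : r%:R * (u E)%:R <= f%:R * (v E)%:R + r%:R * g%:R :> RT.
    by rewrite -!natrM -natrD ler_nat [(f * _)%N]mulnC.
  have r0 : 0 <= r%:R * g%:R :> RT by rewrite mulr_ge0.
  have mu0 : 0 <= mu%:R * g%:R :> RT by rewrite mulr_ge0.
  by rewrite ler_norml natrM natrD mulrDl; apply/andP; split; lra.
apply: le_trans b1 _.
have pE0 : (0 : RT) < (p ^ E)%:R by rewrite ltr0n expn_gt0 ltnW.
rewrite -(ler_pM2r pE0); apply: (@le_trans _ _ (M * P k)).
  by rewrite /M /P -!natrM ler_nat -mulnA -[X in (_ <= X)%N]mulnA leq_mul2l [(_ ^ d * _)%N]mulnC gE orbT.
rewrite mulrAC; apply: ler_wpM2r; first exact: ltW.
apply: le_trans Mk _.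
apply: ler_wpM2l; first exact: ltW.
rewrite ler_nat.
apply: leq_trans (ltnW (ltn_expl _ p1)); by rewrite leq_pmulr.
Unshelve. all: by end_near.
Qed.
End Core.

(** * Residue degrees *)

Section Rank.
Variables (A B : comNzRingType) (th : {rmorphism A -> B}).
Variables (P : A -> Prop) (Q : B -> Prop).

(* The images of the [b i] form a basis of [Frac (B / Q)] over [Frac (A / P)], and
   [c] is a common denominator of [B / Q] with respect to it. *)
Definition rank_basis r (b : 'I_r -> B) (c : A) : Prop :=
  [/\ forall a : 'I_r -> A, Q (\sum_i th (a i) * b i) -> forall i, P (a i), ~ P c &
      forall x, exists a : 'I_r -> A, Q (th c * x - \sum_i th (a i) * b i)].

Hypotheses (pP : is_prime P) (idQ : is_ideal Q) (QP : forall a, Q (th a) <-> P a).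

Lemma ext_kspace : kspace P (fun a x => th a * x) Q.
Proof.
split=> [v a a'|a u v|a a' v|v||u v|a v|a v /QP].
- by rewrite rmorphD mulrDl.
- exact: mulrDr.
- by rewrite rmorphM mulrA.
- by rewrite rmorph1 mul1r.
- exact: is_ideal0.
- exact: is_idealB.
- exact: is_idealMl.
- exact: is_idealMr.
Qed.

(** A maximal independent family exists since [steinitz] bounds its size by the number of
    generators. Maximality gives every element a denominator, and the product over the generators is
    a common one. *)
Lemma rank_basis_exists : module_finite th -> exists r (b : 'I_r -> B) c, rank_basis b c.
Proof.
move=> [s sP]; have [idP P1 PM] := pP; have ks := ext_kspace.
pose act (a : A) (x : B) := th a * x.
have gs : gen_by act Q (size s).
  exists (fun i => s`_i) => x; have [c hc] := sP x; exists (fun i => c (val i)).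
  by rewrite {1}hc subrr; apply: is_ideal0.
pose F r := exists w : 'I_r -> B, ind P act Q w.
have ex : exists r, `[< F r >].
  by exists 0%N; apply/asboolP; exists (fun=> 0) => c _ [].
have bnd r : `[< F r >] -> (r <= size s)%N.
  by move=> /asboolP[w iw]; apply: (dim_le ks pP iw gs).
case: (ex_maxnP ex bnd) => {ex bnd} r /asboolP[w iw] rmax.
have den x : exists c, ~ P c /\ exists a : 'I_r -> A, Q (th c * x - \sum_i th (a i) * w i).
  apply: contrapT => nx.
  pose w' (i : 'I_r.+1) := if unlift ord0 i is Some k then w k else x.
  suff /asboolP/rmax : F r.+1 by rewrite ltnn.
  exists w' => c; rewrite big_ord_recl {1}/w' unlift_none.
  under eq_bigr => i _ do rewrite /w' liftK.
  move=> h; have c0 : P (c ord0).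
    apply: contrapT => c0; apply: nx; exists (c ord0); split=> //.
    exists (fun i => - c (lift ord0 i)); rewrite -sumrN.
    by under eq_bigr => i _ do rewrite rmorphN mulNr opprK.
  have hw : Q (\sum_(i < r) act (c (lift ord0 i)) (w i)).
    by have := is_idealB idQ h (ksNk ks x c0); rewrite addrAC subrr add0r.
  move=> i; case: (unliftP ord0 i) => [k ->|-> //].
  exact: (iw (fun k => c (lift ord0 k))).
have /choice [c hc] := den.
have prodP (l : seq B) : ~ P (\prod_(x <- l) c x).
  elim: l => [|x l IH]; first by rewrite big_nil.
  by rewrite big_cons => /PM[]//; have [] := hc x.
exists r, w, (\prod_(i < size s) c s`_i); split=> //.
  have := prodP [seq s`_(val i) | i <- index_enum 'I_(size s)].
  by rewrite big_map.
move=> x; have [d ->] := sP x.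
have /choice [a ha] : forall i : 'I_(size s), exists a : 'I_r -> A,
    Q (th (\prod_(i < size s) c s`_i) * s`_i - \sum_j th (a j) * w j).
  move=> i; have [_ [a ha]] := hc s`_i.
  exists (fun j => \prod_(i' < size s | i' != i) c s`_i' * a j).
  rewrite (bigD1 i) //= [c _ * _]mulrC rmorphM -mulrA.
  under [X in _ - X]eq_bigr => j _ do rewrite rmorphM -mulrA.
  by rewrite -mulr_sumr -mulrBr; apply: is_idealMl.
exists (fun j => \sum_(i < size s) d i * a i j).
have -> : \sum_j th (\sum_(i < size s) d i * a i j) * w j =
    \sum_(i < size s) th (d i) * \sum_j th (a i j) * w j.
  under eq_bigr => j _ do rewrite rmorph_sum mulr_suml.
  rewrite exchange_big /=; apply: eq_bigr => i _; rewrite mulr_sumr.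
  by apply: eq_bigr => j _; rewrite rmorphM mulrA.
rewrite mulr_sumr -sumrB; apply: is_ideal_sum => // i.
by rewrite mulrCA -mulrBr; apply: is_idealMl.
Qed.
End Rank.

Lemma fraction_numden (D : idomainType) (z : {fraction D}) :
  exists n d : D, d != 0 /\ z * tofrac d = tofrac n.
Proof.
elim/quotW: z => x; exists x.1, x.2; split; first exact: denom_ratioP.
rewrite /tofrac; unlock FracField.tofrac; rewrite -[LHS]FracField.pi_mul.
apply/eqmodP; rewrite /= FracField.equivfE /FracField.mulf !numden_Ratio ?mulf_neq0 ?oner_neq0 ?denom_ratioP //.
by rewrite mulr1 mulrC mulr1.
Qed.

Section Residue.
Variables (A : comNzRingType) (x : prime_idealr A).
Lemma residueD : {morph residue x : a b / a + b}.
Proof. by move=> a b; rewrite /residue rmorphD; exact: tofracD. Qed.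
Lemma residueM : {morph residue x : a b / a * b}.
Proof. by move=> a b; rewrite /residue rmorphM; exact: tofracM. Qed.
Lemma residue1 : residue x 1 = 1.
Proof. by rewrite /residue rmorph1; exact: tofrac1. Qed.
Lemma residue0 : residue x 0 = 0. Proof. exact: morphD_eq0 residueD. Qed.
Lemma residue_eq0 a : residue x a = 0 <-> a \in x.
Proof.
rewrite /residue; split=> [/eqP|h].
  rewrite tofrac_eq0 => /eqP e.
  have /eqP : \pi_(rdom x) a = \pi_(rdom x) 0 by rewrite [LHS]e; apply/esym/(rmorph0 (\pi_(rdom x))).
  by rewrite -Quotient.idealrBE subr0.
apply/eqP; rewrite tofrac_eq0; apply/eqP.
transitivity (\pi_(rdom x) 0 : rdom x); last exact: (rmorph0 (\pi_(rdom x))).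
by apply/eqP; rewrite -Quotient.idealrBE subr0.
Qed.
Lemma residueB a b : residue x (a - b) = residue x a - residue x b.
Proof. by rewrite /residue rmorphB; exact: tofracB. Qed.
Lemma residue_sum (I : finType) (F : I -> A) : residue x (\sum_i F i) = \sum_i residue x (F i).
Proof. exact: (big_morph (residue x) residueD residue0). Qed.
Lemma residue_numden z : exists a t, t \notin x /\ z * residue x t = residue x a.
Proof.
have [n [d [d0 e]]] := fraction_numden z.
exists (repr n), (repr d); rewrite /residue !reprK; split=> //.
apply/negP => /residue_eq0; rewrite /residue reprK => /eqP.
by rewrite tofrac_eq0 (negPf d0).
Qed.
Lemma residue_common_den r (h : 'I_r -> residue_field x) :
  exists d (a : 'I_r -> A), d \notin x /\ forall i, h i * residue x d = residue x (a i).
Proof.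
have /choice [n /choice [d hd]] : forall i, exists a t, t \notin x /\ h i * residue x t = residue x a.
  by move=> i; apply: residue_numden.
exists (\prod_i d i), (fun i => n i * \prod_(j | j != i) d j); split=> [|i].
  apply: (big_ind (fun t => t \notin x)) => [|u v ux vx|i _]; first by rewrite idealr1.
    by rewrite prime_idealrM negb_or ux.
  by have [] := hd i.
by rewrite (bigD1 i) //= !residueM mulrA (hd i).2.
Qed.
End Residue.

Section ResidueDegree.
Variables (A B : comNzRingType) (th : {rmorphism A -> B}).

(** The map [a / t |-> th a / th t], through chosen numerators and denominators; [key] makes it
    independent of the choice. *)
Lemma residue_field_map (x : prime_idealr A) (y : prime_idealr B) :
  (forall a, th a \in y <-> a \in x) ->
  exists g : {rmorphism residue_field x -> residue_field y},
    forall a, g (residue x a) = residue y (th a).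
Proof.
move=> xy.
have /choice [n /choice [d nd]] := @residue_numden _ x.
pose g z := residue y (th (n z)) / residue y (th (d z)).
have ne t : t \notin x -> residue y (th t) != 0.
  by move=> tx; apply/eqP => /residue_eq0/xy; apply/negP.
have neA t : t \notin x -> residue x t != 0 by move=> tx; apply/eqP => /residue_eq0; apply/negP.
have key z a t : t \notin x -> z * residue x t = residue x a ->
    g z * residue y (th t) = residue y (th a).
  move=> tx e; have [dx e'] := nd z; apply: (mulIf (ne _ dx)).
  rewrite mulrAC /g divfK ?ne //; apply/eqP; rewrite -subr_eq0; apply/eqP.
  rewrite -!residueM -residueB -!rmorphM -rmorphB; apply/residue_eq0/xy/residue_eq0.
  by rewrite residueB !residueM -e -e' -mulrA [residue x (d z) * _]mulrC mulrA subrr.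
have g_eq z a t v : t \notin x -> z * residue x t = residue x a ->
    v * residue y (th t) = residue y (th a) -> g z = v.
  by move=> tx e e'; apply: (mulIf (ne _ tx)); rewrite (key _ _ _ tx e).
have gD z w : g (z + w) = g z + g w.
  have [dz ez] := nd z; have [dw ew] := nd w.
  have dd : d z * d w \notin x by rewrite prime_idealrM negb_or dz dw.
  apply: (g_eq _ (n z * d w + n w * d z) _ _ dd).
    by rewrite residueD !residueM -ez -ew; ring.
  rewrite rmorphD !rmorphM residueD !residueM -(key _ _ _ dz ez) -(key _ _ _ dw ew); ring.
have gM z w : g (z * w) = g z * g w.
  have [dz ez] := nd z; have [dw ew] := nd w.
  have dd : d z * d w \notin x by rewrite prime_idealrM negb_or dz dw.
  apply: (g_eq _ (n z * n w) _ _ dd); rewrite ?rmorphM !residueM -?ez -?ew; first by ring.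
  by rewrite -(key _ _ _ dz ez) -(key _ _ _ dw ew); ring.
have one_x : 1 \notin x by rewrite idealr1.
have g1 : g 1 = 1.
  by apply: (g_eq _ 1 _ _ one_x); rewrite ?rmorph1 ?residue1 ?mulr1.
have gB z w : g (z - w) = g z - g w.
  by apply/eqP; rewrite eq_sym subr_eq -gD subrK.
pose G : {rmorphism residue_field x -> residue_field y} := HB.pack g
  (GRing.isZmodMorphism.Build _ _ g gB) (GRing.isMonoidMorphism.Build _ _ g (conj g1 gM)).
exists G => a; apply: (g_eq _ a _ _ one_x); first by rewrite residue1 mulr1.
by rewrite rmorph1 residue1 mulr1.
Qed.

(** The [b i] span all of [Frac (B / y)]: a fraction [s / t] equals [s t' / d] with [d] from [A],
    because [B / y] is algebraic over [A / x]. *)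
Lemma degree_residue (x : prime_idealr A) (y : prime_idealr B) r (b : 'I_r -> B) c
    (g : {rmorphism residue_field x -> residue_field y}) :
  rank_basis th (fun a => a \in x) (fun a => a \in y) b c ->
  (forall a, g (residue x a) = residue y (th a)) -> degree g = r.
Proof.
move=> [bi cx bg] gE; have px := prime_idealr_prime x; have py := prime_idealr_prime y.
have [idy y1 yM] := py.
have xy a : th a \in y <-> a \in x.
  split=> /residue_eq0 h; apply/residue_eq0; last by rewrite -gE h rmorph0.
  by apply/eqP; rewrite -(fmorph_eq0 g) gE h.
apply: (@degree_basis _ _ g (rmorphD g) (rmorphM g) (rmorph1 g) _ (fun i => residue y (b i))) => v.
have c0 : residue x c != 0 by apply/eqP => /residue_eq0.
have span s : exists e : 'I_r -> residue_field x, residue y s = \sum_i g (e i) * residue y (b i).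
  have [a ha] := bg s; exists (fun i => residue x (a i) / residue x c).
  have gc0 : g (residue x c) != 0 by rewrite fmorph_eq0.
  apply: (mulfI gc0); rewrite mulr_sumr gE -residueM.
  have /residue_eq0/eqP := ha; rewrite residueB subr_eq0 => /eqP ->.
  rewrite residue_sum; apply: eq_bigr => i _; rewrite residueM -!gE mulrA; congr (_ * _).
  by rewrite -rmorphM mulrC divfK.
(* A nonzero [t] of [B / y] has a nonzero multiple in [A / x]: the [r + 1] elements
   [t * b i] and [1] are linearly dependent. *)
have inv t : t \notin y -> exists d t', d \notin x /\ th d - t * t' \in y.
  move=> ty; pose u (i : 'I_r.+1) := if unlift ord0 i is Some k then t * b k else 1.
  have /choice [F hF] : forall i, exists a : 'I_r -> A, th c * u i - \sum_j th (a j) * b j \in y.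
    by move=> i; apply: bg.
  have lt : (#|'I_r| < #|'I_r.+1|)%N by rewrite !card_ord.
  have [k [[i0 ki0] hk]] := hom_sys F px lt.
  have dep : th c * (\sum_i th (k i) * u i) \in y.
    have e : th c * (\sum_i th (k i) * u i) =
        \sum_i th (k i) * (th c * u i - \sum_j th (F i j) * b j) +
        \sum_j th (\sum_i k i * F i j) * b j.
      under [X in _ = _ + X]eq_bigr => j _ do rewrite rmorph_sum mulr_suml.
      rewrite [X in _ = _ + X]exchange_big -big_split /= mulr_sumr; apply: eq_bigr => i _.
      under [X in _ = _ + X]eq_bigr => j _ do rewrite rmorphM -mulrA.
      by rewrite -mulr_sumr mulrBr subrK mulrCA.
    rewrite e; apply: (is_idealD idy); apply: (is_ideal_sum idy) => j.
      exact: (is_idealMl idy).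
    by apply: (is_idealMr idy); apply/xy/hk.
  have {}dep : \sum_i th (k i) * u i \in y.
    by have := dep; case/yM => // /xy.
  move: dep; rewrite big_ord_recl {1}/u unlift_none mulr1.
  under eq_bigr => i _ do rewrite /u liftK mulrCA.
  rewrite -mulr_sumr => dep.
  exists (k ord0), (- \sum_i th (k (lift ord0 i)) * b i); split; last by rewrite mulrN opprK.
  apply/negP => k0; apply: ki0; case: (unliftP ord0 i0) => [l ->|-> //].
  apply: (bi (fun l => k (lift ord0 l))).
  have := is_idealB idy dep (_ : th (k ord0) \in y); rewrite addrAC subrr add0r => /(_ ((xy _).2 k0)).
  by case/yM => //; rewrite (negPf ty).
have [s [t [ty e]]] := residue_numden v.
have [d [t' [dx ht]]] := inv t ty.
have [h hh] := span (s * t').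
have gd0 : g (residue x d) != 0 by rewrite fmorph_eq0; apply/eqP => /residue_eq0; apply/negP.
have dK u : g (residue x d) * g (u / residue x d) = g u.
  have d0 : residue x d != 0 by apply/eqP => /residue_eq0; apply/negP.
  have e0 : residue x d * (u / residue x d) = u by rewrite mulrC (divfK d0).
  by rewrite -[in RHS]e0 (rmorphM g).
have ev : g (residue x d) * v = residue y (s * t').
  rewrite residueM -e gE; have /residue_eq0/eqP := ht.
  by rewrite residueB subr_eq0 residueM => /eqP ->; ring.
exists [ffun i => h i / residue x d]; split.
  apply: (mulfI gd0); rewrite ev hh mulr_sumr; apply: eq_bigr => i _; rewrite ffunE mulrA.
  by rewrite dK.
move=> h' hv; apply/ffunP => i; apply/eqP; rewrite -subr_eq0; apply/eqP.
set w := [ffun i => _].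
have [D [a [Dx ha]]] := residue_common_den (fun i => w i - h' i).
have D0 : residue x D != 0 by apply/eqP => /residue_eq0; apply/negP.
suff ax : a i \in x.
  by apply: (mulIf D0); rewrite mul0r ha; apply/residue_eq0.
move: i; apply: bi; apply/residue_eq0; rewrite residue_sum.
rewrite (_ : \sum_i _ = g (residue x D) * (\sum_i g (w i) * residue y (b i) -
    \sum_i g (h' i) * residue y (b i))).
  rewrite -hv (_ : \sum_i _ = v) ?subrr ?mulr0 //.
  apply: (mulfI gd0); rewrite ev hh mulr_sumr; apply: eq_bigr => i _; rewrite ffunE mulrA.
  by rewrite dK.
rewrite -sumrB mulr_sumr; apply: eq_bigr => i _.
by rewrite residueM -gE -ha rmorphM rmorphB; ring.
Qed.
End ResidueDegree.

(** * The splitting prime and the quotient by it *)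

Section GenericDegree.
Variables (R : idomainType) (S : comAlgType R).
Let K : comAlgType R := fracAlg R.
Let inl : K -> talg K S := @generic_inl R S.

Let inlE (k : K) (k' : K) (s : S) : inl k * (tensor k' s : talg K S) = (tensor (k * k') s : talg K S).
Proof. by apply: etrans (talg_mulE k 1 k' s) _; rewrite mul1r. Qed.

Let tens_sumr I (k : K) (F : 'I_I -> S) :
  (tensor k (\sum_i F i) : talg K S) = \sum_i (tensor k (F i) : talg K S).
Proof.
pose f s : talg K S := tensor k s.
have fD : {morph f : s t / s + t} by exact: tensDr.
exact: (big_morph f fD (morphD_eq0 fD)).
Qed.

Lemma fraction_common_den r (h : 'I_r -> {fraction R}) :
  exists (d : R) (a : 'I_r -> R), d != 0 /\ forall i, h i * tofrac d = tofrac (a i).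
Proof.
have /choice [n /choice [d hd]] : forall i, exists a t : R, t != 0 /\ h i * tofrac t = tofrac a.
  by move=> i; apply: fraction_numden.
exists (\prod_i d i), (fun i => n i * \prod_(j | j != i) d j); split=> [|i].
  by apply/prodf_neq0 => i _; have [] := hd i.
by rewrite (bigD1 i) //= !tofracM mulrA (hd i).2.
Qed.

(** Each [k (x) s] is [(k / c) (x) c s] with [c s] in [\sum R b_i], which gives generation;
    independence is inherited from [S], which embeds into [K (x) S]. *)
Lemma degree_generic r (b : 'I_r -> S) c :
  injective (@generic_inr R S) ->
  rank_basis (GRing.in_alg S) (fun a => a = 0) (fun s => s = 0) b c ->
  degree (@generic_inl R S) = r.
Proof.
move=> inj [bi /eqP c0 bg].
apply: (@degree_basis K (talg K S) inl _ _ _ r (fun i => tensor 1 (b i))) => [k k'|k k'|//|v].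
- exact: tensDl.
- by rewrite inlE.
have indep (h : 'I_r -> K) : \sum_i inl (h i) * (tensor 1 (b i) : talg K S) = 0 -> forall i, h i = 0.
  move=> h0; have [d [a [d0 ha]]] := fraction_common_den h.
  have a0 i : a i = 0.
    move: i; apply: bi; apply: inj.
    have -> : @generic_inr R S 0 = 0.
      have D : {morph @generic_inr R S : s t / s + t} by exact: tensDr.
      exact: morphD_eq0 D.
    rewrite -[RHS](mulr0 (inl (tofrac d))) -h0 mulr_sumr.
    apply: etrans (tens_sumr _ _) _; apply: eq_bigr => i _.
    have aE : (a i)%:A = tofrac d * h i :> K by rewrite mulrC ha; exact: mulr1.
    rewrite !inlE mulr1 -aE -[GRing.in_alg S (a i) * b i]/((a i)%:A * b i) mulr_algl.
    by rewrite tens_balanced.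
  move=> i; have := ha i; rewrite a0 tofrac0 => /eqP; rewrite mulf_eq0 tofrac_eq0 (negPf d0) orbF.
  by move/eqP.
have span : exists e : 'I_r -> K, v = \sum_i inl (e i) * (tensor 1 (b i) : talg K S).
  elim/tens_ind: v => [k s|v w [e ->] [e' ->]]; last first.
    exists (fun i => e i + e' i); rewrite -big_split /=; apply: eq_bigr => i _.
    by rewrite !inlE !mulr1 tensDl.
  have [a /eqP] := bg s; rewrite subr_eq0 => /eqP ha.
  pose k' : K := k / tofrac c.
  have kE : k = c *: k'.
    by rewrite /k' [RHS]mulrC divfK // tofrac_eq0.
  exists (fun i => a i *: k'); rewrite kE tens_balanced -[c *: s]mulr_algl ha tens_sumr.
  apply: eq_bigr => i _; rewrite inlE mulr1 tens_balanced; congr tensor.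
  by rewrite mulr_algl.
have [e he] := span; exists [ffun i => e i]; split.
  by rewrite {1}he; apply: eq_bigr => i _; rewrite ffunE.
move=> e' he'; apply/ffunP => i; apply/eqP; rewrite ffunE -subr_eq0; apply/eqP.
move: i; apply: indep; apply/eqP.
rewrite (eq_bigr (fun i => inl (e i) * tensor 1 (b i) - inl (e' i) * tensor 1 (b i))) ?sumrB -?he -?he' ?subrr //.
move=> i _; rewrite -mulrBl; congr (_ * _); apply/eqP; rewrite eq_sym subr_eq; apply/eqP.
by rewrite /inl /generic_inl /talg_inl -[RHS]tensDl subrK.
Qed.
End GenericDegree.

(** * Stability and primality of the splitting prime *)

Section SplittingPrime.
Variables (p : nat) (A : comNzRingType) (m : idealr A).
Hypotheses (mP : local_ring m).
Variables (C : cartierAlg p A) (phi : cartierAction C).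
Notation beta := (splitting_prime m phi).

Lemma splitting_primeP x : x \in beta <-> forall e, (1 <= e)%N -> split_ideal m phi e x.
Proof.
split=> [/asboolP h e e1 k|h]; first exact: h.
by apply/asboolP => e k e1; apply: h.
Qed.

Lemma splitting_prime_ideal : is_ideal (fun x => x \in beta).
Proof.
split=> [|x y /splitting_primeP hx /splitting_primeP hy|a x /splitting_primeP hx];
  apply/splitting_primeP => e e1; have idI := split_ideal_ideal m phi e.
- exact: (is_ideal0 idI).
- by apply: (is_idealD idI); [exact: hx | exact: hy].
- by apply: (is_idealMl idI); exact: hx.
Qed.

Lemma F_pureP : F_pure m phi <-> ~ 1 \in beta.
Proof.
have idb := splitting_prime_ideal.
split=> [[_ /negP h _] //|h]; split; [exact: (is_ideal0 idb) | exact/negP |].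
by move=> a u v hu hv; apply: (is_idealD idb) => //; apply: (is_idealMl idb).
Qed.

Lemma splitting_prime_act e (k : C e) x : x \in beta -> act phi k x \in beta.
Proof.
move=> /splitting_primeP hx; apply/splitting_primeP => d d1 l.
by rewrite -act_cmul; apply: hx; rewrite addn_gt0 d1.
Qed.

(** If [x] is not in [beta], then [k . x = 1] for some [k], say of degree [e]. With [q = p ^ e],
    [y = y (k . x) = k . (y^q x)] is in [beta] when [x y] is, as [beta] is stable under [C]. *)
Lemma splitting_prime_is_prime : p \in [pchar A] -> F_pure m phi -> is_prime (fun x => x \in beta).
Proof.
move=> pA /F_pureP b1; have idb := splitting_prime_ideal; split=> // x y xy.
apply: contrapT => /not_orP[hx hy]; apply: hy.
have [k [e k1]] : exists e (k : C e), act phi k x = 1.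
  apply: contrapT => h; apply: hx; apply/splitting_primeP => e e1 k.
  apply: contrapT => /(local_unit mP)[b bk]; apply: h; exists e, (cleft b k).
  by rewrite act_cleft.
rewrite -[y]mulr1 -k1 -actZ; apply: splitting_prime_act.
rewrite -(prednK (_ : 0 < p ^ k)%N) ?expn_gt0 ?(prime_gt0 (pcharf_prime pA)) //.
by rewrite exprSr -mulrA [y * x]mulrC; apply: (is_idealMl idb).
Qed.

Lemma F_regular_pure : F_regular m phi -> F_pure m phi.
Proof. by move=> reg; apply/F_pureP => /reg/eqP; rewrite oner_eq0. Qed.
End SplittingPrime.

Section Quotient.
Variables (p : nat) (A : comNzRingType) (m : idealr A).
Hypotheses (pA : p \in [pchar A]) (mP : local_ring m) (nA : noetherian A) (fA : F_finite p A).
Variables (C : cartierAlg p A) (phi : cartierAction C).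
Hypothesis pure : F_pure m phi.
Notation beta := (splitting_prime m phi).
Notation Ab := ({ideal_quot (splitting_ideal pure)} : comNzRingType).
Definition qpi (x : A) : Ab := \pi_({ideal_quot (splitting_ideal pure)}) x.

Lemma qpi_eq x y : qpi x = qpi y <-> x - y \in beta.
Proof.
rewrite -[_ \in beta]/(x - y \in splitting_ideal pure) Quotient.idealrBE.
by split=> [/eqP|/eqP].
Qed.
Lemma qpiD : {morph qpi : x y / x + y}. Proof. by move=> x y; exact: rmorphD. Qed.
Lemma qpiB : {morph qpi : x y / x - y}. Proof. by move=> x y; exact: rmorphB. Qed.
Lemma qpiM : {morph qpi : x y / x * y}. Proof. by move=> x y; exact: rmorphM. Qed.
Lemma qpi1 : qpi 1 = 1. Proof. exact: rmorph1. Qed.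
Lemma qpi0 : qpi 0 = 0. Proof. exact: morphD_eq0 qpiD. Qed.
Lemma qpiX x n : qpi (x ^+ n) = qpi x ^+ n.
Proof. by elim: n => [|n IH]; rewrite ?qpi1 // !exprS qpiM IH. Qed.
Lemma qpi_sum (I : finType) (F : I -> A) : qpi (\sum_i F i) = \sum_i qpi (F i).
Proof. exact: (big_morph qpi qpiD qpi0). Qed.
Lemma qpi_eq0 x : qpi x = 0 <-> x \in beta.
Proof. by rewrite -qpi0 qpi_eq subr0. Qed.
Lemma qpiW (P : Ab -> Prop) : (forall x, P (qpi x)) -> forall z, P z.
Proof. by move=> h z; elim/quotW: z => x; apply: h. Qed.
Lemma qpi_repr z : qpi (repr z) = z. Proof. exact: reprK. Qed.

Notation mb := (quot_max mP pure).
Lemma qpi_max x : qpi x \in mb <-> x \in m.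
Proof.
split=> [/asboolP[y ym /qpi_eq h]|xm]; last by apply/asboolP; exists x.
by rewrite -(subrK y x) rpredD // (splitting_prime_sub mP pure).
Qed.

Lemma quot_local : local_ring mb.
Proof.
elim/qpiW => x; split=> [/qpi_max xm [y]|h].
  elim/qpiW: y => y; rewrite -qpiM -qpi1 => /qpi_eq /(splitting_prime_sub mP pure) h.
  have : 1 \in m by rewrite -(subKr (x * y) 1) rpredB // mulrC idealMr.
  by rewrite idealr1.
apply/qpi_max/mP => -[y xy]; apply: h; exists (qpi y).
by rewrite -qpiM xy qpi1.
Qed.
Lemma quot_pchar : p \in [pchar Ab].
Proof.
rewrite inE (pcharf_prime pA) /=; apply/eqP; rewrite -[RHS]qpi0 -(pcharf0 pA).
by rewrite /qpi (rmorph_nat (\pi_({ideal_quot (splitting_ideal pure)}))).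
Qed.
Lemma quot_integral : integral_ring Ab.
Proof.
elim/qpiW => x; elim/qpiW => y; rewrite -qpiM => /qpi_eq0.
have [_ _ bM] := splitting_prime_is_prime mP pA pure.
by move/bM => [] /qpi_eq0; [left | right].
Qed.
Lemma quot_noetherian : noetherian Ab.
Proof.
move=> I; pose J x := qpi x \in I.
have idJ : is_ideal J.
  split=> [|x y|a x]; rewrite /J ?qpi0 ?qpiD ?qpiM; first exact: idealr0.
    by move=> hx hy; rewrite rpredD.
  exact: idealMr.
have J1 : ~ J 1 by rewrite /J qpi1 idealr1.
have [K KJ] := idealr_of idJ J1.
have [s hs] := nA K; exists (map qpi s); elim/qpiW => x.
rewrite -[_ \in I]/(J x) -KJ hs /in_gen_ideal size_map; split=> [[c ->]|[c hc]].
  exists (fun i => qpi (c i)); rewrite qpi_sum; apply: eq_bigr => i _.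
  by rewrite qpiM (nth_map 0).
have idb := splitting_prime_ideal m phi.
have := hs (x - \sum_(i < size s) repr (c i) * s`_i).
have -> : x - \sum_(i < size s) repr (c i) * s`_i \in K.
  apply/KJ; rewrite /J qpiB hc qpi_sum (_ : _ - _ = 0) ?idealr0 //.
  apply/eqP; rewrite subr_eq0; apply/eqP; apply: eq_bigr => i _.
  by rewrite qpiM qpi_repr (nth_map 0).
move=> [/(_ isT) [d hd] _]; exists (fun i => d i + repr (c i)).
rewrite -[x](subrK (\sum_(i < size s) repr (c i) * s`_i)) hd -big_split /=.
by apply: eq_bigr => i _; rewrite mulrDl.
Qed.
Lemma quot_F_finite : F_finite p Ab.
Proof.
have [s hs] := fA; exists (map qpi s); elim/qpiW => x.
have [c ->] := hs x; exists (fun i => qpi (c i)); rewrite size_map qpi_sum.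
by apply: eq_bigr => i _; rewrite qpiM qpiX (nth_map 0).
Qed.

(** Stability of [beta] makes every element of [C_e] descend to [A / beta], and [beta] lies in [m],
    so membership in the maximal ideal can be tested before passing to the quotient. *)
Lemma quot_split_ideal e x :
  split_ideal mb (inducedAction pure) e (qpi x) <-> split_ideal m phi e x.
Proof.
split=> h k; last first.
  have /asboolP[l hl] := zvalP (k : inducedAlg pure e).
  rewrite /act /= -[zval _]/(zval (k : inducedAlg pure e)) hl.
  by apply/qpi_max/h.
pose g (z : Ab) : Ab := qpi (act phi k (repr z)).
have gE y : g (qpi y) = qpi (act phi k y).
  apply/qpi_eq.
  have -> : act phi k (repr (qpi y)) - act phi k y = act phi k (repr (qpi y) - y).
    by apply/eqP; rewrite eq_sym -subr_eq opprK -actD subrK.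
  by apply: splitting_prime_act; apply/qpi_eq; rewrite qpi_repr.
have gP : g \in @induced_pred p A m C phi pure e by apply/asboolP; exists k.
have := h (ZSub gP : inducedAlg pure e).
by rewrite /act /= gE => /qpi_max.
Qed.

(** [beta] is the intersection of the [I_e] with [e >= 1], so those of [A / beta] intersect in
    [0]. *)
Lemma quot_F_regular : F_regular mb (inducedAction pure).
Proof.
elim/qpiW => x; rewrite splitting_primeP qpi_eq0 splitting_primeP.
by split=> h e /h /quot_split_ideal.
Qed.
End Quotient.
Arguments quot_local [p A m] mP [C phi] pure.
Arguments quot_noetherian [p A m] nA [C phi] pure.
Arguments quot_integral [p A m] pA mP [C phi] pure.
Arguments quot_F_regular [p A m] mP [C phi] pure.

(** * Transfer to the splitting ratio *)

Lemma residue_degree_rank (A B : comNzRingType) (th : {rmorphism A -> B}) (P : {pred A}) (Q : {pred B})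
    r (b : 'I_r -> B) c :
  is_prime (fun a => a \in P) -> is_prime (fun a => a \in Q) -> (forall a, th a \in Q <-> a \in P) ->
  rank_basis th (fun a => a \in P) (fun a => a \in Q) b c -> residue_degree th P Q = r.
Proof.
move=> pP pQ PQ [bi cP bg].
have rb (x : prime_idealr A) (y : prime_idealr B) : x =i P -> y =i Q ->
    rank_basis th (fun a => a \in x) (fun a => a \in y) b c.
  move=> xP yQ; split=> [a h i||s]; first by rewrite xP; apply: bi; rewrite -yQ.
    by rewrite xP.
  by have [a ha] := bg s; exists a; rewrite yQ.
rewrite /residue_degree; case: xgetP => [d _ [x [y [g [xP yQ gE ->]]]]|none].
  exact: degree_residue (rb x y xP yQ) gE.
have [x xP] := prime_idealr_of pP; have [y yQ] := prime_idealr_of pQ.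
have [|g gE] := @residue_field_map _ _ th x y; first by move=> a; rewrite yQ xP.
exfalso; apply: (none (degree g)); exists x, y, g; split=> // a; apply/idP/idP; by [apply/xP|apply/yQ|move/xP|move/yQ].
Qed.

Section Transfer.
Variables (RT : realType) (p : nat) (A B : comNzRingType) (mA : idealr A) (mB : idealr B).
Hypotheses (pA : p \in [pchar A]) (pB : p \in [pchar B]) (nA : noetherian A) (nB : noetherian B).
Hypotheses (lA : local_ring mA) (lB : local_ring mB) (fA : F_finite p A) (fB : F_finite p B).
Variable th : {rmorphism A -> B}.
Hypothesis th_fin : module_finite th.
Hypothesis th_loc : forall a, a \in mA -> th a \in mB.
Variable T : B -> A.
Hypotheses (TD : {morph T : x y / x + y}) (TZ : forall a x, T (th a * x) = a * T x).
Hypothesis T1 : exists t, T t = 1.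
Variables (C : cartierAlg p A) (phi : cartierAction C) (D : cartierAlg p B) (psi : cartierAction D).
Hypothesis rel : forall e x, split_ideal mB psi e x <-> forall t, split_ideal mA phi e (T (t * x)).
Hypotheses (pureA : F_pure mA phi) (pureB : F_pure mB psi).
Notation betaA := (splitting_prime mA phi).
Notation betaB := (splitting_prime mB psi).

Lemma splitting_prime_rel x : x \in betaB <-> forall t, T (t * x) \in betaA.
Proof.
split=> [/splitting_primeP h t|h]; apply/splitting_primeP => e e1; first exact: (rel e x).1 (h e e1) t.
by apply/rel => t; move: (h t) => /splitting_primeP; apply.
Qed.

Lemma splitting_prime_contract a : th a \in betaB <-> a \in betaA.
Proof.
have idb := splitting_prime_ideal mA phi.
rewrite splitting_prime_rel; split=> [h|h t].
  by have [t t1] := T1; rewrite -[a]mulr1 -t1 -TZ mulrC.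
by rewrite mulrC TZ; apply: (is_idealMr idb).
Qed.

Variables (f r : nat) (b : 'I_r -> B) (c : A).
Hypothesis hf : has_dim (fun a => a \in mA) (frob th p 0) (fun x => x \in mB) f.
Hypothesis hb : rank_basis th (fun a => a \in betaA) (fun x => x \in betaB) b c.

Notation Aq := ({ideal_quot (splitting_ideal pureA)} : comNzRingType).
Notation Bq := ({ideal_quot (splitting_ideal pureB)} : comNzRingType).
Notation qA := (qpi pureA).
Notation qB := (qpi pureB).

Lemma quot_map : exists g : {rmorphism Aq -> Bq}, forall x, g (qA x) = qB (th x).
Proof.
pose g (z : Aq) : Bq := qB (th (repr z)).
have gE x : g (qA x) = qB (th x).
  apply/qpi_eq; rewrite -rmorphB; apply/splitting_prime_contract/(qpi_eq pureA).
  exact: qpi_repr.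
have gB : zmod_morphism g.
  by elim/qpiW => x; elim/qpiW => y; rewrite -qpiB !gE rmorphB qpiB.
have gM : monoid_morphism g.
  split; first by rewrite -(qpi1 pureA) gE rmorph1 qpi1.
  by elim/qpiW => x; elim/qpiW => y; rewrite -qpiM !gE rmorphM qpiM.
pose G : {rmorphism Aq -> Bq} := HB.pack g
  (GRing.isZmodMorphism.Build _ _ g gB) (GRing.isMonoidMorphism.Build _ _ g gM).
by exists G.
Qed.

(** [T] descends to the quotients because it maps [betaB] into [betaA], and by [splitting_prime_rel]
    the induced form has no kernel. *)
Lemma splitting_ratio_finite_ext :
  ((f%:R)%:E * pure_splitting_ratio RT lB pureB = (r%:R)%:E * pure_splitting_ratio RT lA pureA)%E.
Proof.
have [g gE] := quot_map; have [bi cb bg] := hb.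
pose T' (z : Bq) : Aq := qA (T (repr z)).
have TB x y : T (x - y) = T x - T y.
  by apply/eqP; rewrite eq_sym subr_eq -TD subrK.
have T'E x : T' (qB x) = qA (T x).
  apply/qpi_eq; rewrite -TB -[_ - _]mul1r; apply: (splitting_prime_rel _).1.
  by apply/(qpi_eq pureB); apply: qpi_repr.
rewrite /pure_splitting_ratio.
apply: (@F_signature_finite_ext RT p Aq Bq _ _ (quot_pchar pA pureA) (quot_pchar pB pureB)
  (quot_noetherian nA pureA) (quot_noetherian nB pureB) (quot_local lA pureA) (quot_local lB pureB)
  (quot_integral pA lA pureA) (quot_integral pB lB pureB) (quot_F_finite fA pureA)
  (quot_F_finite fB pureB) g _ _ _ T' _ _ _ _ _ _ _ _ (quot_F_regular lA pureA)
  (quot_F_regular lB pureB) _ f r (fun i => qB (b i)) (qA c)).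
- move=> z w; elim/(@qpiW _ _ _ _ _ pureA): z => x; elim/(@qpiW _ _ _ _ _ pureA): w => y.
  rewrite !gE => /qpi_eq h; apply/qpi_eq/splitting_prime_contract.
  by rewrite rmorphB.
- have [s hs] := th_fin; exists (map qB s); elim/qpiW => x.
  have [a ->] := hs x; exists (fun i => qA (a i)); rewrite size_map qpi_sum.
  by apply: eq_bigr => i _; rewrite qpiM gE (nth_map 0).
- by elim/qpiW => x /qpi_max/th_loc; rewrite gE => h; apply/qpi_max.
- by elim/qpiW => x; elim/qpiW => y; rewrite -qpiD !T'E TD qpiD.
- by elim/qpiW => x; elim/qpiW => y; rewrite gE -qpiM !T'E TZ qpiM.
- by have [t t1] := T1; exists (qB t); rewrite T'E t1 qpi1.
- elim/qpiW => x h; apply/qpi_eq0/splitting_prime_rel => t.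
  by apply/(qpi_eq0 pureA); rewrite -T'E qpiM h.
- move=> e; elim/qpiW => x _; rewrite quot_split_ideal rel; split=> h.
    by elim/qpiW => t; rewrite -qpiM T'E; apply/quot_split_ideal.
  by move=> t; have := h (qB t); rewrite -qpiM T'E => /quot_split_ideal.
- have [w [gw iw]] := hf.
  have E (a : 'I_f -> A) : \sum_i frob g p 0 (qA (a i)) (qB (w i)) = qB (\sum_i frob th p 0 (a i) (w i)).
    by rewrite qpi_sum; apply: eq_bigr => i _; rewrite /frob qpiM qpiX gE.
  exists (fun i => qB (w i)); split=> [|a h i].
    elim/qpiW => x; have [a ha] := gw x; exists (fun i => qA (a i)).
    by rewrite E -qpiB; apply/qpi_max.
  rewrite -(qpi_repr (a i)); apply/(qpi_max lA pureA); apply: (iw (fun i => repr (a i)) _ i).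
  have e : \sum_i frob g p 0 (qA (repr (a i))) (qB (w i)) = \sum_i frob g p 0 (a i) (qB (w i)).
    by apply: eq_bigr => j _; rewrite qpi_repr.
  by apply/(qpi_max lB pureB); rewrite -E e.
- move=> a h i; rewrite -(qpi_repr (a i)); apply/qpi_eq0.
  apply: (bi (fun i => repr (a i)) _ i); apply/(qpi_eq0 pureB).
  rewrite -{}h qpi_sum; apply: eq_bigr => j _.
  by rewrite qpiM -gE qpi_repr.
- by move/qpi_eq0.
- elim/qpiW => x; have [a ha] := bg x; exists (fun i => qA (a i)).
  rewrite gE -qpiM (_ : \sum_i _ = qB (\sum_i th (a i) * b i)); first exact/qpi_eq.
  by rewrite qpi_sum; apply: eq_bigr => i _; rewrite qpiM gE.
Qed.
End Transfer.

(** * The relation between [I_e(S)] and [I_e(R)] *)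

Section PullbackSplitIdeal.
Variables (p : nat) (R : comNzRingType) (S : comAlgType R) (pchS : p \in [pchar S]).
Variables (m : idealr R) (n : idealr S).
Hypotheses (mP : local_ring m) (nP : local_ring n).
Variable sigma : {linear S -> omega S}.
Hypotheses (sigma_Slin : forall s t x : S, sigma (s * t) x = sigma t (s * x))
  (sigma_inj : injective sigma).
Hypotheses (T_surj : forall r : R, exists s : S, sigma 1 s = r)
  (T_max : forall s : S, s \in n -> (sigma 1 s : R) \in m).
Variables (C : cartierAlg p R) (phi : cartierAction C).
Hypothesis T_trans : transposable_module phi (sigma 1).
Notation fphi := (pullbackAction pchS sigma_Slin sigma_inj T_trans).
Let T : S -> R := sigma 1.

Lemma sigma1D : {morph T : x y / x + y}.
Proof. by move=> x y; have := sigma1_lin sigma 1 x y; rewrite !scale1r. Qed.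
Lemma sigma1_alg r x : T (r%:A * x) = r * T x.
Proof. by rewrite mulr_algl; exact: sigma1Z. Qed.

Lemma act_pbtens e (k : C e) t s :
  act fphi (pbtens k t : pullback pchS C e) s = transpose T_trans k (t * s).
Proof. by rewrite /act /= (pbactE pchS sigma_Slin sigma_inj T_trans). Qed.

(** One direction is [k (T (t s)) = T (k^T (t s))] with [T] mapping [n] into [m]. For the other, if
    [k^T (t s)] had an inverse [b], then for [T v = 1] and [q = p ^ e] the value of [k] at
    [T ((v b)^q t s)] would be [T v = 1]. *)
Lemma pullback_split_ideal e s :
  split_ideal n fphi e s <-> forall t, split_ideal m phi e (T (t * s)).
Proof.
split=> [h t k|h].
  have [_ kT] := transposeP T_trans k.
  rewrite kT; apply: T_max; rewrite -act_pbtens; exact: h.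
elim/(@pbpiece_ind p R S C e) => [k t|x y hx hy]; last first.
  by rewrite act_add; apply: rpredD.
rewrite act_pbtens; apply: contrapT => /(local_unit nP)[b bk].
have [[_ kM] kT] := transposeP T_trans k.
have [v v1] := T_surj 1.
have e1 : v = transpose T_trans k ((v * b) ^+ (p ^ e) * (t * s)) by rewrite kM -mulrA bk mulr1.
have [_ m1 _] := local_prime mP; apply: m1; rewrite -v1 e1 -kT mulrA; exact: h.
Qed.
End PullbackSplitIdeal.

Theorem theoremC (RT : realType) (p : nat) (R : idomainType) (S : comAlgType R)
    (m : idealr R) (n : idealr S)
    (pchR : p \in [pchar R]) (pchS : p \in [pchar S])
    (R_noeth : noetherian R) (S_noeth : noetherian S)
    (mP : local_ring m) (nP : local_ring n)
    (R_Ffin : F_finite p R) (S_Ffin : F_finite p S)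
    (theta_inj : injective (fun r : R => r%:A : S))
    (theta_fin : module_finite (fun r : R => r%:A : S))
    (theta_loc : forall r : R, r \in m -> (r%:A : S) \in n)
    (S_S1 : serreS1 RT S)
    (LP : generic_total_fractions S)
    (sigma : {linear S -> omega S})
    (sigma_Slin : forall s t x : S, sigma (s * t) x = sigma t (s * x))
    (sigma_iso : generic_iso sigma)
    (T_surj : forall r : R, exists s : S, sigma 1 s = r)
    (T_max : forall s : S, s \in n -> (sigma 1 s : R) \in m)
    (C : cartierAlg p R) (phi : cartierAction C)
    (T_trans : transposable_module phi (sigma 1)) :
  let fC := pullback pchS C in
  let fphi : cartierAction fC :=
    pullbackAction pchS sigma_Slin (generic_iso_inj LP sigma_iso) T_trans in
  let betaR := splitting_prime m phi in
  let betaS := splitting_prime n fphi in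
  let theta := fun r : R => r%:A : S in
  [/\ forall r, (theta r \in betaS) = (r \in betaR),
      ((residue_degree theta m n)%:R%:E * splitting_ratio RT nP fphi =
       (residue_degree theta betaR betaS)%:R%:E * splitting_ratio RT mP phi)%E,
      F_pure m phi <-> F_pure n fphi,
      F_regular m phi <-> F_regular n fphi &
      F_regular m phi ->
      ((residue_degree theta m n)%:R%:E * F_signature RT n fphi =
       (degree (@generic_inl R S))%:R%:E * F_signature RT m phi)%E].
Proof.
move=> fC fphi betaR betaS theta.
pose th : {rmorphism R -> S} := GRing.in_alg S.
pose T : S -> R := sigma 1.
have sigma_inj := generic_iso_inj LP sigma_iso.
have TD : {morph T : x y / x + y} by exact: sigma1D.
have T0 : T 0 = 0 := morphD_eq0 TD.
have TZ a x : T (th a * x) = a * T x by exact: sigma1_alg.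
have T1 : exists t, T t = 1 by exact: T_surj.
have rel e x : split_ideal n fphi e x <-> forall t, split_ideal m phi e (T (t * x)).
  exact: pullback_split_ideal.
have contract a : th a \in betaS <-> a \in betaR by exact: (splitting_prime_contract TZ T1 rel).
have pureE : F_pure m phi <-> F_pure n fphi.
  by rewrite !F_pureP -(contract 1) rmorph1.
(* If the splitting prime of [R] is [0], an [x] in that of [S] has [T (t x) = 0] for all [t], so
   [x = 0] by injectivity of [sigma]. *)
have regE : F_regular m phi <-> F_regular n fphi.
  split=> reg x; split=> [|->].
  - move=> /(splitting_prime_rel rel) h; apply: (sigma1_nondeg sigma_Slin sigma_inj) => t.
    rewrite mulr0; apply: etrans (esym T0); exact/reg/h.
  - exact: (is_ideal0 (splitting_prime_ideal n fphi)).
  - by move=> /contract/reg/eqP; rewrite -(rmorph0 th) => /eqP/theta_inj.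
  - exact: (is_ideal0 (splitting_prime_ideal m phi)).
have pm := local_prime mP; have pn := local_prime nP; have [idn n1 _] := pn.
have th_loc a : th a \in n <-> a \in m.
  split=> [h|/theta_loc //]; apply: contrapT => /(local_unit mP)[b ba].
  apply: n1; rewrite -(rmorph1 th) -ba rmorphM.
  exact: (is_idealMl idn).
have ks := ext_kspace idn th_loc.
have [f hf] : exists f, has_dim (fun a => a \in m) (frob th p 0) (fun x => x \in n) f.
  have [s hs] := theta_fin; apply: (@exists_dim _ _ _ _ _ ks (size s) (local_unit mP)).
  exists (fun i => s`_i) => x; have [a ->] := hs x; exists (fun i => a (val i)).
  by rewrite subrr; apply: (is_ideal0 idn).
have fE : residue_degree theta m n = f.
  have [w [gw iw]] := hf.
  apply: (@residue_degree_rank _ _ th m n f w 1 pm pn th_loc); split; [exact: iw | by rewrite idealr1 |].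
  by move=> x; have [a ha] := gw x; exists a; rewrite rmorph1 mul1r.
rewrite fE; split; [| | exact: pureE | exact: regE |].
- by move=> r; apply/idP/idP => /contract.
- rewrite /splitting_ratio; case: pselect => pureS; case: pselect => pureR; last first.
  + by rewrite !mule0.
  + by exfalso; apply/pureS/pureE.
  + by exfalso; apply/pureR/pureE.
  have pbR := splitting_prime_is_prime mP pchR pureR.
  have pbS := splitting_prime_is_prime nP pchS pureS; have [idbS _ _] := pbS.
  have [r [b [c hb]]] := rank_basis_exists pbR idbS contract theta_fin.
  rewrite (_ : residue_degree theta betaR betaS = r); last first.
    exact: (@residue_degree_rank _ _ th betaR betaS r b c).
  exact: (@splitting_ratio_finite_ext RT p R S m n pchR pchS R_noeth S_noeth mP nP R_Ffin S_Ffin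
    th theta_fin theta_loc T TD TZ T1 C phi fC fphi rel pureR pureS f r b c hf hb).
move=> reg; have regS := regE.1 reg.
have dR : integral_ring R.
  by move=> x y /eqP; rewrite mulf_eq0 => /orP[] /eqP; [left | right].
(* [S] is a domain because its splitting prime, which is prime, is [0]. *)
have dS : integral_ring S.
  have [_ _ bM] := splitting_prime_is_prime nP pchS (F_regular_pure regS).
  by move=> x y xy; case: (bM x y) => [|/regS ->|/regS ->]; [apply/regS | left | right].
have zero_contract a : (th a = 0) <-> (a = 0).
  by split=> [|->]; rewrite ?rmorph0 // -{1}(rmorph0 th) => /theta_inj.
(* Both primes are [0] here, so the rank [r] is [[L : K]] by [degree_generic]. *)
have [r [b [c hb]]] := rank_basis_exists (integral_prime0 dR) (@frob0_ideal S) zero_contract theta_fin.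
have [genericr_inj _ _] := LP.
rewrite (degree_generic genericr_inj hb); have [bi c0 bg] := hb.
have T_nondeg x : (forall t, T (t * x) = 0) -> x = 0.
  move=> h; apply: (sigma1_nondeg sigma_Slin sigma_inj) => t.
  by rewrite mulr0; apply: etrans (esym T0); exact: h.
have b_gen x : exists a : 'I_r -> R, th c * x = \sum_i th (a i) * b i.
  by have [a /eqP] := bg x; rewrite subr_eq0 => /eqP; exists a.
exact: (@F_signature_finite_ext RT p R S m n pchR pchS R_noeth S_noeth mP nP dR dS R_Ffin S_Ffin
  th theta_inj theta_fin theta_loc T TD TZ T1 T_nondeg C phi fC fphi reg regS
  (fun e x _ => rel e x) f r b c hf bi c0 b_gen).
Qed.
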